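(* Let $n,m\in\mathbb{N}$, $p\ge 1$, and $f\in W^{1,p}(\mathbb{R}^n)$. Then, for every convex body $Q$ in $\mathbb{R}^m$ containing the origin, $$\mathcal{E}_p(Q,f)\le \|\nabla f\|_{L^p(\mathbb{R}^n)},$$ with equality when $f$ is radially symmetric. For $p=1$, the inequality extends to $f\in BV(\mathbb{R}^n)$, i.e. $\mathcal{E}_1(Q,f)\le |Df|(\mathbb{R}^n)$ for every $f\in BV(\mathbb{R}^n)$, where $|Df|(\mathbb{R}^n)$ is the total variation of $f$.
   Context: $\mathbb{R}^{nm}$ is identified with real $n\times m$ matrices: $x=(x_1,\dots,x_m)$ with $x_i\in\mathbb{R}^n$, and for $v\in\mathbb{R}^n$, $v^tx=(v^tx_1,\dots,v^tx_m)\in\mathbb{R}^m$. $|\cdot|$ is the Euclidean norm, $\mathbb{S}^{d-1}$ and $B_2^d$ are the centered unit sphere and ball of $\mathbb{R}^d$, $\mathrm{vol}_d$ is Lebesgue measure, $\omega_n=\mathrm{vol}_n(B_2^n)$, and $dv,d\theta$ on spheres denote surface measure. A convex body is a compact convex set with non-empty interior; its support function is $h_Q(x)=\max_{y\in Q}y^tx$. ''$Q$ contains the origin'' does not require it in the interior. For a convex body $Q\subset\mathbb{R}^m$ containing the origin and $p\ge1$, $\Pi_{Q,p}B_2^n$ is the convex body in $\mathbb{R}^{nm}$ (it contains the origin in its interior) with $h_{\Pi_{Q,p}B_2^n}(\theta)^p=\int_{\mathbb{S}^{n-1}}h_Q(v^t\theta)^p\,dv$, and $\Pi^\circ_{Q,p}B_2^n$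 is its polar body. Set $$d_{n,p}(Q)=(n\omega_n)^{1/p}\left(nm\,\mathrm{vol}_{nm}(\Pi^\circ_{Q,p}B_2^n)\right)^{\frac1{nm}},$$ $$\mathcal{E}_p(Q,f)=d_{n,p}(Q)\left(\int_{\mathbb{S}^{nm-1}}\left(\int_{\mathbb{R}^n}h_Q((\nabla f(z))^t\theta)^p\,dz\right)^{-\frac{nm}{p}}d\theta\right)^{-\frac1{nm}},$$ with $\mathcal{E}_p(Q,f)=0$ if $f=0$ a.e. For $p=1$ and $f\in BV(\mathbb{R}^n)$, the inner integral is $\int_{\mathbb{R}^n}h_Q(\sigma_f(z)^t\theta)\,d|Df|(z)$, where $|Df|$ is the total variation measure and $\sigma_f$ the unit vector field with $\int f\,\mathrm{div}\psi\,dv=-\int \sigma_f^t\psi\,d|Df|$ for all smooth compactly supported vector fields $\psi$. $f$ is radially symmetric if $f\circ T=f$ for every $T\in O(n)$. $W^{1,p}(\mathbb{R}^n)$ is the space of $f\in L^p$ with weak gradient in $L^p$. *)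

(* Defs.v *)
From HB Require Import structures.
From mathcomp Require Import all_boot all_order all_algebra.
From mathcomp Require Import all_classical all_reals all_analysis.
From mathcomp Require Import measurable_realfun.

Set Implicit Arguments.
Unset Strict Implicit.
Unset Printing Implicit Defensive.

Import Order.TTheory GRing.Theory Num.Theory.
Import numFieldNormedType.Exports.

Local Open Scope classical_set_scope.
Local Open Scope ring_scope.

(* R^n is 'cV[R]_n, R^m is 'rV[R]_m and R^(nm) is 'M[R]_(n, m), so that the
   vector v^t x of the scalar products of v with the columns of x is
   v^T *m x : 'rV[R]_m.  The library norm `|x| on matrices is the sup norm;
   the Euclidean norm is enorm below. *)

(* The sigma-algebra on matrices generated by the coordinates, i.e. the product
   of the Borel sigma-algebras of the entries (as the library does for tuples);
   this is the Borel sigma-algebra of R^(nm). *)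
Section measurable_matrix.
Variables (R : realType) (m n : nat).

Definition mx_coord_sets : set (set 'M[R]_(m, n)) :=
  [set A : set 'M[R]_(m, n) | exists i j, exists2 B : set (measurableTypeR R),
     measurable B & A = [set x : 'M[R]_(m, n) | B (x i j)]].

HB.instance Definition _ := @isMeasurable.Build
  (sigma_display mx_coord_sets) 'M[R]_(m, n) <<s mx_coord_sets >>
  (@sigma_algebra0 _ setT mx_coord_sets)
  (@sigma_algebraC _ mx_coord_sets)
  (@sigma_algebra_bigcup _ setT mx_coord_sets).

Lemma measurable_mx_coord (i : 'I_m) (j : 'I_n) :
  measurable_fun [set: 'M[R]_(m, n)]
    (fun x => x i j : measurableTypeR R).
Proof.
move=> _ B mB; rewrite setTI; apply: sub_sigma_algebra.
by exists i, j, B.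
Qed.

Lemma measurable_to_mx d (T : measurableType d) (f : T -> 'M[R]_(m, n)) :
  (forall i j, measurable_fun setT (fun t => f t i j : measurableTypeR R)) ->
  measurable_fun setT f.
Proof.
move=> mf; apply: (@measurability _ _ _ _ _ _ mx_coord_sets) => //.
move=> _ [_ [i [j [B mB ->]]] <-].
exact: (mf i j).
Qed.

End measurable_matrix.

Section image_measure.
Context d d' (T : measurableType d) (T' : measurableType d') (R : realType).
Variables (mu : {measure set T -> \bar R}) (X : {mfun T >-> T'}).

Definition image_measure : set T' -> \bar R := pushforward mu X.

Let image_measure0 : image_measure set0 = 0%E.
Proof. exact: measure0. Qed.

Let image_measure_ge0 A : (0 <= image_measure A)%E.
Proof. exact: measure_ge0. Qed.

Let image_measure_sigma_additive : semi_sigma_additive image_measure.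
Proof. exact: measure_semi_sigma_additive. Qed.

HB.instance Definition _ := isMeasure.Build _ _ _ image_measure
  image_measure0 image_measure_ge0 image_measure_sigma_additive.

End image_measure.

Section sigma_finite_image_measure.
Context d d' (T : measurableType d) (T' : measurableType d') (R : realType).
Variables (mu : {measure set T -> \bar R}).

Lemma image_measure_sigma_finite (X : {mfun T >-> T'}) (Y : T' -> T) :
  sigma_finite setT mu -> measurable_fun setT Y -> cancel X Y ->
  sigma_finite setT (image_measure mu X).
Proof.
move=> [F TF Foo] mY XY.
exists (fun k => Y @^-1` F k).
  by rewrite -preimage_bigcup -TF preimage_setT.
move=> k; have [mF oo] := Foo k; split.
  by rewrite -[X in measurable X]setTI; exact: mY.
rewrite /image_measure /pushforward -comp_preimage.
by rewrite (_ : Y \o X = id) ?preimage_id//; apply/funext => x /=; rewrite XY.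
Qed.

End sigma_finite_image_measure.

(* The canonical sigma-finite structure of \x is only found for
   subprobabilities, hence this lemma. *)
Lemma product_sigma_finite d1 d2 (T1 : measurableType d1)
    (T2 : measurableType d2) (R : realType)
    (m1 : {sigma_finite_measure set T1 -> \bar R})
    (m2 : {sigma_finite_measure set T2 -> \bar R}) :
  sigma_finite setT (m1 \x m2)%E.
Proof.
have /sigma_finiteP[F [TF ndF Foo]] := sigma_finiteT m1.
have /sigma_finiteP[G [TG ndG Goo]] := sigma_finiteT m2.
exists (fun k => F k `*` G k).
  rewrite -setXTT TF TG predeqE => -[x y]; split.
    move=> [/= [k _ Fkx] [l _ Gly]]; exists (maxn k l) => //; split.
    - by move: x Fkx; exact/subsetPset/ndF/leq_maxl.
    - by move: y Gly; exact/subsetPset/ndG/leq_maxr.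
  by move=> [k _ []/= ? ?]; split; exists k.
move=> k; have [? ?] := Foo k; have [? ?] := Goo k.
split; first exact: measurableX.
by rewrite product_measure1E// lte_mul_pinfty// ge0_fin_numE.
Qed.

Section lebesgue_rV.
Variable R : realType.

Definition rV_cons n (xv : measurableTypeR R * 'rV[R]_n) : 'rV[R]_(n.+1) :=
  row_mx (const_mx xv.1 : 'rV[R]_1) xv.2.

Definition rV_uncons n (v : 'rV[R]_(n.+1)) : measurableTypeR R * 'rV[R]_n :=
  (v ord0 ord0, @rsubmx R 1 1 n v).

Lemma rV_consK n : cancel (@rV_cons n) (@rV_uncons n).
Proof.
move=> [x v]; rewrite /rV_cons /rV_uncons /= row_mxKr; congr pair.
have -> : ord0 = lshift n (ord0 : 'I_1) :> 'I_(1 + n) by exact/val_inj.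
by apply: etrans (row_mxEl _ _ _ _) _; rewrite mxE.
Qed.

Lemma measurable_rV_cons n : measurable_fun setT (@rV_cons n).
Proof.
apply: measurable_to_mx => i j; rewrite /rV_cons.
case: (@split_ordP 1 n j) => k ->.
  rewrite (_ : (fun t => _) = fst); first exact: measurable_fst.
  by apply/funext => t; apply: etrans (row_mxEl _ _ _ _) _; rewrite mxE.
rewrite (_ : (fun t => _) = fun t : measurableTypeR R * 'rV[R]_n => t.2 i k); last first.
  by apply/funext => t; exact: row_mxEr.
apply: (@measurableT_comp _ _ _ _ _ _
  (fun v : 'rV[R]_n => v i k : measurableTypeR R)).
  exact: measurable_mx_coord.
exact: measurable_snd.
Qed.

Lemma measurable_rV_uncons n : measurable_fun setT (@rV_uncons n).
Proof.
apply/measurable_fun_pairP; split; first exact: measurable_mx_coord.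
apply: measurable_to_mx => i j.
rewrite (_ : (fun t => _) = fun v : 'rV[R]_n.+1 => v i (rshift 1 j)).
  exact: measurable_mx_coord.
by apply/funext => v /=; rewrite mxE.
Qed.

HB.instance Definition _ n :=
  isMeasurableFun.Build _ _ _ _ (@rV_cons n) (@measurable_rV_cons n).

Section step.
Variables (n : nat) (mu : {sigma_finite_measure set 'rV[R]_n -> \bar R}).

Definition lebesgue_rV_step : set 'rV[R]_(n.+1) -> \bar R :=
  image_measure (@lebesgue_measure R \x mu)%E (@rV_cons n).

HB.instance Definition _ := Measure.on lebesgue_rV_step.

Let lebesgue_rV_step_sigma_finite : sigma_finite setT lebesgue_rV_step.
Proof.
apply: (image_measure_sigma_finite (Y := @rV_uncons n)).
- exact: product_sigma_finite.
- exact: measurable_rV_uncons.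
- exact: rV_consK.
Qed.

HB.instance Definition _ := @Measure_isSigmaFinite.Build _ _ _
  lebesgue_rV_step lebesgue_rV_step_sigma_finite.
End step.

Fixpoint lebesgue_rV n : {sigma_finite_measure set 'rV[R]_n -> \bar R} :=
  match n with
  | 0 => dirac (0 : 'rV[R]_0)
  | n'.+1 => lebesgue_rV_step (lebesgue_rV n')
  end.

End lebesgue_rV.

Section matrix_space.
Variables (R : realType) (m n : nat).
Implicit Types (x y : 'M[R]_(m, n)).

Lemma measurable_vec_mx :
  measurable_fun setT (@vec_mx R m n : 'rV[R]_(m * n) -> 'M[R]_(m, n)).
Proof.
apply: measurable_to_mx => i j.
rewrite (_ : (fun t => _) = fun v : 'rV[R]_(m * n) => v ord0 (mxvec_index i j)).
  exact: measurable_mx_coord.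
by apply/funext => v; rewrite mxE.
Qed.

Lemma measurable_mxvec :
  measurable_fun setT (@mxvec R m n : 'M[R]_(m, n) -> 'rV[R]_(m * n)).
Proof.
apply: measurable_to_mx => i j; case/mxvec_indexP: j => k l.
rewrite ord1 (_ : (fun t => _) = fun v : 'M[R]_(m, n) => v k l).
  exact: measurable_mx_coord.
by apply/funext => v; rewrite mxvecE.
Qed.

HB.instance Definition _ :=
  isMeasurableFun.Build _ _ _ _ (@vec_mx R m n) measurable_vec_mx.

Definition lebesgue_mx : set 'M[R]_(m, n) -> \bar R :=
  image_measure (lebesgue_rV R (m * n)) (@vec_mx R m n).

HB.instance Definition _ := Measure.on lebesgue_mx.

Let lebesgue_mx_sigma_finite : sigma_finite setT lebesgue_mx.
Proof.
apply: (image_measure_sigma_finite (Y := @mxvec R m n)).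
- exact: sigma_finiteT.
- exact: measurable_mxvec.
- exact: vec_mxK.
Qed.

HB.instance Definition _ := @Measure_isSigmaFinite.Build _ _ _
  lebesgue_mx lebesgue_mx_sigma_finite.

Definition dotmx x y : R := \sum_i \sum_j x i j * y i j.

Definition enorm x : R := Num.sqrt (dotmx x x).

Definition esphere : set 'M[R]_(m, n) := [set x | enorm x = 1].

Definition eball : set 'M[R]_(m, n) := [set x | enorm x <= 1].

Lemma measurable_dotmx_diag : measurable_fun setT (fun x => dotmx x x).
Proof.
apply: measurable_sum => i; apply: measurable_sum => j.
by apply: measurable_funM; exact: measurable_mx_coord.
Qed.

Lemma dotmx_ge0 x : 0 <= dotmx x x.
Proof.
by apply: sumr_ge0 => i _; apply: sumr_ge0 => j _; rewrite -expr2 sqr_ge0.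
Qed.

Lemma measurable_enorm : measurable_fun setT enorm.
Proof.
rewrite (_ : enorm = fun x => dotmx x x `^ 2^-1).
  apply: (@measurableT_comp _ _ _ _ _ _ (@powR R ^~ 2^-1)).
    exact: measurable_powR.
  exact: measurable_dotmx_diag.
by apply/funext => x; rewrite powR12_sqrt// dotmx_ge0.
Qed.

Definition normalize x : 'M[R]_(m, n) := (enorm x)^-1 *: x.

Lemma measurable_normalize : measurable_fun setT normalize.
Proof.
apply: measurable_to_mx => i j.
rewrite (_ : (fun t => _) = fun x => dotmx x x `^ (- 2^-1) * x i j).
  apply: measurable_funM; last exact: measurable_mx_coord.
  apply: (@measurableT_comp _ _ _ _ _ _ (@powR R ^~ (- 2^-1))).
    exact: measurable_powR.
  exact: measurable_dotmx_diag.
by apply/funext => x; rewrite mxE powRN powR12_sqrt// dotmx_ge0.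
Qed.

HB.instance Definition _ :=
  isMeasurableFun.Build _ _ _ _ normalize measurable_normalize.

Definition punctured_eball : set 'M[R]_(m, n) := [set x | 0 < enorm x <= 1].

Lemma measurable_punctured_eball : measurable punctured_eball.
Proof.
rewrite (_ : punctured_eball = enorm @^-1` `]0, 1]%classic).
  by rewrite -[X in measurable X]setTI; exact: measurable_enorm.
by apply/seteqP; split => x /=; rewrite in_itv.
Qed.

(* Surface measure of the unit sphere, from polar coordinates: a set A of
   directions has measure mn times the volume of the part of the unit ball
   lying over A. *)
Definition surface_measure : set 'M[R]_(m, n) -> \bar R :=
  mscale (m * n)%:R%:nng
    (image_measure (mrestr lebesgue_mx measurable_punctured_eball) normalize).

HB.instance Definition _ := Measure.on surface_measure.

End matrix_space.
Arguments lebesgue_mx {R m n}.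
Arguments enorm {R m n} x.
Arguments esphere {R m n}.
Arguments eball {R m n}.
Arguments surface_measure {R m n}.

Section convex_bodies.
Variables (R : realType) (m n : nat).
Implicit Types K : set 'M[R]_(m, n).

Definition convex_body K :=
  [/\ compact K, convex_set (K : set (convex_lmodType 'M[R]_(m, n)))
    & K° !=set0].

Definition support_fun K (x : 'M[R]_(m, n)) : R :=
  sup [set dotmx y x | y in K].

Definition polar K : set 'M[R]_(m, n) :=
  [set x | forall y, K y -> dotmx y x <= 1].

End convex_bodies.

Section projection_body.
Variables (R : realType) (n m : nat) (p : R) (Q : set 'rV[R]_m).
Local Open Scope ereal_scope.

Definition support_Pi (theta : 'M[R]_(n, m)) : \bar R :=
  (\int[surface_measure]_(v in (esphere : set 'cV[R]_n))
     (support_fun Q (v^T *m theta) `^ p)%:E) `^ p^-1.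

(* The convex body with support function support_Pi. *)
Definition Pi_body : set 'M[R]_(n, m) :=
  [set y | forall theta, (dotmx y theta)%:E <= support_Pi theta].

Definition d_const : \bar R :=
  (n%:R%:E * lebesgue_mx (eball : set 'cV[R]_n)) `^ p^-1 *
  ((n * m)%:R%:E * lebesgue_mx (polar Pi_body)) `^ (n * m)%:R^-1.

(* J theta stands for the integral over R^n inside the energy.  The negative
   powers are written as inverses of positive powers: the inverse of \bar R
   satisfies 0^-1 = +oo and +oo^-1 = 0, whereas poweR with a negative exponent
   does not. *)
Definition energy (f : 'cV[R]_n -> R) (J : 'M[R]_(n, m) -> \bar R) : \bar R :=
  if `[< {ae lebesgue_mx, forall z, f z = 0%R} >] then 0 else
  d_const *
  ((\int[surface_measure]_(theta in esphere)
      (J theta `^ ((n * m)%:R / p))^-1) `^ (n * m)%:R^-1)^-1.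

(* E_p(Q, f), where g is the weak gradient of f. *)
Definition affine_energy (f : 'cV[R]_n -> R) (g : 'cV[R]_n -> 'cV[R]_n) :=
  energy f (fun theta => \int[lebesgue_mx]_z
    (support_fun Q ((g z)^T *m theta) `^ p)%:E).

End projection_body.

(* E_1(Q, f) for f of bounded variation, where mu is |Df| and s is sigma_f. *)
Definition affine_energy_BV (R : realType) (n m : nat) (Q : set 'rV[R]_m)
    (f : 'cV[R]_n -> R) (mu : {finite_measure set 'cV[R]_n -> \bar R})
    (s : 'cV[R]_n -> 'cV[R]_n) : \bar R :=
  energy 1 Q f (fun theta : 'M[R]_(n, m) => \int[mu]_z
    (support_fun Q ((s z)^T *m theta))%:E)%E.

Section function_spaces.
Variables (R : realType) (n : nat).
Implicit Types (f phi : 'cV[R]_n -> R) (g psi : 'cV[R]_n -> 'cV[R]_n).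

Definition partial (i : 'I_n) phi : 'cV[R]_n -> R :=
  fun x => 'D_(delta_mx i ord0) phi x.

Fixpoint of_class_C (k : nat) phi : Prop :=
  match k with
  | 0 => continuous phi
  | k'.+1 => continuous phi /\ forall i : 'I_n,
      (forall x, derivable phi x (delta_mx i ord0)) /\
      of_class_C k' (partial i phi)
  end.

Definition test_fun phi :=
  (forall k, of_class_C k phi) /\ compact (closure [set x | phi x != 0]).

Definition test_field psi := forall i, test_fun (fun x => psi x i ord0).

Definition divergence psi : 'cV[R]_n -> R :=
  fun x => \sum_i partial i (fun y => psi y i ord0) x.

Definition weak_gradient f g :=
  [/\ forall i, measurable_fun setT (fun x => g x i ord0),
      forall i (K : set 'cV[R]_n), compact K ->
        lebesgue_mx.-integrable K (fun x => (g x i ord0)%:E)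
    & forall i phi, test_fun phi ->
        (\int[lebesgue_mx]_x (f x * partial i phi x)%:E =
         - \int[lebesgue_mx]_x (g x i ord0 * phi x)%:E)%E].

Definition W1p (p : R) f :=
  f \in Lfun lebesgue_mx p%:E /\
  exists2 g, weak_gradient f g &
    forall i, (fun x => g x i ord0) \in Lfun lebesgue_mx p%:E.

Definition radially_symmetric f :=
  forall T : 'M[R]_n, T^T *m T = 1%:M ->
    {ae lebesgue_mx, forall x, f (T *m x) = f x}.

Definition variation f : \bar R :=
  ereal_sup [set (\int[lebesgue_mx]_x (f x * divergence psi x)%:E)%E |
    psi in [set psi | test_field psi /\ forall x, enorm (psi x) <= 1]].

Definition BV f := f \in Lfun lebesgue_mx 1%:E /\ (variation f < +oo)%E.

(* mu is the total variation measure |Df| and s the unit field sigma_f. *)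
Definition total_variation_decomposition f
    (mu : {finite_measure set 'cV[R]_n -> \bar R}) (s : 'cV[R]_n -> 'cV[R]_n) :=
  [/\ measurable_fun setT s,
      {ae mu, forall x, enorm (s x) = 1}
    & forall psi, test_field psi ->
        (\int[lebesgue_mx]_x (f x * divergence psi x)%:E =
         - \int[mu]_x (dotmx (s x) (psi x))%:E)%E].

End function_spaces.

(* Main.v *)
From HB Require Import structures.
From mathcomp Require Import all_boot all_order all_algebra.
From mathcomp Require Import all_classical all_reals all_analysis.
From mathcomp Require Import measurable_realfun ring lra.
Require Import Defs.

(** Write N = nm, let h be the support function of the projection body of Q,
    and for theta in R^(nm) let J theta be the integral of h_Q((grad f)^t theta)^p.

    The constant of the energy is itself a spherical integral.  The polar of
    the projection body is the set h <= 1: the nontrivial inclusion says that h,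
    which is sublinear by Minkowski's inequality, is the supremum of the linear
    functions below it ([polar_Pi_body]).  Polar coordinates then give
    N vol(h <= 1) as the integral of h^(- N) over the unit sphere
    ([volume_polar_Pi_body]).  So the theorem compares the integrals over the
    sphere of J^(- N / p) and of A^(- N / p), where A is the multiple of h^p with
    the factor given by the ratio of the p-th power of the norm of grad f and the
    area of the unit sphere of R^n.

    The comparison rests on the action of O(n) on R^(nm) by left multiplication.
    If a weight W >= 0 is invariant under it, then W J and W A have the same
    integral over the sphere ([averaging], [average_eq]): by Tonelli's theorem
    it is enough to integrate W(theta) h_Q(u^t theta)^p in theta for a fixed u,
    and this depends on |u| only, because O(n) is transitive on spheres
    ([orthogonal_transitive]) and preserves the surface measure
    ([surface_measure_orthogonal]).  Thus A is the average of J over the orbits of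
    O(n), although no integral over the group is ever formed.

    For the inequality ([spherical_power_mean], [energy_bound]), the convex
    function t^(- N / p) lies above its tangent at A theta; the linear term of the
    tangent at J theta is J times an invariant weight, so after integration it
    cancels.  This is Jensen's inequality.  The case p = 1, with |Df| in place of
    the Lebesgue measure and the unit field sigma_f in place of grad f, is the
    same computation, since the gradient enters only through a measurable field
    u and a measure for which |u|^p is integrable ([energy_le]).

    For equality, if f is radially symmetric then T^t grad f(T x) = grad f(x) for
    almost every x and each T in O(n) ([radially_symmetric_gradient]), so J is
    invariant.  The indicator functions of J > A and J < A are then admissible
    weights, hence J = A almost everywhere ([average_eq_ae]) and the two integrals
    agree.  That relation for the gradient, the equality grad f = 0 when f = 0
    almost everywhere, and the finiteness of the norm for the given weak gradient
    all follow from the uniqueness of weak gradients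
    ([tested_gradient_unique]).  It is proved with explicit test functions, which
    are products of functions exp (- 1 / t) of the coordinates and exhaust the
    indicator functions of boxes ([fundamental_lemma_boxes]). *)

Set Implicit Arguments.
Unset Strict Implicit.
Unset Printing Implicit Defensive.

Import Order.TTheory GRing.Theory Num.Theory.
Import numFieldNormedType.Exports.

Local Open Scope classical_set_scope.
Local Open Scope ring_scope.


(** * Lebesgue measure on row vectors *)

Section lebesgue_translation.
Variable R : realType.
Local Open Scope ereal_scope.

Lemma lebesgue_measure_translation (a : R) (A : set (measurableTypeR R)) :
  measurable A ->
  lebesgue_measure ((fun x => (x + a)%R) @^-1` A) = lebesgue_measure A.
Proof.
move=> mA.
have ma : measurable_fun setT (fun x : measurableTypeR R => (x + a)%R : measurableTypeR R).
  exact: measurable_funD.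
pose X : {mfun measurableTypeR R >-> measurableTypeR R} :=
  HB.pack (fun x : R => (x + a)%R) (isMeasurableFun.Build _ _ _ _ _ ma).
apply/esym; apply: (@lebesgue_measure_unique _ (image_measure lebesgue_measure X)) => //.
move=> _ [[b c]] _ <-.
rewrite /image_measure /pushforward /=.
rewrite (_ : _ @^-1` _ = `](b - a)%R, (c - a)%R]%classic); last first.
  by apply/seteqP; split => x /=; rewrite !in_itv/= ltrBlDr lerBrDr.
by rewrite !lebesgue_measure_itv/= !lte_fin ltrD2r -!EFinD opprB addrA subrK.
Qed.

Lemma ge0_integral_lebesgue_translation (a : R) (f : measurableTypeR R -> \bar R) :
  measurable_fun setT f -> (forall x, 0 <= f x) ->
  \int[lebesgue_measure]_x f (x + a)%R = \int[lebesgue_measure]_x f x.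
Proof.
move=> mf f0.
have ma : measurable_fun setT (fun x : measurableTypeR R => (x + a)%R : measurableTypeR R).
  exact: measurable_funD.
pose X : {mfun measurableTypeR R >-> measurableTypeR R} :=
  HB.pack (fun x : R => (x + a)%R) (isMeasurableFun.Build _ _ _ _ _ ma).
transitivity (\int[image_measure lebesgue_measure X]_x f x).
  by rewrite (ge0_integral_pushforward ma)//.
by apply: eq_measure_integral => A mA _; exact: lebesgue_measure_translation.
Qed.

End lebesgue_translation.

Section lebesgue_rV_integral.
Variable R : realType.
Local Open Scope ereal_scope.

Lemma ge0_integral_rV_cons n (F : 'rV[R]_n.+1 -> \bar R) :
  measurable_fun setT F -> (forall x, 0 <= F x) ->
  \int[lebesgue_rV R n.+1]_x F x =
  \int[lebesgue_measure]_x \int[lebesgue_rV R n]_v F (rV_cons (x, v)).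
Proof.
move=> mF F0.
rewrite -(@fubini_tonelli1 _ _ _ _ _ _ _ (fun z => F (rV_cons z)))//; last first.
  exact: (measurableT_comp mF (@measurable_rV_cons R n)).
apply: etrans (@ge0_integral_pushforward _ _ _ _ _ _ (@measurable_rV_cons R n)
  (lebesgue_measure \x lebesgue_rV R n) setT F measurableT mF _) _ => //.
Qed.

Lemma rV_consD n (x y : R) (v w : 'rV[R]_n) :
  (rV_cons (x, v) + rV_cons (y, w) = rV_cons (x + y, v + w))%R.
Proof.
apply/rowP => j; rewrite mxE /rV_cons; case: (@split_ordP 1 n j) => k ->.
  by rewrite !(@row_mxEl _ 1 1 n) !mxE.
by rewrite !(@row_mxEr _ 1 1 n) !mxE.
Qed.

Lemma rV_unconsK n : cancel (@rV_uncons R n) (@rV_cons R n).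
Proof.
move=> v; rewrite /rV_uncons/rV_cons; apply/rowP => j.
case: (@split_ordP 1 n j) => k ->.
  by rewrite (@row_mxEl _ 1 1 n) mxE ord1; congr (v _ _); apply/val_inj; rewrite (ord1 k).
by rewrite (@row_mxEr _ 1 1 n) mxE.
Qed.

Lemma measurable_mx_addr m n (w : 'M[R]_(m, n)) :
  measurable_fun setT (fun v : 'M[R]_(m, n) => (v + w)%R).
Proof.
apply: measurable_to_mx => i j; under eq_fun do rewrite mxE.
by apply: measurable_funD => //; exact: measurable_mx_coord.
Qed.

(** Induction on the dimension: Tonelli peels off one coordinate at a time, so
    the invariance reduces to the one-dimensional case. *)
Lemma ge0_integral_rV_translation n (w : 'rV[R]_n) (F : 'rV[R]_n -> \bar R) :
  measurable_fun setT F -> (forall x, 0 <= F x) ->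
  \int[lebesgue_rV R n]_x F (x + w)%R = \int[lebesgue_rV R n]_x F x.
Proof.
elim: n w F => [|n ih] w F mF F0.
  by apply: eq_integral => x _; congr F; apply/rowP => -[].
have mFc : measurable_fun setT (fun z => F (rV_cons z)).
  exact: (measurableT_comp mF (@measurable_rV_cons R n)).
rewrite !ge0_integral_rV_cons//; last first.
  exact: (measurableT_comp mF (measurable_mx_addr w)).
pose G (x : measurableTypeR R) := \int[lebesgue_rV R n]_v F (rV_cons (x, v)).
transitivity (\int[lebesgue_measure]_x G (x + (rV_uncons w).1)%R); last first.
  rewrite ge0_integral_lebesgue_translation//; first
    exact: (measurable_fun_fubini_tonelli_F (m2 := lebesgue_rV R n) _ mFc).
  by move=> x; exact: integral_ge0.
apply: eq_integral => x _; rewrite -(rV_unconsK w); case: (rV_uncons w) => y v.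
rewrite rV_consK /=.
under eq_integral do rewrite rV_consD.
rewrite (ih v (fun u => F (rV_cons ((x + y)%R, u))))//.
exact: (measurableT_comp mFc).
Qed.

End lebesgue_rV_integral.

Section lebesgue_rV_cube.
Variable R : realType.
Local Open Scope ereal_scope.

Lemma measurable_rV_cube n (c : R) :
  measurable [set v : 'rV[R]_n | forall j, (`|v ord0 j| <= c)%R].
Proof.
have -> : [set v : 'rV[R]_n | forall j, (`|v ord0 j| <= c)%R] =
    \bigcap_(j in [set: 'I_n]) [set v : 'rV[R]_n | (`|v ord0 j| <= c)%R].
  by apply/seteqP; split => [v h j _|v h j]; exact: h.
apply: fin_bigcap_measurable => // j _.
have -> : [set v : 'rV[R]_n | (`|v ord0 j| <= c)%R] =
    (fun v : 'rV[R]_n => v ord0 j : measurableTypeR R) @^-1` `[(-c)%R, c]%classic.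
  by apply/seteqP; split => v /=; rewrite in_itv/= ler_norml.
rewrite -[X in measurable X]setTI; exact: measurable_mx_coord.
Qed.

Lemma lebesgue_rV_cube n (c : R) : (0 <= c)%R ->
  lebesgue_rV R n [set v | forall j, (`|v ord0 j| <= c)%R] = ((2 * c) ^+ n)%:E.
Proof.
move=> c0; elim: n => [|n ih].
  rewrite /= diracE mem_set//=.
  by move=> -[].
rewrite [LHS](_ : _ = (lebesgue_measure \x lebesgue_rV R n)
   (`[(-c)%R, c]%classic `*` [set v : 'rV[R]_n | forall j, (`|v ord0 j| <= c)%R])).
  rewrite product_measure1E//; last exact: measurable_rV_cube.
  rewrite [X in X * _](lebesgue_measure_itv `[(-c)%R, c]) ih/= lte_fin.
  have [cc|] := ltP (- c)%R c; first by rewrite opprK -EFinD -EFinM exprS; congr (_ * _)%:E; ring.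
  move=> cc; have -> : c = 0%R by lra.
  by rewrite exprS mulr0 mul0r mul0e.
rewrite [LHS]/=/lebesgue_rV_step /image_measure /pushforward.
congr (_ _); apply/seteqP; split => [[x v] /= h|[x v] /= [hx hv] j].
  split.
    have := h ord0; rewrite in_itv/= -ler_norml.
    have -> : ord0 = lshift n (ord0 : 'I_1) :> 'I_(1 + n) by exact/val_inj.
    by rewrite /rV_cons (@row_mxEl _ 1 1 n) mxE.
  by move=> j; have := h (rshift 1 j); rewrite /rV_cons (@row_mxEr _ 1 1 n).
rewrite /rV_cons; case: (@split_ordP 1 n j) => k ->.
  by rewrite (@row_mxEl _ 1 1 n) mxE /= ler_norml; move: hx; rewrite in_itv.
by rewrite (@row_mxEr _ 1 1 n).
Qed.

End lebesgue_rV_cube.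

(** * Euclidean norm and orthogonal matrices *)

Section euclidean_norm.
Variables (R : realType) (m n : nat).
Implicit Types x y : 'M[R]_(m, n).

Lemma dotmx_trace x y : dotmx x y = \tr (x^T *m y).
Proof.
rewrite /dotmx /mxtrace exchange_big/=; apply: eq_bigr => j _.
by rewrite mxE; apply: eq_bigr => i _; rewrite mxE.
Qed.

Lemma dotmxC x y : dotmx x y = dotmx y x.
Proof. by apply: eq_bigr => i _; apply: eq_bigr => j _; rewrite mulrC. Qed.

Lemma dotmxDr x y z : dotmx x (y + z) = dotmx x y + dotmx x z.
Proof.
rewrite /dotmx -big_split/=; apply: eq_bigr => i _.
by rewrite -big_split/=; apply: eq_bigr => j _; rewrite mxE mulrDr.
Qed.

Lemma dotmxZr c x y : dotmx x (c *: y) = c * dotmx x y.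
Proof.
rewrite /dotmx mulr_sumr; apply: eq_bigr => i _.
by rewrite mulr_sumr; apply: eq_bigr => j _; rewrite mxE; ring.
Qed.

Lemma dotmxNr x y : dotmx x (- y) = - dotmx x y.
Proof. by rewrite -scaleN1r dotmxZr mulN1r. Qed.

Lemma dotmx0r x : dotmx x 0 = 0.
Proof. by rewrite -(scale0r 0) dotmxZr mul0r. Qed.

Lemma enormE x : enorm x ^+ 2 = dotmx x x.
Proof. by rewrite sqr_sqrtr// dotmx_ge0. Qed.

Lemma enorm_ge0 x : 0 <= enorm x. Proof. exact: sqrtr_ge0. Qed.

Lemma enorm_coord x i j : `|x i j| <= enorm x.
Proof.
rewrite -[leLHS]sqrtr_sqr; apply: ler_wsqrtr.
rewrite /dotmx (bigD1 i)//= (bigD1 j)//= -expr2 -addrA lerDl addr_ge0//.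
  by apply: sumr_ge0 => k _; rewrite -expr2 sqr_ge0.
by apply: sumr_ge0 => k _; apply: sumr_ge0 => l _; rewrite -expr2 sqr_ge0.
Qed.

Lemma enorm_le_sum x : enorm x <= \sum_i \sum_j `|x i j|.
Proof.
have s0 : 0 <= \sum_i \sum_j `|x i j|.
  by apply: sumr_ge0 => k _; apply: sumr_ge0 => l _.
rewrite -(ler_pXn2r (n:=2))// ?nnegrE ?enorm_ge0// enormE [leRHS]expr2.
rewrite mulr_suml; apply: ler_sum => i _.
rewrite mulr_suml; apply: ler_sum => j _.
rewrite -expr2 -real_normK ?num_real// expr2 ler_wpM2l//.
rewrite (bigD1 i)//= (bigD1 j)//= -addrA lerDl addr_ge0//.
  by apply: sumr_ge0 => k _.
by apply: sumr_ge0 => k _; apply: sumr_ge0 => l _.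
Qed.

Lemma enormZ c x : enorm (c *: x) = `|c| * enorm x.
Proof.
rewrite /enorm dotmxZr dotmxC dotmxZr mulrA -expr2 sqrtrM ?sqr_ge0//.
by rewrite sqrtr_sqr.
Qed.

Lemma enormN x : enorm (- x) = enorm x.
Proof. by rewrite -scaleN1r enormZ normrN1 mul1r. Qed.

Lemma enorm0 : enorm (0 : 'M[R]_(m, n)) = 0.
Proof. by rewrite -(scale0r 0) enormZ normr0 mul0r. Qed.

Lemma enorm_eq0 x : (enorm x == 0) = (x == 0).
Proof.
apply/eqP/eqP => [x0|->]; last exact: enorm0.
apply/matrixP => i j; rewrite mxE; apply/normr0_eq0/eqP.
by rewrite eq_le normr_ge0 andbT -x0 enorm_coord.
Qed.

Lemma enorm_gt0 x : (0 < enorm x) = (x != 0).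
Proof. by rewrite lt_def enorm_ge0 andbT enorm_eq0. Qed.

Lemma enorm_normalize x : x != 0 -> enorm (normalize x) = 1.
Proof.
rewrite -enorm_gt0 => x0; rewrite /normalize enormZ ger0_norm ?mulVf ?gt_eqF//.
by rewrite invr_ge0 ltW.
Qed.

Lemma normalizeK x : enorm x *: normalize x = x.
Proof.
have [->|x0] := eqVneq x 0; first by rewrite /normalize !scaler0.
by rewrite /normalize scalerA mulfV ?scale1r// enorm_eq0.
Qed.

Lemma measurable_esphere : measurable (esphere : set 'M[R]_(m, n)).
Proof.
rewrite (_ : esphere = enorm @^-1` [set 1]); last by [].
by rewrite -[X in measurable X]setTI; exact: measurable_enorm.
Qed.

Lemma measurable_eball : measurable (eball : set 'M[R]_(m, n)).
Proof.
rewrite (_ : eball = enorm @^-1` `]-oo, 1]%classic).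
  by rewrite -[X in measurable X]setTI; exact: measurable_enorm.
by apply/seteqP; split => x /=; rewrite in_itv.
Qed.

End euclidean_norm.

Section orthogonal.
Variables (R : realType) (n : nat).

Definition orthogonal_mx (T : 'M[R]_n) := T^T *m T = 1%:M.

Lemma orthogonal_mxT (T : 'M[R]_n) : orthogonal_mx T -> orthogonal_mx T^T.
Proof. by rewrite /orthogonal_mx trmxK => /mulmx1C. Qed.

Lemma orthogonal_mxK m (T : 'M[R]_n) : orthogonal_mx T ->
  cancel (mulmx T : 'M[R]_(n, m) -> _) (mulmx T^T).
Proof. by move=> oT x; rewrite mulmxA oT mul1mx. Qed.

Lemma dotmx_orthogonal m (T : 'M[R]_n) (x y : 'M[R]_(n, m)) :
  orthogonal_mx T -> dotmx (T *m x) (T *m y) = dotmx x y.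
Proof.
move=> oT; rewrite !dotmx_trace trmx_mul -mulmxA (mulmxA T^T) oT.
by rewrite mul1mx.
Qed.

Lemma enorm_orthogonal m (T : 'M[R]_n) (x : 'M[R]_(n, m)) :
  orthogonal_mx T -> enorm (T *m x) = enorm x.
Proof. by move=> oT; rewrite /enorm dotmx_orthogonal. Qed.

Lemma normalize_orthogonal m (T : 'M[R]_n) (x : 'M[R]_(n, m)) :
  orthogonal_mx T -> normalize (T *m x) = T *m normalize x.
Proof. by move=> oT; rewrite /normalize enorm_orthogonal// scalemxAr. Qed.

Lemma orthogonal_reflection (w : 'cV[R]_n) : dotmx w w = 2 ->
  orthogonal_mx (1%:M - w *m w^T).
Proof.
move=> w2.
have symT : (1%:M - w *m w^T)^T = 1%:M - w *m w^T.
  by rewrite raddfB/= trmx1 trmx_mul trmxK.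
rewrite /orthogonal_mx symT.
rewrite mulmxBl mul1mx mulmxBr mulmx1 mulmxA -(mulmxA w w^T w).
have -> : w^T *m w = 2%:M.
  apply/matrixP => i j; rewrite !ord1 mxE [RHS]mxE eqxx mulr1n -w2.
  by apply: eq_bigr => k _; rewrite big_ord1 mxE.
rewrite mul_mx_scalar -scalemxAl.
by apply/matrixP => i j; rewrite !mxE; ring.
Qed.

(** The Householder reflection along u - v exchanges two vectors of the same
    norm.  Together with the invariance of the surface measure, transitivity of
    O(n) on spheres replaces averages with respect to a Haar measure. *)
Lemma orthogonal_transitive (u v : 'cV[R]_n) : enorm u = enorm v ->
  exists2 T, orthogonal_mx T & T *m u = v.
Proof.
move=> uv; have [->|neq] := eqVneq u v.
  by exists 1%:M; rewrite ?mul1mx// /orthogonal_mx trmx1 mul1mx.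
have d0 : 0 < enorm (u - v) by rewrite enorm_gt0 subr_eq0.
have dd : dotmx (u - v) (u - v) = 2 * dotmx (u - v) u.
  have e : dotmx u u = dotmx v v by rewrite -!enormE uv.
  rewrite dotmxDr dotmxNr !(dotmxC (u - v)) !dotmxDr !dotmxNr (dotmxC v u) e.
  ring.
(* the normal vector of the reflection must have squared norm 2 *)
pose c := Num.sqrt 2 / enorm (u - v).
have c2 : c ^+ 2 * dotmx (u - v) (u - v) = 2.
  by rewrite -enormE -exprMn divfK ?gt_eqF// sqr_sqrtr.
exists (1%:M - (c *: (u - v)) *m (c *: (u - v))^T).
  by apply: orthogonal_reflection; rewrite dotmxZr dotmxC dotmxZr mulrA -expr2.
rewrite mulmxBl mul1mx -mulmxA.
have -> : (c *: (u - v))^T *m u = (c * dotmx (u - v) u)%:M.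
  apply/matrixP => i j; rewrite !ord1 mxE [RHS]mxE eqxx mulr1n mulr_sumr.
  by apply: eq_bigr => k _; rewrite big_ord1 !mxE mulrA.
rewrite mul_mx_scalar scalerA.
have -> : c * dotmx (u - v) u * c = 1.
  by apply: (@mulfI _ 2) => //; rewrite mulr1 -[RHS]c2 dd; ring.
by rewrite scale1r opprB addrC subrK.
Qed.

End orthogonal.

(** * Linear changes of variables *)

Section lebesgue_mx_invariance.
Variables (R : realType) (m n : nat).
Local Notation M := 'M[R]_(m, n).
Local Notation N := (m * n)%N.
Local Notation lambda := (@lebesgue_mx R m n).
Local Open Scope ereal_scope.

Lemma ge0_integral_lebesgue_mx (F : M -> \bar R) :
  measurable_fun setT F -> (forall x, 0 <= F x) ->
  \int[lambda]_x F x = \int[lebesgue_rV R (m * n)]_v F (vec_mx v).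
Proof.
move=> mF F0.
exact: (@ge0_integral_pushforward _ _ _ _ _ _ (@measurable_vec_mx R m n)
  (lebesgue_rV R (m * n)) setT F measurableT mF).
Qed.

Lemma ge0_integral_lebesgue_mx_translation (w : M) (F : M -> \bar R) :
  measurable_fun setT F -> (forall x, 0 <= F x) ->
  \int[lambda]_x F (x + w)%R = \int[lambda]_x F x.
Proof.
move=> mF F0; rewrite !ge0_integral_lebesgue_mx//; last first.
  exact: (measurableT_comp mF (measurable_mx_addr w)).
rewrite -[RHS](@ge0_integral_rV_translation _ _ (mxvec w))//.
  by apply: eq_integral => v _; rewrite linearD/= mxvecK.
exact: (measurableT_comp mF (@measurable_vec_mx R m n)).
Qed.

Definition cube (c : R) : set M := [set x | forall i j, (`|x i j| <= c)%R].

Lemma cube0 : cube 0 = [set 0%R].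
Proof.
apply/seteqP; split => [x h|_ -> i j]; last by rewrite mxE normr0.
by apply/matrixP => i j; apply/eqP; rewrite mxE -normr_le0; exact: h.
Qed.

Lemma measurable_cube c : measurable (cube c).
Proof.
have -> : cube c = \bigcap_(ij in [set: 'I_m * 'I_n])
    [set x : M | (`|x ij.1 ij.2| <= c)%R].
  by apply/seteqP; split => [v h ij _|v h i j]; [exact: h|exact: (h (i, j))].
apply: fin_bigcap_measurable => // -[i j] _ /=.
have -> : [set x : M | (`|x i j| <= c)%R] =
    (fun x : M => x i j : measurableTypeR R) @^-1` `[(-c)%R, c]%classic.
  by apply/seteqP; split => v /=; rewrite in_itv/= ler_norml.
by rewrite -[X in measurable X]setTI; exact: measurable_mx_coord.
Qed.

Lemma lebesgue_cube c : (0 <= c)%R -> lambda (cube c) = ((2 * c) ^+ N)%:E.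
Proof.
move=> c0; rewrite -lebesgue_rV_cube// /lebesgue_mx/image_measure/pushforward.
congr (_ _); apply/seteqP; split => v h /=.
  by move=> j; case/mxvec_indexP: j => i j; have := h i j; rewrite mxE.
by move=> i j; rewrite mxE.
Qed.

Lemma eball_sub_cube : (eball : set M) `<=` cube 1.
Proof. by move=> x x1 i j; exact: le_trans (enorm_coord _ _ _) x1. Qed.

Lemma cube_sub_eball : cube (N.+1%:R^-1) `<=` (eball : set M).
Proof.
move=> x h; rewrite /eball/=; apply: le_trans (enorm_le_sum _) _.
apply: (@le_trans _ _ (\sum_(i < m) \sum_(j < n) N.+1%:R^-1)%R).
  by apply: ler_sum => i _; apply: ler_sum => j _; exact: h.
rewrite !sumr_const !card_ord -mulrnA -[leLHS]mulr_natl (mulnC n) ler_pdivrMr//.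
by rewrite mul1r ler_nat.
Qed.

Lemma lebesgue_eball_gt0 : 0 < lambda eball.
Proof.
apply: (@lt_le_trans _ _ (lambda (cube (N.+1%:R^-1)))).
  by rewrite lebesgue_cube// lte_fin exprn_gt0// mulr_gt0.
apply: le_measure; rewrite ?inE; [exact: measurable_cube|exact: measurable_eball|].
exact: cube_sub_eball.
Qed.

Lemma lebesgue_eball_lty : lambda eball < +oo.
Proof.
apply: (@le_lt_trans _ _ (lambda (cube 1))); last by rewrite lebesgue_cube// ltry.
apply: le_measure; rewrite ?inE; [exact: measurable_eball|exact: measurable_cube|].
exact: eball_sub_cube.
Qed.

Lemma lebesgue_mx_set0 : (0 < N)%N -> lambda [set 0%R] = 0.
Proof.
move=> N0; apply/eqP; rewrite eq_le measure_ge0 andbT.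
by rewrite -cube0 lebesgue_cube// mulr0 expr0n gtn_eqF.
Qed.

Lemma measurable_mx_set0 : measurable [set 0%R : M].
Proof. by rewrite -cube0; exact: measurable_cube. Qed.

Lemma measurable_mx_sub :
  measurable_fun setT (fun z : M * M => (z.1 - z.2)%R).
Proof.
apply: measurable_to_mx => i j.
under eq_fun do rewrite !mxE.
apply: (@measurable_funB _ _ _ _ (fun z : M * M => z.1 i j) (fun z : M * M => z.2 i j)).
  exact: (measurableT_comp (measurable_mx_coord i j) measurable_fst).
exact: (measurableT_comp (measurable_mx_coord i j) measurable_snd).
Qed.

Lemma measurable_mx_add :
  measurable_fun setT (fun z : M * M => (z.1 + z.2)%R).
Proof.
apply: measurable_to_mx => i j.
under eq_fun do rewrite !mxE.
apply: (@measurable_funD _ _ _ _ (fun z : M * M => z.1 i j) (fun z : M * M => z.2 i j)).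
  exact: (measurableT_comp (measurable_mx_coord i j) measurable_fst).
exact: (measurableT_comp (measurable_mx_coord i j) measurable_snd).
Qed.

(** Invariance is required on integrals rather than on sets because it is used
    inside iterated integrals. *)
Definition translation_invariant (nu : {measure set M -> \bar R}) :=
  forall (w : M) (F : M -> \bar R), measurable_fun setT F ->
  (forall x, 0 <= F x) -> \int[nu]_x F (x + w)%R = \int[nu]_x F x.

(** Uniqueness of the translation-invariant measure up to a factor.  Both sides
    are equal to the double integral of 1_A(x) 1_B(x + y) with respect to nu in
    x and lambda in y: integrating in y first gives nu A * lambda B, while
    translating x by - y first turns the integrand into 1_A(x - y) 1_B(x), whose
    integral in y is the measure of x - A = x + A. *)
Lemma translation_invariant_symmetry (nu : {sigma_finite_measure set M -> \bar R})
    (A B : set M) :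
  translation_invariant nu -> measurable A -> measurable B ->
  (forall x, A (- x)%R = A x) ->
  nu A * lambda B = nu B * lambda A.
Proof.
move=> nuT mA mB symA.
have mE (C : set M) : measurable C -> measurable_fun setT (fun x : M => (\1_C x : R)%:E).
  by move=> mC; apply/measurable_EFinP; exact: measurable_indic.
have E0 (C : set M) x : 0 <= (\1_C x : R)%:E by rewrite lee_fin.
have iE (mu : {measure set M -> \bar R}) (C : set M) : measurable C ->
    \int[mu]_x (\1_C x)%:E = mu C.
  by move=> mC; rewrite integral_indic// setIT.
transitivity (\int[nu]_x \int[lambda]_y ((\1_A x)%:E * (\1_B (y + x)%R)%:E)).
  transitivity (\int[nu]_x ((\1_A x)%:E * lambda B)).
    by rewrite ge0_integralZr//; [rewrite iE|exact: mE].
  apply: eq_integral => x _; rewrite ge0_integralZl//.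
  - rewrite (ge0_integral_lebesgue_mx_translation x (F := fun y => (\1_B y)%:E))//.
      by rewrite iE.
    exact: mE.
  - exact: (measurableT_comp (mE _ mB) (measurable_mx_addr x)).
transitivity (\int[lambda]_y \int[nu]_x ((\1_A x)%:E * (\1_B (y + x)%R)%:E)).
  rewrite (fubini_tonelli (fun z : M * M => (\1_A z.1)%:E * (\1_B (z.2 + z.1)%R)%:E))//.
  - apply: emeasurable_funM; first exact: (measurableT_comp (mE _ mA) measurable_fst).
    apply: (measurableT_comp (mE _ mB)).
    have mswap : measurable_fun setT (fun z : M * M => (z.2, z.1)).
      by apply/measurable_fun_pairP; split; [exact: measurable_snd|exact: measurable_fst].
    exact: (measurableT_comp measurable_mx_add mswap).
transitivity (\int[lambda]_y \int[nu]_x ((\1_A (x - y)%R)%:E * (\1_B x)%:E)).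
  apply: eq_integral => y _.
  rewrite -(nuT (- y)%R (fun x => ((\1_A x)%:E * (\1_B (y + x)%R)%:E)))//.
  - by apply: eq_integral => x _; rewrite [(y + _)%R]addrC subrK.
  - apply: emeasurable_funM; first exact: mE.
    apply: (measurableT_comp (mE _ mB)).
    apply: (eq_measurable_fun (fun x : M => (x + y)%R)) => [x _|]; first by rewrite addrC.
    exact: measurable_mx_addr.
rewrite -(fubini_tonelli (fun z : M * M => (\1_A (z.1 - z.2)%R)%:E * (\1_B z.1)%:E))/=.
- transitivity (\int[nu]_x ((\1_B x)%:E * lambda A)).
    apply: eq_integral => x _.
    under eq_integral do rewrite muleC.
    rewrite ge0_integralZl//; last first.
      apply: (measurableT_comp (mE _ mA)).
      have mpair : measurable_fun setT (fun y : M => (x, y)).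
        by apply/measurable_fun_pairP; split; [exact: measurable_cst|exact: measurable_id].
      exact: (measurableT_comp measurable_mx_sub mpair).
    congr (_ * _); rewrite -(iE _ _ mA).
    rewrite -(ge0_integral_lebesgue_mx_translation (- x)%R (F := fun y => (\1_A y)%:E))//.
      apply: eq_integral => y _; rewrite !indicE -(opprB y x).
      suff -> : ((- (y - x))%R \in A) = ((y - x)%R \in A) by [].
      by apply/idP/idP; rewrite !inE symA.
    exact: mE.
  by rewrite ge0_integralZr//; [rewrite iE|exact: mE].
- apply: emeasurable_funM.
    exact: (measurableT_comp (mE _ mA) measurable_mx_sub).
  exact: (measurableT_comp (mE _ mB) measurable_fst).
- by move=> z; rewrite mule_ge0.
Qed.

End lebesgue_mx_invariance.

Section lebesgue_mx_linear.
Variables (R : realType) (m n : nat).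
Local Notation M := 'M[R]_(m, n).
Local Notation N := (m * n)%N.
Local Notation lambda := (@lebesgue_mx R m n).
Local Open Scope ereal_scope.

(** The image of the Lebesgue measure by an additive bijection is again
    translation invariant, hence a multiple of the Lebesgue measure.  The factor
    is read on a single symmetric test set A, which takes the place of the
    determinant: the ball serves for orthogonal matrices and the cube for
    dilations. *)
Lemma ge0_integral_lebesgue_mx_linear (L L' : M -> M) (c : {nonneg R}) (A : set M)
    (F : M -> \bar R) :
  measurable_fun setT L -> measurable_fun setT L' ->
  cancel L L' -> cancel L' L -> {morph L : x y / (x + y)%R} ->
  measurable A -> (forall x, A (- x)%R = A x) ->
  0 < lambda A -> lambda A < +oo -> lambda (L @^-1` A) = c%:num%:E * lambda A ->
  measurable_fun setT F -> (forall x, 0 <= F x) ->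
  \int[lambda]_x F (L x) = c%:num%:E * \int[lambda]_x F x.
Proof.
move=> mL mL' LK L'K LD mA symA A0 Aoo LA mF F0.
pose X : {mfun M >-> M} := HB.pack L (isMeasurableFun.Build _ _ _ _ _ mL).
have sf : sigma_finite setT (image_measure lambda X).
  by apply: (image_measure_sigma_finite (Y := L')) => //; exact: sigma_finiteT.
pose nu0 : {measure set M -> \bar R} := image_measure lambda X.
pose nu : {sigma_finite_measure set M -> \bar R} :=
  HB.pack (nu0 : set M -> \bar R) (Measure.class nu0)
   (@Measure_isSigmaFinite.Build _ _ _ nu0 sf).
have intE G : measurable_fun setT G -> (forall x, 0 <= G x) ->
    \int[nu]_x G x = \int[lambda]_x G (L x).
  move=> mG G0.
  exact: (@ge0_integral_pushforward _ _ _ _ _ _ mL lambda setT G measurableT mG).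
have nuT : translation_invariant nu.
  move=> w G mG G0; rewrite !intE//; last first.
    exact: (measurableT_comp mG (measurable_mx_addr w)).
  rewrite -[RHS](ge0_integral_lebesgue_mx_translation (L' w))//.
    by apply: eq_integral => x _; rewrite LD L'K.
  exact: (measurableT_comp mG mL).
have nuE B : measurable B -> nu B = c%:num%:E * lambda B.
  move=> mB; have := translation_invariant_symmetry nuT mA mB symA.
  have -> : nu A = c%:num%:E * lambda A by rewrite -LA.
  have lA : lambda A \is a fin_num by rewrite ge0_fin_numE.
  have : (0 < fine (lambda A))%R by rewrite fine_gt0// A0.
  rewrite -(fineK lA); set r := fine _ => r0 e.
  have : nu B * r%:E * (r^-1)%:E = c%:num%:E * lambda B * r%:E * (r^-1)%:E.
    by rewrite -e -!muleA; congr (_ * _); rewrite muleCA !muleA; congr (_ * _); rewrite muleC.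
  by rewrite -!muleA -EFinM mulfV ?gt_eqF// !mule1.
rewrite -intE// -ge0_integral_mscale//.
by apply: eq_measure_integral => B mB _; exact: nuE.
Qed.

Lemma measurable_mx_scale (c : R) : measurable_fun setT (fun x : M => (c *: x)%R).
Proof.
apply: measurable_to_mx => i j; under eq_fun do rewrite mxE.
by apply: measurable_funM => //; exact: measurable_mx_coord.
Qed.

Lemma measurable_mx_mull (T : 'M[R]_m) : measurable_fun setT (fun x : M => T *m x).
Proof.
apply: measurable_to_mx => i j; under eq_fun do rewrite mxE.
apply: measurable_sum => k.
by apply: measurable_funM => //; exact: measurable_mx_coord.
Qed.

Lemma ge0_integral_lebesgue_mx_orthogonal (T : 'M[R]_m) (F : M -> \bar R) :
  orthogonal_mx T -> measurable_fun setT F -> (forall x, 0 <= F x) ->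
  \int[lambda]_x F (T *m x) = \int[lambda]_x F x.
Proof.
move=> oT mF F0.
have oT' := orthogonal_mxT oT.
rewrite (ge0_integral_lebesgue_mx_linear (L' := mulmx T^T) (A := eball) (c := NngNum (@ler01 R)))//=.
- by rewrite mul1e.
- exact: measurable_mx_mull.
- exact: measurable_mx_mull.
- exact: orthogonal_mxK.
- by have := orthogonal_mxK (m := n) oT'; rewrite trmxK.
- by move=> x y; rewrite mulmxDr.
- exact: measurable_eball.
- by move=> x; rewrite /eball/= enormN.
- exact: lebesgue_eball_gt0.
- exact: lebesgue_eball_lty.
- rewrite mul1e; congr (_ _); apply/seteqP.
  by split => x; rewrite /eball/= enorm_orthogonal.
Qed.

Lemma ge0_integral_lebesgue_mx_scale (s : R) (F : M -> \bar R) :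
  (0 < s)%R -> measurable_fun setT F -> (forall x, 0 <= F x) ->
  \int[lambda]_x F (s *: x)%R = (s ^- N)%:E * \int[lambda]_x F x.
Proof.
move=> s0 mF F0.
have c0 : (0 <= s ^- N)%R by rewrite invr_ge0 exprn_ge0// ltW.
rewrite (ge0_integral_lebesgue_mx_linear (L' := fun x => (s^-1 *: x)%R) (A := @cube R m n 1%R)
  (c := NngNum c0))//=.
- exact: measurable_mx_scale.
- exact: measurable_mx_scale.
- by move=> x; rewrite scalerA mulVf ?scale1r ?gt_eqF.
- by move=> x; rewrite scalerA mulfV ?scale1r ?gt_eqF.
- by move=> x y; rewrite scalerDr.
- exact: measurable_cube.
- move=> x; apply/propext.
  by split => h i j; have := h i j; rewrite mxE normrN.
- by rewrite lebesgue_cube// lte_fin exprn_gt0.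
- by rewrite lebesgue_cube// ltry.
- rewrite [LHS](_ : _ = lambda (@cube R m n s^-1)).
    rewrite !lebesgue_cube ?invr_ge0 ?(ltW s0)// -EFinM mulr1 exprMn exprVn.
    by rewrite mulrC.
  congr (_ _); apply/seteqP; split => x h i j; have := h i j; rewrite mxE normrM (gtr0_norm s0).
    by rewrite -[s^-1%R]mulr1 ler_pdivlMl.
  by rewrite -[s^-1%R]mulr1 ler_pdivlMl.
Qed.

Lemma lebesgue_mx_preimage_scale (s : R) (A : set M) : (0 < s)%R -> measurable A ->
  lambda [set x | A (s *: x)%R] = (s ^- N)%:E * lambda A.
Proof.
move=> s0 mA.
have mE : measurable_fun setT (fun x : M => (\1_A x : R)%:E).
  by apply/measurable_EFinP; exact: measurable_indic.
have indE (B : set M) : measurable B -> \int[lambda]_x (\1_B x : R)%:E = lambda B.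
  by move=> mB; rewrite integral_indic// setIT.
rewrite -(indE _ mA) -(ge0_integral_lebesgue_mx_scale s0 mE); last first.
  by move=> x; rewrite lee_fin.
rewrite -indE//.
rewrite -[X in measurable X]setTI; exact: measurable_mx_scale.
Qed.

End lebesgue_mx_linear.

(** * Surface measure and polar coordinates *)

Section surface_integral.
Variables (R : realType) (m n : nat).
Local Notation M := 'M[R]_(m, n).
Local Notation N := (m * n)%N.
Local Notation lambda := (@lebesgue_mx R m n).
Local Notation sigma := (@surface_measure R m n).
Local Open Scope ereal_scope.

Lemma ge0_integral_mrestr d (T : measurableType d) (mu : {measure set T -> \bar R})
    (D : set T) (mD : measurable D) (F : T -> \bar R) :
  measurable_fun setT F -> (forall x, 0 <= F x) ->
  \int[mrestr mu mD]_x F x = \int[mu]_(x in D) F x.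
Proof.
move=> mF F0; rewrite (@ge0_negligible_integral _ _ _ _ setT (~` D))//=; last 2 first.
- exact: measurableC.
- by rewrite /mrestr setICl measure0.
rewrite setTD setCK; apply: eq_measure_integral => A mA AD.
by rewrite /= /mrestr setIidl.
Qed.

Lemma ge0_integral_surface (F : M -> \bar R) :
  measurable_fun setT F -> (forall x, 0 <= F x) ->
  \int[sigma]_x F x =
  (N%:R)%:E * \int[lambda]_(x in @punctured_eball R m n) F (normalize x).
Proof.
move=> mF F0; rewrite /surface_measure ge0_integral_mscale//; congr (_ * _).
rewrite -(ge0_integral_mrestr lambda (@measurable_punctured_eball R m n)) //; last first.
  exact: (measurableT_comp mF (@measurable_normalize R m n)).
exact: (@ge0_integral_pushforward _ _ _ _ _ _ (@measurable_normalize R m n)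
  (mrestr lambda (@measurable_punctured_eball R m n)) setT F measurableT mF).
Qed.

Lemma ge0_integral_esphere (F : M -> \bar R) :
  measurable_fun setT F -> (forall x, 0 <= F x) ->
  \int[sigma]_(x in esphere) F x = \int[sigma]_x F x.
Proof.
move=> mF F0; rewrite [RHS](@ge0_negligible_integral _ _ _ _ setT (~` esphere))//=.
- by rewrite setTD setCK.
- by apply: measurableC; exact: measurable_esphere.
- rewrite /surface_measure/= /mscale/= /image_measure/pushforward/= /mrestr.
  rewrite [X in lambda X](_ : _ = set0) ?measure0 ?mule0//.
  apply/seteqP; split => // x [/= h /andP[x0 _]]; apply: h.
  by rewrite /esphere/= enorm_normalize// -enorm_gt0.
Qed.

Lemma surface_measure_orthogonal (T : 'M[R]_m) (F : M -> \bar R) :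
  orthogonal_mx T -> measurable_fun setT F -> (forall x, 0 <= F x) ->
  \int[sigma]_x F (T *m x) = \int[sigma]_x F x.
Proof.
move=> oT mF F0.
have mT := @measurable_mx_mull R m n T.
rewrite !ge0_integral_surface//; last exact: measurableT_comp mF mT.
congr (_ * _); rewrite [LHS]integral_mkcond [RHS]integral_mkcond.
have mFn : measurable_fun setT (fun x : M => F (normalize x)).
  exact: (measurableT_comp mF (@measurable_normalize R m n)).
rewrite -[RHS](ge0_integral_lebesgue_mx_orthogonal oT)//.
- apply: eq_integral => x _; rewrite /patch.
  rewrite -normalize_orthogonal//; congr (if _ then _ else _).
  by apply/idP/idP; rewrite !inE/punctured_eball/= enorm_orthogonal.
- apply/(measurable_restrictT _ _).1 => //; first exact: measurable_punctured_eball.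
  exact: measurable_funS mFn.
- by move=> x; rewrite /patch; case: ifP.
Qed.

(** The restriction on the dimension excludes the one-point space, whose
    Lebesgue measure is a Dirac mass at the origin. *)
Lemma lebesgue_punctured_eball : (0 < N)%N ->
  lambda (@punctured_eball R m n) = lambda eball.
Proof.
move=> N0; have -> : eball = @punctured_eball R m n `|` [set 0%R] :> set M.
  apply/seteqP; split => x; rewrite /eball /punctured_eball/=.
    by have [->|x0 x1] := eqVneq x 0%R; [right|left; rewrite enorm_gt0 x0].
  by case=> [/andP[]//|->]; rewrite enorm0.
rewrite measureU//=; first by rewrite lebesgue_mx_set0// adde0.
- exact: measurable_punctured_eball.
- exact: measurable_mx_set0.
- by apply/seteqP; split => // x [] /= /[swap] ->; rewrite /punctured_eball/= enorm0 ltxx.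
Qed.

Lemma surface_measureT : (0 < N)%N -> sigma setT = N%:R%:E * lambda eball.
Proof.
move=> N0; rewrite -lebesgue_punctured_eball//.
rewrite /surface_measure/= /mscale/=; congr (_ * _).
by rewrite /image_measure/pushforward/= /mrestr preimage_setT setTI.
Qed.

Lemma surface_measure_fin : fin_num_fun sigma.
Proof.
move=> A mA; rewrite ge0_fin_numE//.
apply: (@le_lt_trans _ _ (N%:R%:E * lambda eball)); last first.
  by rewrite lte_mul_pinfty// ?lee_fin// lebesgue_eball_lty.
rewrite /surface_measure/= /mscale/=; apply: lee_wpmul2l; first by rewrite lee_fin.
  rewrite /image_measure/pushforward/mrestr; apply: le_measure; rewrite ?inE.
  - apply: measurableI; last exact: measurable_punctured_eball.
    by rewrite -[X in measurable X]setTI; exact: measurable_normalize.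
  - exact: measurable_eball.
  - by move=> x [_ /andP[]].
Qed.

End surface_integral.

HB.instance Definition _ (R : realType) (m n : nat) :=
  @Measure_isFinite.Build _ _ _ (@surface_measure R m n)
    (@surface_measure_fin R m n).

Lemma measurable_inv_ge0 d (T : measurableType d) (R : realType) (f : T -> R) :
  measurable_fun setT f -> (forall x, 0 <= f x) ->
  measurable_fun setT (fun x => (f x)^-1).
Proof.
move=> mf f0; rewrite (_ : (fun x => _) = (fun x => f x `^ (-1))).
  by apply: (@measurableT_comp _ _ _ _ _ _ (@powR R ^~ (-1))) => //; exact: measurable_powR.
by apply/funext => x; rewrite powR_inv1.
Qed.

(** The centre of polar coordinates, where the gauges below vanish, is
    negligible. *)
Lemma ge0_integral_eq_neq0 (R : realType) (m n : nat) (F G : 'M[R]_(m, n) -> \bar R) :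
  (0 < m * n)%N -> measurable_fun setT F -> measurable_fun setT G ->
  (forall x, 0 <= F x)%E -> (forall x, 0 <= G x)%E ->
  (forall x, x != 0 -> F x = G x) ->
  (\int[lebesgue_mx]_x F x = \int[lebesgue_mx]_x G x)%E.
Proof.
move=> N0 mF mG F0 G0 FG; apply: ge0_ae_eq_integral => //.
exists [set 0]; split.
- exact: measurable_mx_set0.
- exact: lebesgue_mx_set0.
- move=> x /= h; apply: contrapT => /eqP x0; apply: h => _; exact: FG.
Qed.

Section polar_coordinates.
Variables (R : realType) (m n : nat).
Local Notation M := 'M[R]_(m, n).
Local Notation N := (m * n)%N.
Local Notation lambda := (@lebesgue_mx R m n).
Local Notation sigma := (@surface_measure R m n).
Local Open Scope ereal_scope.
Variables (b : M -> R).
Hypothesis N0 : (0 < N)%N.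
Hypothesis mb : measurable_fun setT b.
Hypothesis b_gt0 : forall x, x != 0%R -> (0 < b x)%R.
Hypothesis bZ : forall s x, (0 < s)%R -> b (s *: x)%R = (s * b x)%R.

(** The exponent 2N makes the double integral of [star_body_volume_identity]
    decouple after rescaling either variable.  The value of the constant is the
    volume of the ball, as that identity shows when b is the norm. *)
Let tail := \int[lambda]_y
  (if (1 <= enorm y)%R then ((enorm y ^+ (2 * N))^-1)%:E else 0).

Let G (z : M * M) : \bar R :=
  if [&& (0 < enorm z.1)%R, (b z.1 <= 1)%R & (enorm z.1 <= enorm z.2)%R]
  then (enorm z.1 ^+ N * (enorm z.2 ^+ (2 * N))^-1)%:E else 0.

Let mfst_enorm : measurable_fun setT (fun z : M * M => enorm z.1).
Proof. exact: (measurableT_comp (@measurable_enorm R m n) measurable_fst). Qed.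

Let msnd_enorm : measurable_fun setT (fun z : M * M => enorm z.2).
Proof. exact: (measurableT_comp (@measurable_enorm R m n) measurable_snd). Qed.

Let mG : measurable_fun setT G.
Proof.
apply: measurable_fun_ifT => //.
  apply: measurable_and; first exact: measurable_fun_ltr.
  apply: measurable_and; last exact: measurable_fun_ler.
  by apply: measurable_fun_ler => //; exact: (measurableT_comp mb measurable_fst).
apply/measurable_EFinP; apply: measurable_funM; first exact: measurable_funX.
apply: measurable_inv_ge0; first exact: measurable_funX.
by move=> z; rewrite exprn_ge0// enorm_ge0.
Qed.

Let G_ge0 z : 0 <= G z.
Proof.
rewrite /G; case: ifP => // _; rewrite lee_fin mulr_ge0 ?invr_ge0//.
all: by rewrite exprn_ge0// enorm_ge0.
Qed.

Let ball_b : set M := [set x | (b x <= 1)%R].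

Lemma measurable_ball_b : measurable ball_b.
Proof.
rewrite (_ : ball_b = b @^-1` `]-oo, 1%R]%classic).
  by rewrite -[X in measurable X]setTI; exact: mb.
by apply/seteqP; split => x /=; rewrite in_itv.
Qed.

Let integral_G_snd x : \int[lambda]_y G (x, y) =
  if (0 < enorm x)%R && (b x <= 1)%R then tail else 0.
Proof.
rewrite /G/=; have [x0|] := boolP (0 < enorm x)%R; last by rewrite integral0.
have [bx|] := boolP (b x <= 1)%R; last by rewrite integral0.
rewrite /=; set F := (F in \int[_]_y F y).
have mF : measurable_fun setT F.
  apply: measurable_fun_ifT => //.
    by apply: measurable_fun_ler => //; exact: measurable_enorm.
  apply/measurable_EFinP; apply: measurable_funM => //; apply: measurable_inv_ge0.
    by apply: measurable_funX; exact: measurable_enorm.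
  by move=> z; rewrite exprn_ge0// enorm_ge0.
have F0 y : 0 <= F y.
  rewrite /F; case: ifP => // _.
  by rewrite lee_fin mulr_ge0 ?invr_ge0 ?exprn_ge0 ?enorm_ge0.
have sN0 : (0 < enorm x ^+ N)%R by rewrite exprn_gt0.
have -> : \int[lambda]_y F y = (enorm x ^+ N)%:E * \int[lambda]_y F (enorm x *: y)%R.
  rewrite ge0_integral_lebesgue_mx_scale// muleA -EFinM mulfV ?gt_eqF// mul1e.
  by [].
rewrite -ge0_integralZl//; last 2 first.
- exact: (measurableT_comp mF (@measurable_mx_scale R m n (enorm x))).
- by rewrite lee_fin ltW.
apply: eq_integral => y _; rewrite /F enormZ gtr0_norm// ler_pMr//.
case: ifP => _; last by rewrite mule0.
rewrite -EFinM; congr EFin; rewrite exprMn (mul2n N) -addnn (exprD (enorm x)).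
by rewrite [in LHS]invfM !mulrA mulfV ?mul1r// mulf_neq0// gt_eqF.
Qed.

Let F_fst (y x : M) : \bar R :=
  if [&& (0 < enorm x)%R, (enorm x <= 1)%R & (enorm y * b x <= 1)%R]
  then (enorm x ^+ N)%:E else 0.

Let F_fst_ge0 y x : 0 <= F_fst y x.
Proof. by rewrite /F_fst; case: ifP => // _; rewrite lee_fin exprn_ge0// enorm_ge0. Qed.

Let mF_fst : measurable_fun setT (fun z : M * M => F_fst z.2 z.1).
Proof.
apply: measurable_fun_ifT => //.
  apply: measurable_and; first exact: measurable_fun_ltr.
  apply: measurable_and; first exact: measurable_fun_ler.
  apply: measurable_fun_ler => //; apply: measurable_funM => //.
  exact: (measurableT_comp mb measurable_fst).
by apply/measurable_EFinP; exact: measurable_funX.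
Qed.

Let integral_G_fst y : y != 0%R -> \int[lambda]_x G (x, y) = \int[lambda]_x F_fst y x.
Proof.
rewrite -enorm_gt0 => y0.
have mGy : measurable_fun setT (fun x => G (x, y)).
  exact: (measurableT_comp mG (pair2_measurable y)).
have sN0 : (0 < enorm y ^+ N)%R by rewrite exprn_gt0.
have -> : \int[lambda]_x G (x, y) =
    (enorm y ^+ N)%:E * \int[lambda]_x G ((enorm y *: x)%R, y).
  rewrite (ge0_integral_lebesgue_mx_scale (F := fun x => G (x, y)))// muleA -EFinM.
  by rewrite mulfV ?gt_eqF// mul1e.
rewrite -ge0_integralZl//; last 2 first.
- exact: (measurableT_comp mGy (@measurable_mx_scale R m n (enorm y))).
- by rewrite lee_fin ltW.
apply: eq_integral => x _; rewrite /G /F_fst/= enormZ gtr0_norm// bZ//.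
rewrite pmulr_rgt0// ger_pMr// [(_ * b x <= 1)%R && _]andbC.
case: ifP => _; last by rewrite mule0.
rewrite -EFinM; congr EFin; rewrite exprMn (mul2n N) -addnn exprD.
set a := (enorm y ^+ N)%R; set c := (enorm x ^+ N)%R.
have a0 : a != 0%R by rewrite gt_eqF.
by field.
Qed.

Let m_snd : measurable_fun setT (fun x : M => \int[lambda]_y G (x, y)).
Proof. exact: (measurable_fun_fubini_tonelli_F (m2 := lambda) _ mG). Qed.

Let integral_F_snd x :
  \int[lambda]_y F_fst y x = lambda eball *
    ((fun x => ((enorm x / b x) ^+ N)%:E) \_ (@punctured_eball R m n)) x.
Proof.
rewrite /patch; case: ifPn => [|/negP]; rewrite inE /punctured_eball/=.
  move=> /andP[x0 x1]; have bx0 : (0 < b x)%R by rewrite b_gt0// -enorm_gt0.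
  have c0 : (0 <= enorm x ^+ N)%R by rewrite exprn_ge0// ltW.
  have mE : measurable [set y : M | eball (b x *: y)%R].
    rewrite -[X in measurable X]setTI.
    by apply: (@measurable_mx_scale R m n (b x)) => //; exact: measurable_eball.
  transitivity (\int[lambda]_y ((enorm x ^+ N)%:E * (\1_[set y | eball (b x *: y)%R] y)%:E)).
    apply: eq_integral => y _; rewrite /F_fst x0 x1/=.
    case: ifPn => h; first by rewrite indicE mem_set ?mule1// /eball/= enormZ gtr0_norm// mulrC.
    rewrite indicE memNset ?mule0// /eball/= enormZ gtr0_norm// mulrC; exact/negP.
  rewrite ge0_integralZl//; last by apply/measurable_EFinP; exact: measurable_indic.
  rewrite integral_indic// setIT.
  rewrite [X in _ * X](lebesgue_mx_preimage_scale bx0 (@measurable_eball R m n)).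
  by rewrite muleA -EFinM muleC expr_div_n.
move=> h; rewrite mule0; rewrite (eq_integral (cst 0)) ?integral0// => y _.
by rewrite /F_fst andbA; case: ifP => // /andP[].
Qed.

Let b_ge0 x : (0 <= b x)%R.
Proof.
have [->|/b_gt0/ltW//] := eqVneq x 0%R.
have := bZ 0%R (ltr0n R 2); rewrite scaler0 => h; lra.
Qed.

Let m_ratio : measurable_fun setT (fun x => ((enorm x / b x) ^+ N)%:E).
Proof.
apply/measurable_EFinP; apply: measurable_funX; apply: measurable_funM.
  exact: measurable_enorm.
exact: measurable_inv_ge0.
Qed.

(** Polar coordinates without a product decomposition of the space.  The
    integral over pairs (x, y) with b x <= 1 and |x| <= |y| of
    |x|^N |y|^(-2N) is computed in two ways.  Rescaling y by |x| decouples it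
    from x and gives [tail] times the volume of the body b <= 1.  Rescaling x by
    |y| leaves the integral of |x|^N over |x| <= 1 and |y| <= 1 / b x, whose
    y-part is a ball of radius 1 / b x. *)
Lemma star_body_volume_identity : tail * lambda ball_b =
  lambda eball * \int[lambda]_(x in @punctured_eball R m n) ((enorm x / b x) ^+ N)%:E.
Proof.
have tail_ge0 : 0 <= tail.
  apply: integral_ge0 => y _; case: ifP => // _.
  by rewrite lee_fin invr_ge0 exprn_ge0// enorm_ge0.
have mball : measurable_fun setT (fun x => tail * (\1_ball_b x : R)%:E).
  apply: emeasurable_funM => //; apply/measurable_EFinP; apply: measurable_indic.
  exact: measurable_ball_b.
transitivity (\int[lambda]_x \int[lambda]_y G (x, y)).
  transitivity (\int[lambda]_x (tail * (\1_ball_b x : R)%:E)).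
    rewrite ge0_integralZl//; last first.
      by apply/measurable_EFinP; apply: measurable_indic; exact: measurable_ball_b.
    by rewrite integral_indic// ?setIT//; exact: measurable_ball_b.
  apply: ge0_integral_eq_neq0 => //.
  - by move=> x; rewrite mule_ge0// lee_fin.
  - by move=> x; apply: integral_ge0 => y _; exact: G_ge0.
  - move=> x x0; rewrite integral_G_snd enorm_gt0 x0/=.
    case: ifPn => h; first by rewrite indicE mem_set ?mule1.
    by rewrite indicE memNset ?mule0//; exact/negP.
rewrite (fubini_tonelli G mG G_ge0).
transitivity (\int[lambda]_y \int[lambda]_x F_fst y x).
  apply: ge0_integral_eq_neq0 => //.
  - exact: (measurable_fun_fubini_tonelli_G (m1 := lambda) _ mG).
  - exact: (measurable_fun_fubini_tonelli_G (m1 := lambda) _ mF_fst).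
  - by move=> x; apply: integral_ge0 => y _; exact: G_ge0.
  - by move=> x; apply: integral_ge0 => y _; exact: F_fst_ge0.
rewrite -(fubini_tonelli (fun z : M * M => F_fst z.2 z.1))//=.
under eq_integral do rewrite integral_F_snd.
rewrite ge0_integralZl//; first by rewrite -integral_mkcond.
- apply/(measurable_restrictT _ _).1; first exact: measurable_punctured_eball.
  exact: measurable_funS m_ratio.
- move=> x _; rewrite /patch; case: ifP => // _.
  by rewrite lee_fin exprn_ge0// divr_ge0// enorm_ge0.
Qed.

End polar_coordinates.

Section star_body_volume.
Variables (R : realType) (m n : nat).
Local Notation M := 'M[R]_(m, n).
Local Notation N := (m * n)%N.
Local Notation lambda := (@lebesgue_mx R m n).
Local Notation sigma := (@surface_measure R m n).
Local Open Scope ereal_scope.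
Variables (b : M -> R).
Hypothesis N0 : (0 < N)%N.
Hypothesis mb : measurable_fun setT b.
Hypothesis b_gt0 : forall x, x != 0%R -> (0 < b x)%R.
Hypothesis bZ : forall s x, (0 < s)%R -> b (s *: x)%R = (s * b x)%R.

(** Taking for b the Euclidean norm in [star_body_volume_identity] shows that
    the unknown constant there is the volume of the ball, which then cancels. *)
Lemma star_body_volume :
  \int[lambda]_(x in @punctured_eball R m n) ((enorm x / b x) ^+ N)%:E =
  lambda [set x | (b x <= 1)%R].
Proof.
have enorm_id := @star_body_volume_identity R m n enorm N0 (@measurable_enorm R m n)
  (fun x => etrans (enorm_gt0 x)) _.
have := star_body_volume_identity N0 mb b_gt0 bZ.
set tail := (X in X * _ = _ -> _) in enorm_id *.
have w0 := @lebesgue_eball_gt0 R m n; have woo := @lebesgue_eball_lty R m n.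
have -> : tail = lambda eball.
  have : tail * lambda eball = lambda eball * lambda eball.
    rewrite [X in _ * X = _](_ : _ = lambda [set x : M | (enorm x <= 1)%R])//.
    rewrite enorm_id; last by move=> s x s0; rewrite enormZ gtr0_norm.
    congr (_ * _); rewrite -lebesgue_punctured_eball//.
    rewrite -[RHS]mul1e -integral_cst; last exact: measurable_punctured_eball.
    apply: eq_integral => x; rewrite inE => /andP[x0 _].
    by rewrite mulfV ?gt_eqF// expr1n.
  have wfin : lambda eball \is a fin_num by rewrite ge0_fin_numE.
  have r0 : fine (lambda eball) != 0%R by rewrite gt_eqF// fine_gt0// w0.
  rewrite -(fineK wfin); set r := fine _ => e.
  have : tail * r%:E * (r^-1)%:E = r%:E * r%:E * (r^-1)%:E by rewrite e.
  by rewrite -!muleA -EFinM mulfV// !mule1.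
have wfin : lambda eball \is a fin_num by rewrite ge0_fin_numE.
have r0 : fine (lambda eball) != 0%R by rewrite gt_eqF// fine_gt0// w0.
rewrite -(fineK wfin); set r := fine _ => e.
set X := (X in X = _); set Y := (X in _ = X).
have : (r^-1)%:E * (r%:E * Y) = (r^-1)%:E * (r%:E * X) by rewrite e.
by rewrite !muleA -EFinM mulVf// !mul1e.
Qed.

Lemma surface_integral_gauge :
  \int[sigma]_x ((b x ^+ N)^-1)%:E = N%:R%:E * lambda [set x | (b x <= 1)%R].
Proof.
have b_ge0 x : (0 <= b x)%R.
  have [->|/b_gt0/ltW//] := eqVneq x 0%R.
  have := bZ 0%R (ltr0n R 2); rewrite scaler0 => h; lra.
rewrite -star_body_volume ge0_integral_surface//.
- congr (_ * _); apply: eq_integral => x; rewrite inE => /andP[x0 _].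
  by rewrite /normalize bZ ?invr_gt0// -exprVn invfM invrK.
- apply/measurable_EFinP; apply: measurable_inv_ge0; first exact: measurable_funX.
  by move=> x; exact: exprn_ge0.
- by move=> x; rewrite lee_fin invr_ge0 exprn_ge0.
Qed.

End star_body_volume.

(** * Support functions *)

Section open_matrix_measurable.
Variables (R : realType) (m n : nat).
Local Notation M := 'M[R]_(m, n).

Lemma ball_mx_coord (x y : M) (e : R) : 0 < e ->
  (forall i j, `|x i j - y i j| < e) -> ball x e y.
Proof. by move=> e0 h; split => // i j; exact: h. Qed.

(** An open set is the union of the cubes with rational centre and radius
    1 / (k + 1) that it contains. *)
Lemma open_mx_measurable (U : set M) : open U -> measurable U.
Proof.
move=> oU.
pose C (qk : 'M[rat]_(m, n) * nat) : set M :=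
  [set x | cube qk.2.+1%:R^-1 (x - map_mx ratr qk.1)].
have mC qk : measurable (C qk).
  rewrite -[X in measurable X]setTI.
  by apply: (@measurable_mx_addr R m n (- map_mx ratr qk.1)) => //; exact: measurable_cube.
have -> : U = \bigcup_qk (if `[< C qk `<=` U >] then C qk else set0).
  apply/seteqP; split => [x Ux|x [qk _]]; last by case: asboolP => // CU /CU.
  have /nbhs_ballP[e /= e0 eU] : nbhs x U by exact: open_nbhs_nbhs.
  have e20 : 0 < e / 2 by rewrite divr_gt0.
  have [k _ /(_ k (leqnn k)) /= ke] := near_infty_natSinv_lt (PosNum e20).
  set r := k.+1%:R^-1 in ke.
  have r0 : 0 < r by rewrite invr_gt0.
  have /choice[q hq] : forall ij : 'I_m * 'I_n, exists q : rat,
      x ij.1 ij.2 - r < ratr q < x ij.1 ij.2 + r.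
    move=> [i j] /=; have : x i j - r < x i j + r by rewrite ltrD2l gtrN.
    by move=> /rat_in_itvoo[q]; rewrite in_itv/=; exists q.
  exists (\matrix_(i, j) q (i, j), k) => //.
  rewrite asboolT.
    move=> i j; rewrite !mxE ler_norml; have /andP[] := hq (i, j) => /=.
    by rewrite -/r; lra.
  move=> y Cy; apply: eU; apply: ball_mx_coord => // i j.
  have := Cy i j; rewrite !mxE /= -/r ler_norml => /andP[].
  have /andP[] := hq (i, j) => /=.
  by rewrite ltr_norml; lra.
apply: countable_bigcupT_measurable => //.
by move=> qk; case: asboolP => // _; exact: measurable0.
Qed.

Lemma continuous_mx_measurable (f : M -> R) :
  continuous f -> measurable_fun setT (f : M -> measurableTypeR R).
Proof.
move=> cf; apply: (measurability _ (RGenOpens.measurableE R)).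
move=> _ [_ [a [b ->]] <-]; rewrite setTI; apply: open_mx_measurable.
by apply: open_comp => // x _; exact: cf.
Qed.

End open_matrix_measurable.

Section support_function.
Variables (R : realType) (m : nat) (Q : set 'rV[R]_m).
Hypothesis Qbody : convex_body Q.
Hypothesis Q0 : Q 0.
Local Notation h := (support_fun Q).

Lemma convex_body_bounded : exists2 C : R, 0 < C & forall y j, Q y -> `|y ord0 j| <= C.
Proof.
have [cQ _ _] := Qbody.
have [C [_ hC]] := compact_bounded cQ.
exists (`|C| + 1); first by rewrite ltr_wpDl.
move=> y j Qy; apply: le_trans (hC _ _ y Qy); last by rewrite ltr_pwDr// ler_norm.
by rewrite [leRHS]/Num.norm /= mx_normrE; apply/bigmax_geP; right; exists (ord0, j).
Qed.

Lemma support_fun_bounded : exists2 C : R, 0 < C &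
  forall x y, Q y -> dotmx y x <= C * \sum_j `|x ord0 j|.
Proof.
have [C C0 hC] := convex_body_bounded; exists C => // x y Qy.
rewrite /dotmx big_ord1 mulr_sumr; apply: ler_sum => j _.
by rewrite (le_trans (ler_norm _))// normrM ler_wpM2r// hC.
Qed.

Lemma support_fun_has_sup x : has_sup [set dotmx y x | y in Q].
Proof.
have [C C0 hC] := support_fun_bounded.
split; first by exists (dotmx 0 x); exists 0.
by exists (C * \sum_j `|x ord0 j|) => _ [y Qy <-]; exact: hC.
Qed.

Lemma support_fun_ge x y : Q y -> dotmx y x <= h x.
Proof.
by move=> Qy; apply: ub_le_sup; [have [] := support_fun_has_sup x|exists y].
Qed.

Lemma support_fun_le x c : (forall y, Q y -> dotmx y x <= c) -> h x <= c.
Proof.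
move=> hc; apply: ge_sup; first by have [] := support_fun_has_sup x.
by move=> _ [y Qy <-]; exact: hc.
Qed.

Lemma support_fun_ge0 x : 0 <= h x.
Proof. by have := support_fun_ge x Q0; rewrite dotmxC dotmx0r. Qed.

Lemma support_fun0 : h 0 = 0.
Proof.
apply/eqP; rewrite eq_le support_fun_ge0 andbT.
by apply: support_fun_le => y _; rewrite dotmx0r.
Qed.

Lemma support_funD x y : h (x + y) <= h x + h y.
Proof.
by apply: support_fun_le => z Qz; rewrite dotmxDr lerD// support_fun_ge.
Qed.

Lemma support_funZ s x : 0 <= s -> h (s *: x) = s * h x.
Proof.
rewrite le_eqVlt => /predU1P[<-|s0]; first by rewrite scale0r support_fun0 mul0r.
have le t z : 0 < t -> h (t *: z) <= t * h z.
  move=> t0; apply: support_fun_le => y Qy.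
  by rewrite dotmxZr ler_wpM2l ?(ltW t0)// support_fun_ge.
apply/eqP; rewrite eq_le le//= -ler_pdivlMl// (le_trans _ (le _ _ _))//.
  by rewrite scalerA mulVf ?gt_eqF// scale1r.
by rewrite invr_gt0.
Qed.

Lemma support_fun_upper : exists2 C : R, 0 < C &
  forall x, h x <= C * \sum_j `|x ord0 j|.
Proof.
have [C C0 hC] := support_fun_bounded; exists C => // x.
by apply: support_fun_le => y; exact: hC.
Qed.

Lemma continuous_support_fun : continuous h.
Proof.
have [C C0 hC] := support_fun_upper.
move=> x; apply/(@cvgrPdist_le _ _ _ _ (nbhs_filter x)) => e e0.
have K0 : 0 < C * m.+1%:R by rewrite mulr_gt0.
near=> y.
have hd u v : h u - h v <= C * (m%:R * `|u - v|).
  rewrite lerBlDr -[X in h X](subrK v) (le_trans (support_funD _ _))// lerD2r.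
  rewrite (le_trans (hC _))// ler_wpM2l ?(ltW C0)//.
  rewrite mulr_natl -[X in _ *+ X](card_ord m) -sumr_const; apply: ler_sum => j _.
  rewrite [leRHS]/Num.norm /= mx_normrE; apply/bigmax_geP; right.
  by exists (ord0, j).
have small : C * (m%:R * `|x - y|) <= e.
  have : `|x - y| < e / (C * m.+1%:R).
    near: y; apply: (@cvgr_dist_lt _ _ _ _ (nbhs_filter x) id x).
      exact: cvg_id.
    exact: (@divr_gt0 R _ _ e0 K0).
  rewrite ltr_pdivlMr// => /ltW; apply: le_trans.
  rewrite mulrA [leRHS]mulrC ler_wpM2r// ler_wpM2l ?(ltW C0)//.
  by rewrite ler_nat.
rewrite ler_norml lerNl opprB; apply/andP; split.
  by apply: le_trans (hd _ _) _; rewrite distrC.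
exact: le_trans (hd _ _) _.
Unshelve. all: by end_near. Qed.

Lemma measurable_support_fun : measurable_fun setT h.
Proof. by apply: continuous_mx_measurable; exact: continuous_support_fun. Qed.

(** Q contains a ball of some radius r around an interior point y0; adding up the
    bounds on h in two opposite directions makes y0 disappear.  This is how the
    interior of Q enters when the origin is only a boundary point, in which
    case h itself may vanish in some directions. *)
Lemma support_fun_lower : exists2 r : R, 0 < r &
  forall x, r * enorm x <= h x + h (- x).
Proof.
have [_ _ [y0]] := Qbody.
rewrite /interior/= => /nbhs_ballP[r /= r0 hr].
exists r => // x; have [->|x0] := eqVneq x 0.
  by rewrite enorm0 mulr0 addr_ge0// support_fun_ge0.
have ex0 : 0 < enorm x by rewrite enorm_gt0.
have [u u1 ux] : exists2 u, enorm u = 1 & enorm x *: u = x.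
  by exists (normalize x); rewrite ?enorm_normalize ?normalizeK.
have inQ t : `|t| < r -> Q (y0 + t *: u).
  move=> tr; apply: hr; apply: ball_mx_coord => // i j.
  rewrite mxE opprD addrA subrr add0r normrN mxE normrM.
  by rewrite (le_lt_trans _ tr)// ler_piMr// -u1 enorm_coord.
have r2 : `|r / 2| < r by rewrite gtr0_norm ?divr_gt0//; lra.
have r2' : `|- (r / 2)| < r by rewrite normrN.
have hu : r <= h u + h (- u).
  have := lerD (support_fun_ge u (inQ _ r2)) (support_fun_ge (- u) (inQ _ r2')).
  apply: le_trans; rewrite dotmxNr !(dotmxC _ u) !dotmxDr !dotmxZr.
  rewrite -!enormE u1.
  by rewrite expr1n; lra.
have -> : h x + h (- x) = enorm x * (h u + h (- u)).
  by rewrite mulrDr -!support_funZ ?enorm_ge0// scalerN ux.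
by rewrite mulrC ler_wpM2l// enorm_ge0.
Qed.

End support_function.

(** * The projection body and its polar *)

Lemma half_double (R : realType) (x : \bar R) :
  (0 <= x)%E -> (2^-1%:E * (x + x) = x)%E.
Proof.
case: x => [r| |]//= _; first by rewrite -EFinD -EFinM; congr EFin; lra.
by rewrite gt0_muley// lte_fin invr_gt0.
Qed.

Section projection_kernel.
Variables (R : realType) (n m : nat) (p : R) (Q : set 'rV[R]_m).
Hypotheses (n0 : (0 < n)%N) (m0 : (0 < m)%N) (p1 : 1 <= p).
Hypothesis Qbody : convex_body Q.
Hypothesis Q0 : Q 0.
Local Notation h := (support_fun Q).
Local Notation V := 'cV[R]_n.
Local Notation M := 'M[R]_(n, m).
Local Notation sigma := (@surface_measure R n 1).
Implicit Types (u v : V) (theta : M).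

Let p0 : 0 < p. Proof. exact: lt_le_trans p1. Qed.
Let pge0 : 0 <= p. Proof. exact: ltW. Qed.
Let hge0 x : 0 <= h x. Proof. exact: support_fun_ge0. Qed.

(** The integrand shared by the projection body, where u runs over the unit
    sphere, and by the energy, where u is the gradient. *)
Definition pkernel u theta : R := h (u^T *m theta) `^ p.

Lemma pkernelE u theta : pkernel u theta = h (u^T *m theta) `^ p.
Proof. by []. Qed.

Lemma pkernel_ge0 u theta : 0 <= pkernel u theta.
Proof. exact: powR_ge0. Qed.

Lemma measurable_mx_pairing : measurable_fun setT (fun z : V * M => z.1^T *m z.2).
Proof.
apply: measurable_to_mx => i j.
apply: (eq_measurable_fun (fun z : V * M => \sum_k z.1 k i * z.2 k j)) => [z _|].
  by rewrite mxE; apply: eq_bigr => k _; rewrite mxE.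
apply: measurable_sum => k; apply: measurable_funM.
  exact: (measurableT_comp (@measurable_mx_coord R n 1 k i) measurable_fst).
exact: (measurableT_comp (@measurable_mx_coord R n m k j) measurable_snd).
Qed.

Lemma measurable_support_pairing :
  measurable_fun setT (fun z : V * M => h (z.1^T *m z.2)).
Proof.
exact: (measurableT_comp (measurable_support_fun Qbody Q0) measurable_mx_pairing).
Qed.

Lemma measurable_pkernel :
  measurable_fun setT (fun z : V * M => pkernel z.1 z.2).
Proof.
apply: (@measurableT_comp _ _ _ _ _ _ (@powR R ^~ p)); first exact: measurable_powR.
exact: measurable_support_pairing.
Qed.

Lemma measurable_pkernel1 theta : measurable_fun setT (fun u => pkernel u theta).
Proof. exact: (measurableT_comp measurable_pkernel (pair2_measurable theta)). Qed.

Lemma pkernel_orthogonal (T : 'M[R]_n) u theta : orthogonal_mx T ->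
  pkernel (T *m u) (T *m theta) = pkernel u theta.
Proof.
by move=> oT; rewrite /pkernel trmx_mul -mulmxA (mulmxA T^T) oT mul1mx.
Qed.

Lemma pkernelZl s u theta : 0 <= s -> pkernel (s *: u) theta = s `^ p * pkernel u theta.
Proof.
move=> s0; rewrite /pkernel linearZ/= -scalemxAl support_funZ//.
by rewrite powRM.
Qed.

Lemma pkernelZr s u theta : 0 <= s -> pkernel u (s *: theta) = s `^ p * pkernel u theta.
Proof.
move=> s0; rewrite /pkernel -scalemxAr support_funZ//.
by rewrite powRM.
Qed.

(** The p-th power of the support function of the projection body, over the
    whole space instead of the unit sphere on which the measure lives. *)
Definition pgauge theta : \bar R := (\int[sigma]_v (pkernel v theta)%:E)%E.

Lemma pgauge_ge0 theta : (0 <= pgauge theta)%E.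
Proof. by apply: integral_ge0 => v _; rewrite lee_fin pkernel_ge0. Qed.

Lemma measurable_EFin_pkernel1 theta :
  measurable_fun setT (fun u => (pkernel u theta)%:E).
Proof. by apply/measurable_EFinP; exact: measurable_pkernel1. Qed.

Lemma measurable_pgauge : measurable_fun setT pgauge.
Proof.
have mk : measurable_fun setT (fun z : M * V => (pkernel z.2 z.1)%:E).
  apply/measurable_EFinP.
  have mswap : measurable_fun setT (fun z : M * V => (z.2, z.1)).
    by apply/measurable_fun_pairP; split; [exact: measurable_snd|exact: measurable_fst].
  exact: (measurableT_comp measurable_pkernel mswap).
by apply: (measurable_fun_fubini_tonelli_F (m2 := sigma) _ mk) => z;
  rewrite lee_fin pkernel_ge0.
Qed.

Lemma pgauge_orthogonal (T : 'M[R]_n) theta : orthogonal_mx T ->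
  pgauge (T *m theta) = pgauge theta.
Proof.
move=> oT.
rewrite -[LHS](surface_measure_orthogonal (F := fun u => (pkernel u (T *m theta))%:E) oT).
- by apply: eq_integral => v _; rewrite pkernel_orthogonal.
- exact: measurable_EFin_pkernel1.
- by move=> v; rewrite lee_fin pkernel_ge0.
Qed.

Lemma pgaugeZ s theta : 0 <= s -> pgauge (s *: theta) = ((s `^ p)%:E * pgauge theta)%E.
Proof.
move=> s0; rewrite /pgauge -ge0_integralZl//.
- by apply: eq_integral => v _; rewrite pkernelZr// EFinM.
- exact: measurable_EFin_pkernel1.
- by move=> v _; rewrite lee_fin pkernel_ge0.
- by rewrite lee_fin powR_ge0.
Qed.

Local Opaque pkernel.

Let sigmaT : sigma setT = (n%:R%:E * lebesgue_mx (eball : set V))%E.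
Proof. by rewrite surface_measureT ?muln1. Qed.

Lemma surface_measure_gt0 : (0 < sigma setT)%E.
Proof.
by rewrite sigmaT mule_gt0 ?lebesgue_eball_gt0// lte_fin ltr0n.
Qed.

Lemma surface_measure_lty : (sigma setT < +oo)%E.
Proof.
by rewrite sigmaT lte_mul_pinfty ?lebesgue_eball_lty// lee_fin.
Qed.

(** Together with [pgauge_lower], this says that the projection body is bounded
    and has the origin in its interior. *)
Lemma pgauge_upper : exists2 C : R, 0 <= C &
  forall theta, (pgauge theta <= (C * enorm theta `^ p)%:E)%E.
Proof.
have [C C0 hC] := support_fun_upper Qbody Q0.
pose D := C * (m%:R * n%:R).
have D0 : 0 <= D by rewrite !mulr_ge0// ltW.
have sfin : sigma setT \is a fin_num by rewrite ge0_fin_numE ?surface_measure_lty.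
exists (D `^ p * fine (sigma setT)).
  by rewrite mulr_ge0 ?powR_ge0// fine_ge0.
move=> theta.
rewrite /pgauge -ge0_integral_esphere; last 2 first.
- exact: measurable_EFin_pkernel1.
- by move=> v; rewrite lee_fin pkernel_ge0.
apply: (@le_trans _ _ (\int[sigma]_(v in esphere) (D `^ p * enorm theta `^ p)%:E)%E).
  apply: ge0_le_integral => //.
  - exact: measurable_esphere.
  - by move=> v _; rewrite lee_fin pkernel_ge0.
  - exact: measurable_funS (measurable_EFin_pkernel1 theta).
  - move=> v v1; rewrite lee_fin pkernelE -powRM ?enorm_ge0//.
    apply: ge0_ler_powR; rewrite ?nnegrE ?hge0//.
      by rewrite mulr_ge0// enorm_ge0.
    apply: le_trans (hC _) _; rewrite -mulrA ler_wpM2l ?(ltW C0)//.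
    apply: (@le_trans _ _ (\sum_(j < m) \sum_(k < n) enorm theta)).
      apply: ler_sum => j _; rewrite mxE; apply: le_trans (ler_norm_sum _ _ _) _.
      apply: ler_sum => k _; rewrite mxE normrM -[leRHS]mul1r.
      by rewrite ler_pM ?enorm_coord// -(v1 : enorm v = 1) enorm_coord.
    by rewrite !sumr_const !card_ord -mulrnA -[leLHS]mulr_natl mulnC natrM.
rewrite integral_cst//; last exact: measurable_esphere.
rewrite [leRHS](_ : _ = (D `^ p * enorm theta `^ p)%:E * sigma setT)%E; last first.
  by rewrite -[in RHS](fineK sfin) -EFinM; congr EFin; ring.
apply: lee_wpmul2l; first by rewrite lee_fin mulr_ge0 ?powR_ge0.
by apply: le_measure; rewrite ?inE//; exact: measurable_esphere.
Qed.

(** A comparison kernel for [pkernel] whose integral over the sphere is a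
    multiple of |w|^p by invariance under O(n). *)
Let moment v (w : V) : R := `|dotmx v w| `^ p.

Let mmoment w : measurable_fun setT (fun v => (moment v w)%:E).
Proof.
apply/measurable_EFinP; apply: (@measurableT_comp _ _ _ _ _ _ (@powR R ^~ p)).
  exact: measurable_powR.
apply: (measurableT_comp (@normr_measurable R setT)).
apply: measurable_sum => i; apply: measurable_sum => j.
by apply: measurable_funM => //; exact: measurable_mx_coord.
Qed.

Let moment_ge0 v w : (0 <= (moment v w)%:E)%E.
Proof. by rewrite lee_fin powR_ge0. Qed.

Let e1 : V := delta_mx (Ordinal n0) ord0.

Let enorm_delta (i : 'I_n) : enorm (delta_mx i ord0 : V) = 1.
Proof.
rewrite /enorm /dotmx (bigD1 i)//= big_ord1 mxE !eqxx mulr1 big1 ?addr0 ?sqrtr1//.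
by move=> k ki; rewrite big_ord1 mxE (negbTE ki) mul0r.
Qed.

Let moment_unit (w : V) :
  (\int[sigma]_v (moment v w)%:E = (enorm w `^ p)%:E * \int[sigma]_v (moment v e1)%:E)%E.
Proof.
have [T oT Tw] : exists2 T, orthogonal_mx T & T *m w = enorm w *: e1.
  apply: orthogonal_transitive; rewrite enormZ enorm_delta mulr1 ger0_norm//.
  exact: enorm_ge0.
rewrite -(surface_measure_orthogonal (orthogonal_mxT oT))//.
rewrite -ge0_integralZl//; last by rewrite lee_fin powR_ge0.
apply: eq_integral => v _; rewrite -EFinM; congr EFin.
rewrite /moment -(dotmx_orthogonal _ _ oT) Tw mulmxA.
have /mulmx1C -> : T^T *m T = 1%:M by [].
by rewrite mul1mx dotmxZr normrM (ger0_norm (enorm_ge0 _)) powRM// enorm_ge0.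
Qed.

(** If the moment in one direction were zero, all of them would be, although on
    the unit sphere some coordinate is at least 1 / n. *)
Let moment_gt0 : (0 < \int[sigma]_v (moment v e1)%:E)%E.
Proof.
rewrite lt_def integral_ge0 ?andbT//; apply/negP => /eqP e0.
have : (\int[sigma]_v \sum_(i < n) (moment v (delta_mx i ord0))%:E = 0)%E.
  rewrite ge0_integral_sum//; apply: big1 => i _.
  by rewrite moment_unit e0 mule0.
apply/eqP; rewrite gt_eqF//.
apply: (@lt_le_trans _ _ (\int[sigma]_(v in esphere) ((n%:R^-1) `^ p)%:E)%E).
  rewrite integral_cst; last exact: measurable_esphere.
  apply: mule_gt0; first by rewrite lte_fin powR_gt0// invr_gt0 ltr0n.
  suff E : sigma esphere = sigma setT.
    by have := surface_measure_gt0; rewrite -E.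
  have := @ge0_integral_esphere R n 1 (cst 1)%E (measurable_cst _) (fun=> lee01).
  by rewrite !integral_cst ?mul1e//; exact: measurable_esphere.
rewrite -[leRHS]ge0_integral_esphere; last 2 first.
- by apply: emeasurable_sum => i.
- by move=> v; apply: sume_ge0.
apply: ge0_le_integral => //.
- exact: measurable_esphere.
- by apply: measurable_funTS; apply: emeasurable_sum => i.
move=> v v1; rewrite sumEFin lee_fin.
have [i hi] : exists i : 'I_n, n%:R^-1 <= `|v i ord0|.
  apply: contrapT => /forallNP hi.
  have : \sum_(i < n) `|v i ord0| < \sum_(i < n) n%:R^-1.
    apply: ltr_sum => [|i _]; first by apply/hasP; exists (Ordinal n0); rewrite ?mem_index_enum.
    by rewrite ltNge; apply/negP; exact: hi.
  rewrite sumr_const card_ord -[_ *+ _]mulr_natl mulfV ?gt_eqF ?ltr0n//.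
  apply/negP; rewrite -leNgt -(v1 : enorm v = 1).
  apply: le_trans (enorm_le_sum _) _.
  by apply: ler_sum => k _; rewrite big_ord1.
rewrite (bigD1 i)//= -[leLHS]addr0 lerD//.
  rewrite /moment; apply: ge0_ler_powR => //; rewrite ?nnegrE ?invr_ge0//.
  apply: (le_trans hi); rewrite /dotmx (bigD1 i)//= big_ord1 mxE !eqxx mulr1.
  rewrite big1 ?addr0// => k ki.
  by rewrite big_ord1 mxE (negbTE ki) mulr0.
by apply: sumr_ge0 => k _; exact: powR_ge0.
Qed.

Let orthogonalN1 : orthogonal_mx (- 1%:M : 'M[R]_n).
Proof.
have symN : (- 1%:M : 'M[R]_n)^T = - 1%:M by rewrite raddfN/= trmx1.
by rewrite /orthogonal_mx symN mulNmx mulmxN opprK mul1mx.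
Qed.

Lemma support_fun_symmetrized_lower (r : R) (x : 'rV[R]_m) j : 0 < r ->
  (forall y, r * enorm y <= h y + h (- y)) ->
  (r / 2 * `|x ord0 j|) `^ p <= h x `^ p + h (- x) `^ p.
Proof.
move=> r0 hr; have hs := hr x.
have r20 : 0 <= r / 2 by rewrite divr_ge0// ltW.
have hx : r / 2 * `|x ord0 j| <= r / 2 * enorm x by rewrite ler_wpM2l// enorm_coord.
have nn : 0 <= r / 2 * `|x ord0 j| by rewrite mulr_ge0.
have [hl|hl] := leP (h (- x)) (h x).
  apply: (@le_trans _ _ (h x `^ p)); last by rewrite lerDl powR_ge0.
  by apply: ge0_ler_powR; rewrite ?nnegrE ?pge0 ?hge0 ?nn//; lra.
apply: (@le_trans _ _ (h (- x) `^ p)); last by rewrite lerDr powR_ge0.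
by apply: ge0_ler_powR; rewrite ?nnegrE ?pge0 ?hge0 ?nn//; lra.
Qed.

(** Since h may vanish on a half-space, the integrand is first symmetrized
    under v -> - v.  The sum h x + h (- x) is bounded below by a multiple of
    |x|, hence by the absolute value of any coordinate of x = v^t theta, that is
    of the product of v with a column of theta; some column has norm comparable
    to that of theta. *)
Lemma pgauge_lower : exists2 c : R, 0 < c &
  forall theta, ((c * enorm theta `^ p)%:E <= pgauge theta)%E.
Proof.
have [r r0 hr] := support_fun_lower Qbody Q0.
have r20 : 0 < r / 2 by rewrite divr_gt0.
have [d d0 hd] : exists2 d : R, 0 < d & (d%:E <= \int[sigma]_v (moment v e1)%:E)%E.
  case: (\int[sigma]_v (moment v e1)%:E)%E moment_gt0 => // [d|] d0; first by exists d.
  by exists 1 => //; rewrite leey.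
pose N1 : R := (n * m).+1%:R.
have N10 : 0 < N1 by [].
exists (2^-1 * ((r / 2) `^ p * (d * (N1^-1) `^ p))).
  by rewrite !mulr_gt0 ?powR_gt0 ?invr_gt0.
move=> theta.
have [j hj] : exists j, enorm theta / N1 <= enorm (col j theta).
  have [->|th0] := eqVneq theta 0.
    by exists (Ordinal m0); rewrite enorm0 mul0r enorm_ge0.
  apply: contrapT => /forallNP hj.
  have : enorm theta < enorm theta; last by rewrite ltxx.
  apply: le_lt_trans (enorm_le_sum _) _.
  apply: (@le_lt_trans _ _ (\sum_(i < n) \sum_(j < m) enorm theta / N1)).
    apply: ler_sum => i _; apply: ler_sum => j _; apply/ltW.
    rewrite ltNge; apply/negP => h; apply: (hj j); apply: (le_trans h).
    by have := enorm_coord (col j theta) i ord0; rewrite mxE.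
  rewrite !sumr_const !card_ord -mulrnA -[ltLHS]mulr_natl mulrCA gtr_pMr ?enorm_gt0//.
  by rewrite ltr_pdivrMr// mul1r ltr_nat mulnC.
have hp : (N1^-1) `^ p * enorm theta `^ p <= enorm (col j theta) `^ p.
  have N1V : 0 <= N1^-1 by rewrite invr_ge0 ltW.
  rewrite -powRM ?enorm_ge0//; apply: ge0_ler_powR => //.
  - by rewrite nnegrE mulr_ge0// enorm_ge0.
  - by rewrite nnegrE enorm_ge0.
  - by rewrite mulrC.
have sym : pgauge theta = (\int[sigma]_v (pkernel (- v) theta)%:E)%E.
  rewrite -[LHS](surface_measure_orthogonal (F := fun u => (pkernel u theta)%:E) orthogonalN1).
  - by apply: eq_integral => v _; rewrite (mulNmx 1%:M v) mul1mx.
  - exact: measurable_EFin_pkernel1.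
  - by move=> v; rewrite lee_fin pkernel_ge0.
have mN : measurable_fun setT (fun v : V => (pkernel (- v) theta)%:E).
  apply: (eq_measurable_fun (fun v : V => (pkernel ((-1) *: v) theta)%:E)).
    by move=> v _; rewrite scaleN1r.
  exact: (measurableT_comp (measurable_EFin_pkernel1 theta) (@measurable_mx_scale R n 1 (-1))).
have dbl : (pgauge theta + pgauge theta =
    \int[sigma]_v ((pkernel v theta)%:E + (pkernel (- v) theta)%:E))%E.
  have k1 v : (0 <= (pkernel v theta)%:E)%E by rewrite lee_fin pkernel_ge0.
  have k2 v : (0 <= (pkernel (- v) theta)%:E)%E by rewrite lee_fin pkernel_ge0.
  apply: etrans (congr2 adde (erefl (pgauge theta)) sym) (esym _).
  exact: (ge0_integralD sigma measurableT (fun v _ => k1 v)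
    (measurable_EFin_pkernel1 theta) (fun v _ => k2 v) mN).
have key : (((r / 2) `^ p)%:E * \int[sigma]_v (moment v (col j theta))%:E <=
    pgauge theta + pgauge theta)%E.
  rewrite dbl -[leLHS](ge0_integralZl sigma measurableT (mmoment _) (fun v _ => moment_ge0 _ _)); last first.
    by rewrite lee_fin powR_ge0.
  apply: ge0_le_integral.
  - exact: measurableT.
  - by move=> v _; apply: mule_ge0; rewrite lee_fin powR_ge0.
  - by apply: emeasurable_funM; [exact: measurable_cst|exact: mmoment].
  - by apply: emeasurable_funD; [exact: measurable_EFin_pkernel1|exact: mN].
  move=> v _; rewrite -[leLHS]EFinM -[leRHS]EFinD lee_fin /moment.
  rewrite -[leLHS](powRM _ (ltW r20) (normr_ge0 _)).
  have -> : dotmx v (col j theta) = (v^T *m theta) ord0 j.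
    by rewrite mxE; apply: eq_bigr => i _; rewrite big_ord1 !mxE.
  have Nv : (- v)^T *m theta = - (v^T *m theta) by rewrite raddfN/= mulNmx.
  rewrite !pkernelE Nv; exact: support_fun_symmetrized_lower.
rewrite -[leRHS](half_double (pgauge_ge0 theta)) -[in leLHS]mulrA [leLHS]EFinM.
apply: lee_wpmul2l; first by rewrite lee_fin.
apply: le_trans key; rewrite -[in leLHS]mulrA [leLHS]EFinM; apply: lee_wpmul2l.
  by rewrite lee_fin powR_ge0.
rewrite moment_unit -[in leLHS]mulrA [in leLHS]mulrC [leLHS]EFinM.
apply: lee_pmul; [| |rewrite lee_fin|exact: hd].
- by rewrite lee_fin mulr_ge0 ?powR_ge0.
- by rewrite lee_fin ltW.
exact: hp.
Qed.

End projection_kernel.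

Section hahn_banach.
Variables (R : realType) (n m : nat).
Local Notation M := 'M[R]_(n, m).

Definition sublinear (b : M -> R) :=
  (forall x y, b (x + y) <= b x + b y) /\ (forall s x, 0 <= s -> b (s *: x) = s * b x).

Lemma sublinear0 b : sublinear b -> b 0 = 0.
Proof. by move=> [_ bZ]; rewrite -(scale0r 0) bZ// mul0r. Qed.

Lemma sublinearN b x : sublinear b -> - b (- x) <= b x.
Proof.
move=> sb; have [bD _] := sb; have := bD x (- x).
by rewrite subrr sublinear0//; lra.
Qed.

(** The Hahn-Banach step: b' is the largest sublinear function below b which is
    linear on the line of e with the value b e, namely the infimum over t >= 0
    of b (x + t e) - t b e. *)
Lemma sublinear_linearize b e : sublinear b -> exists b',
  [/\ sublinear b', forall x, b' x <= b x & b' (- e) <= - b e].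
Proof.
move=> sb; have [bD bZ] := sb.
pose S x := [set b (x + t *: e) - t * b e | t in [set t | 0 <= t]].
have S0 x : S x !=set0 by exists (b (x + 0 *: e) - 0 * b e), 0 => //=.
have Slb x : lbound (S x) (- b (- x)).
  move=> _ [t /= t0 <-]; rewrite -bZ// lerBrDl.
  have := bD (- x) (x + t *: e); rewrite addrA addNr add0r.
  lra.
have Sinf x : has_inf (S x) by split => //; exists (- b (- x)).
have leS x t : 0 <= t -> inf (S x) <= b (x + t *: e) - t * b e.
  by move=> t0; apply: inf_lbound; [case: (Sinf x)|exists t].
have geS x c : (forall t, 0 <= t -> c <= b (x + t *: e) - t * b e) -> c <= inf (S x).
  by move=> h; apply: lb_le_inf => // _ [t /= t0 <-]; exact: h.
exists (fun x => inf (S x)); split.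
- split.
    move=> x y; rewrite -lerBlDr; apply: (geS) => t t0.
    rewrite lerBlDr -lerBlDl; apply: (geS) => s s0.
    have ts : 0 <= t + s by rewrite addr_ge0.
    have := leS (x + y) _ ts.
    rewrite scalerDl addrACA mulrDl => h.
    have := bD (x + t *: e) (y + s *: e); lra.
  move=> s x; rewrite le_eqVlt => /predU1P[<-|s0].
    rewrite scale0r mul0r; apply/eqP; rewrite eq_le; apply/andP; split.
      by have := leS 0 0 (lexx _); rewrite add0r scale0r sublinear0// mul0r subr0.
    by apply: (geS) => t t0; rewrite add0r bZ// subrr.
  have le1 u y : 0 < u -> inf (S (u *: y)) <= u * inf (S y).
    move=> u0; rewrite -ler_pdivrMl//; apply: (geS) => t t0.
    rewrite ler_pdivrMl//; have := leS (u *: y) (u * t) (mulr_ge0 (ltW u0) t0).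
    by rewrite -scalerA -scalerDr bZ ?(ltW u0)// mulrBr mulrA.
  apply/eqP; rewrite eq_le le1//= -ler_pdivlMl// (le_trans _ (le1 _ _ _))//.
    by rewrite scalerA mulVf ?gt_eqF// scale1r.
  by rewrite invr_gt0.
- by move=> x; have := leS x 0 (lexx _); rewrite scale0r addr0 mul0r subr0.
- have := leS (- e) 1 ler01.
  by rewrite scale1r addNr sublinear0// mul1r sub0r.
Qed.

Lemma sublinear_linearize_seq b (s : seq M) : sublinear b -> exists b',
  [/\ sublinear b', forall x, b' x <= b x & forall e, e \in s -> b' (- e) <= - b' e].
Proof.
move=> sb; elim: s => [|e s [b1 [sb1 b1b hb1]]]; first by exists b.
have [b2 [sb2 b21 b2e]] := sublinear_linearize e sb1.
exists b2; split => // [x|x]; first exact: le_trans (b21 x) (b1b x).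
rewrite inE => /predU1P[->|/hb1 h].
  by apply: (le_trans b2e); rewrite lerN2.
by apply: (le_trans (b21 _)); apply: (le_trans h); rewrite lerN2.
Qed.

(** In finite dimension Hahn-Banach needs finitely many steps: one for the
    direction x0, which fixes the value there, and one for each vector of the
    standard basis.  A sublinear function that is linear on the coordinate axes
    is linear. *)
Lemma sublinear_support b x0 : sublinear b ->
  exists y, dotmx y x0 = b x0 /\ forall x, dotmx y x <= b x.
Proof.
move=> sb; have [b1 [sb1 b1b b1x0]] := sublinear_linearize x0 sb.
pose s : seq M := [seq delta_mx ij.1 ij.2 | ij <- enum {: 'I_n * 'I_m}].
have [b2 [sb2 b21 hs]] := sublinear_linearize_seq s sb1.
have [b2D b2Z] := sb2.
have b2delta c i j : b2 (c *: delta_mx i j) = c * b2 (delta_mx i j).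
  have [c0|c0] := leP 0 c; first exact: b2Z.
  rewrite -[c]opprK scaleNr -scalerN b2Z; last by rewrite oppr_ge0 ltW.
  suff -> : b2 (- delta_mx i j) = - b2 (delta_mx i j) by rewrite mulrNN opprK.
  have hd : delta_mx i j \in s.
    by apply/mapP; exists (i, j); rewrite ?mem_enum.
  apply/eqP; rewrite eq_le (hs _ hd) /=.
  by rewrite lerNl sublinearN.
pose y : M := \matrix_(i, j) b2 (delta_mx i j).
have b2sum (I : Type) (r : seq I) (F : I -> M) :
    b2 (\sum_(k <- r) F k) <= \sum_(k <- r) b2 (F k).
  elim: r => [|k r ih]; first by rewrite !big_nil sublinear0.
  by rewrite !big_cons (le_trans (b2D _ _))// lerD2l.
have le x : b2 x <= dotmx y x.
  rewrite [in leLHS](matrix_sum_delta x).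
  apply: (le_trans (b2sum _ _ _)); apply: ler_sum => i _.
  apply: (le_trans (b2sum _ _ _)); apply: ler_sum => j _.
  by rewrite b2delta mxE mulrC.
have E x : dotmx y x = b2 x.
  apply/eqP; rewrite eq_le le andbT.
  have := le (- x); have := sublinearN x sb2; rewrite dotmxNr; lra.
exists y; split; last by move=> x; rewrite E (le_trans (b21 x)).
apply/eqP; rewrite eq_le E (le_trans (b21 _) (b1b _))/=.
have := sublinearN x0 sb2; have := b21 (- x0); lra.
Qed.

End hahn_banach.

Section projection_body_polar.
Variables (R : realType) (n m : nat) (p : R) (Q : set 'rV[R]_m).
Hypotheses (n0 : (0 < n)%N) (m0 : (0 < m)%N) (p1 : 1 <= p).
Hypothesis Qbody : convex_body Q.
Hypothesis Q0 : Q 0.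
Local Notation h := (support_fun Q).
Local Notation V := 'cV[R]_n.
Local Notation M := 'M[R]_(n, m).
Local Notation sigma := (@surface_measure R n 1).
Local Notation H := (@pgauge R n m p Q).
Implicit Types (u v : V) (theta : M).

Let p0 : 0 < p. Proof. exact: lt_le_trans p1. Qed.
Let pge0 : 0 <= p. Proof. exact: ltW. Qed.
Let pV0 : 0 <= p^-1. Proof. by rewrite invr_ge0. Qed.
Let pneq0 : p != 0. Proof. by rewrite gt_eqF. Qed.

Lemma pgauge_fin theta : H theta \is a fin_num.
Proof.
have [C _ hC] := pgauge_upper n0 p1 Qbody Q0.
by rewrite ge0_fin_numE ?pgauge_ge0// (le_lt_trans (hC theta))// ltry.
Qed.

Lemma support_PiE theta : support_Pi p Q theta = (H theta `^ p^-1)%E.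
Proof.
rewrite /support_Pi ge0_integral_esphere//.
- exact: measurable_EFin_pkernel1.
- by move=> v; rewrite lee_fin powR_ge0.
Qed.

(** The real-valued version of the support function of the projection body,
    which is also the gauge of the polar body. *)
Definition rgauge theta : R := fine (H theta) `^ p^-1.

Lemma support_Pi_rgauge theta : support_Pi p Q theta = (rgauge theta)%:E.
Proof. by rewrite support_PiE -(fineK (pgauge_fin theta)) poweR_EFin. Qed.

Lemma rgauge_ge0 theta : 0 <= rgauge theta. Proof. exact: powR_ge0. Qed.

Lemma rgauge_powR theta : H theta = (rgauge theta `^ p)%:E.
Proof.
rewrite /rgauge -powRrM mulVf// powRr1 ?fineK ?pgauge_fin//.
by rewrite fine_ge0// pgauge_ge0.
Qed.

Lemma rgaugeZ s theta : 0 <= s -> rgauge (s *: theta) = s * rgauge theta.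
Proof.
move=> s0; rewrite /rgauge pgaugeZ// fineM ?pgauge_fin//=.
by rewrite powRM ?powR_ge0 ?fine_ge0 ?pgauge_ge0// -powRrM mulfV// powRr1.
Qed.

Lemma rgauge_gt0 theta : theta != 0 -> 0 < rgauge theta.
Proof.
rewrite -enorm_gt0 => th0; apply: powR_gt0; rewrite fine_gt0//.
rewrite -ge0_fin_numE ?pgauge_ge0// pgauge_fin andbT.
have [c c0 hc] := pgauge_lower n0 m0 p1 Qbody Q0.
by apply: lt_le_trans (hc theta); rewrite lte_fin mulr_gt0// powR_gt0.
Qed.

Lemma measurable_rgauge : measurable_fun setT rgauge.
Proof.
apply: (@measurableT_comp _ _ _ _ _ _ (@powR R ^~ p^-1)); first exact: measurable_powR.
by apply: (measurableT_comp (@fine_measurable R setT measurableT)); exact: measurable_pgauge.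
Qed.

Lemma rgauge_orthogonal (T : 'M[R]_n) theta : orthogonal_mx T ->
  rgauge (T *m theta) = rgauge theta.
Proof. by move=> oT; rewrite /rgauge pgauge_orthogonal. Qed.

Local Opaque rgauge.

(** The same function as an L^p norm, for which the triangle inequality is the
    one of Minkowski. *)
Definition support_Lnorm theta : \bar R :=
  'N[sigma]_(p%:E)[(fun v => (h (v^T *m theta))%:E)]%E.

Lemma rgauge_Lnorm theta : support_Lnorm theta = (rgauge theta)%:E.
Proof.
rewrite -(support_Pi_rgauge theta) (support_PiE theta) /support_Lnorm unlock.
apply: (congr1 (fun x => x `^ p^-1)%E).
apply: eq_integral => v _; rewrite abse_EFin poweR_EFin ger0_norm ?pkernelE//.
exact: support_fun_ge0.
Qed.

Lemma support_LnormD x y :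
  (support_Lnorm (x + y) <= support_Lnorm x + support_Lnorm y)%E.
Proof.
have mh theta : measurable_fun setT (fun v : V => h (v^T *m theta)).
  exact: (measurableT_comp (measurable_support_pairing Qbody Q0) (pair2_measurable theta)).
apply: le_trans (minkowski_EFin _ (mh x) (mh y) p1).
rewrite /support_Lnorm unlock; apply: gt0_ler_poweR => //.
- by apply/andP; split; [apply: integral_ge0 => v _; exact: poweR_ge0|exact: leey].
- by apply/andP; split; [apply: integral_ge0 => v _; exact: poweR_ge0|exact: leey].
have mp (f : V -> R) : measurable_fun setT f ->
    measurable_fun setT (fun v => `|(f v)%:E| `^ p)%E.
  move=> mf; apply: (@measurableT_comp _ _ _ _ _ _ (fun x => x `^ p)%E).
    exact: measurable_poweR.
  by apply: measurableT_comp => //; exact/measurable_EFinP.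
apply: ge0_le_integral.
- exact: measurableT.
- by move=> v _; exact: poweR_ge0.
- exact: mp.
- by apply: mp; exact: measurable_funD.
move=> v _; rewrite !abse_EFin !poweR_EFin lee_fin mulmxDr.
rewrite !ger0_norm ?addr_ge0 ?support_fun_ge0//.
apply: ge0_ler_powR; rewrite ?nnegrE ?addr_ge0 ?support_fun_ge0//.
exact: support_funD.
Qed.

Local Opaque support_Lnorm.

Lemma rgaugeD x y : rgauge (x + y) <= rgauge x + rgauge y.
Proof.
by have := support_LnormD x y; rewrite !rgauge_Lnorm -EFinD lee_fin.
Qed.

(** The inclusion from left to right is the statement that the gauge, being
    sublinear, is the supremum of the linear functions below it. *)
Lemma polar_Pi_body : (polar (Pi_body p Q) : set M) = [set theta : M | rgauge theta <= 1].
Proof.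
have srg : sublinear rgauge by split; [exact: rgaugeD|exact: rgaugeZ].
apply/seteqP; split => x /=.
  move=> px; have [y [yx hy]] := sublinear_support x srg.
  rewrite -yx; apply: px => theta; rewrite support_Pi_rgauge lee_fin; exact: hy.
move=> bx y hy; apply: le_trans bx.
by have := hy x; rewrite support_Pi_rgauge lee_fin.
Qed.

(** This turns the normalizing constant of the energy into an integral over the
    same sphere as the energy. *)
Lemma volume_polar_Pi_body :
  ((n * m)%:R%:E * lebesgue_mx (polar (Pi_body p Q) : set M) =
   \int[@surface_measure R n m]_theta ((rgauge theta ^+ (n * m))^-1)%:E)%E.
Proof.
rewrite polar_Pi_body surface_integral_gauge//.
- by rewrite muln_gt0 n0.
- exact: measurable_rgauge.
- exact: rgauge_gt0.
- by move=> s x s0; rewrite rgaugeZ// ltW.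
Qed.

End projection_body_polar.

(** * Averages over orbits of the orthogonal group *)

Section averaging.
Variables (R : realType) (n m : nat) (p : R).
Local Notation V := 'cV[R]_n.
Local Notation M := 'M[R]_(n, m).
Local Notation sigma := (@surface_measure R n 1).
Local Notation S := (@surface_measure R n m).
Hypotheses (n0 : (0 < n)%N) (p0 : 0 < p).
Variable k : V -> M -> R.
Hypothesis mk : measurable_fun setT (fun z : V * M => k z.1 z.2).
Hypothesis k_ge0 : forall u theta, 0 <= k u theta.
Hypothesis k_orthogonal : forall (T : 'M[R]_n) u theta, orthogonal_mx T ->
  k (T *m u) (T *m theta) = k u theta.
Hypothesis kZ : forall s u theta, 0 <= s -> k (s *: u) theta = s `^ p * k u theta.
Variable W : M -> \bar R.
Hypothesis mW : measurable_fun setT W.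
Hypothesis W_ge0 : forall theta, (0 <= W theta)%E.
Hypothesis W_orthogonal : forall (T : 'M[R]_n) theta, orthogonal_mx T ->
  W (T *m theta) = W theta.
Local Open Scope ereal_scope.

Let e1 : V := delta_mx (Ordinal n0) ord0.

Let enorm_e1 : enorm e1 = 1%R.
Proof.
rewrite /enorm /dotmx (bigD1 (Ordinal n0))//= big_ord1 mxE !eqxx mulr1.
rewrite big1 ?addr0 ?sqrtr1//.
by move=> i ki; rewrite big_ord1 mxE (negbTE ki) mul0r.
Qed.

Let cW := \int[S]_theta (W theta * (k e1 theta)%:E).

Let mk2 u : measurable_fun setT (fun theta => (k u theta)%:E).
Proof. by apply/measurable_EFinP; exact: (measurableT_comp mk (pair1_measurable u)). Qed.

Let Wk_ge0 u theta : 0 <= W theta * (k u theta)%:E.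
Proof. by apply: mule_ge0; rewrite ?lee_fin. Qed.

Let mWk u : measurable_fun setT (fun theta => W theta * (k u theta)%:E).
Proof. exact: emeasurable_funM. Qed.

Let integral_invariant_kernel u :
  \int[S]_theta (W theta * (k u theta)%:E) = (enorm u `^ p)%:E * cW.
Proof.
have [T oT Tu] : exists2 T, orthogonal_mx T & T *m u = (enorm u *: e1)%R.
  apply: orthogonal_transitive; rewrite enormZ enorm_e1 mulr1 ger0_norm//.
  exact: enorm_ge0.
have oT' := orthogonal_mxT oT.
rewrite -(surface_measure_orthogonal oT' (mWk u) (Wk_ge0 u)) /cW.
rewrite -ge0_integralZl//; last by rewrite lee_fin powR_ge0.
apply: eq_integral => theta _.
rewrite W_orthogonal// -(k_orthogonal _ _ oT) Tu mulmxA.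
have /mulmx1C -> : T^T *m T = 1%:M by [].
by rewrite mul1mx kZ ?enorm_ge0// EFinM muleCA.
Qed.

(** By Tonelli it suffices to integrate W k(u, -) for a fixed u.  As W and k are
    invariant, this integral depends on u only through its orbit under O(n),
    that is through |u|, and by homogeneity it is |u|^p times a constant that
    depends on W alone. *)
Lemma averaging d (Z : measurableType d) (mu : {sigma_finite_measure set Z -> \bar R})
    (u : Z -> V) : measurable_fun setT u ->
  \int[S]_theta (W theta * \int[mu]_z (k (u z) theta)%:E) =
  (\int[mu]_z (enorm (u z) `^ p)%:E) * cW.
Proof.
move=> mu_.
have mpair : measurable_fun setT (fun z : M * Z => (u z.2, z.1)).
  apply/measurable_fun_pairP; split; last exact: measurable_fst.
  exact: (measurableT_comp mu_ measurable_snd).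
have mK : measurable_fun setT (fun z : M * Z => (k (u z.2) z.1)%:E).
  by apply/measurable_EFinP; exact: (measurableT_comp mk mpair).
have mWK : measurable_fun setT (fun z : M * Z => W z.1 * (k (u z.2) z.1)%:E).
  by apply: emeasurable_funM => //; exact: (measurableT_comp mW measurable_fst).
transitivity (\int[S]_theta \int[mu]_z (W theta * (k (u z) theta)%:E)).
  apply: eq_integral => theta _; rewrite ge0_integralZl//.
  - exact: (measurableT_comp mK (pair1_measurable theta)).
  - by move=> z _; rewrite lee_fin.
rewrite (fubini_tonelli _ mWK (fun z => Wk_ge0 _ _))/=.
under eq_integral do rewrite integral_invariant_kernel.
rewrite ge0_integralZr//.
- apply/measurable_EFinP; apply: (@measurableT_comp _ _ _ _ _ _ (@powR R ^~ p)).
    exact: measurable_powR.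
  exact: (measurableT_comp (@measurable_enorm R n 1)).
- by move=> z _; rewrite lee_fin powR_ge0.
- exact: integral_ge0.
Qed.

(** The average for the unit field on the sphere identifies the constant of
    [averaging], so that the energy kernel can be compared with the gauge of the
    projection body. *)
Lemma averaging_sphere :
  \int[S]_theta (W theta * \int[sigma]_v (k v theta)%:E) = sigma setT * cW.
Proof.
rewrite (averaging sigma (@measurable_id _ _ setT)); congr (_ * _).
have mE : measurable_fun setT (fun v : V => (enorm v `^ p)%:E).
  apply/measurable_EFinP; apply: (@measurableT_comp _ _ _ _ _ _ (@powR R ^~ p)).
    exact: measurable_powR.
  exact: measurable_enorm.
rewrite -ge0_integral_esphere//; last by move=> v; rewrite lee_fin powR_ge0.
transitivity (\int[sigma]_(v in esphere) (cst 1 v : \bar R)).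
  by apply: eq_integral => v; rewrite inE => v1; rewrite (v1 : enorm v = 1%R) powR1.
by rewrite ge0_integral_esphere// integral_cst// mul1e.
Qed.

End averaging.

Lemma measurable_inve_ge0 d (T : measurableType d) (R : realType) (f : T -> \bar R) :
  measurable_fun setT f -> (forall x, 0 <= f x)%E ->
  measurable_fun setT (fun x => (f x)^-1%E).
Proof.
move=> mf f0.
have -> : (fun x => (f x)^-1%E) = (fun x => if f x == 0%E then +oo%E
    else if f x == +oo%E then 0%E else (fine (f x) `^ (-1))%:E).
  apply/funext => x; move: (f0 x); case: (inveP (f x)) => //=; rewrite ?eqxx//.
  by move=> r r0 r_ge0; rewrite !eqe (negbTE r0) powR_inv1.
apply: measurable_fun_ifT => //; first exact: measurable_fun_eqe.
apply: measurable_fun_ifT => //; first exact: measurable_fun_eqe.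
apply/measurable_EFinP.
apply: (@measurableT_comp _ _ _ _ _ _ (@powR R ^~ (-1))); first exact: measurable_powR.
exact: (measurableT_comp (@fine_measurable R setT measurableT)).
Qed.

(** The convex function j |-> j^(- q) lies above its tangent at A.  The right-hand
    side is written for extended reals so that j = 0 and j = +oo are
    covered. *)
Lemma inverse_power_tangent (R : realType) (A q : R) (j : \bar R) :
  0 < A -> 0 < q -> (0 <= j)%E ->
  (((1 + q) * A `^ (- q))%:E <=
   (j `^ q)^-1 + (q * A `^ (- q - 1))%:E * j)%E.
Proof.
move=> A0 q0; have Aq : 0 < q * A `^ (- q - 1) by rewrite mulr_gt0// powR_gt0.
case: j => [r| |]//; last first.
  by move=> _; rewrite gt0_muley ?lte_fin// poweRyr ?gt_eqF// addey ?leey// invey.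
rewrite lee_fin le_eqVlt => /predU1P[<-|r0].
  by rewrite poweR0r ?gt_eqF// inve0 mule0 adde0 leey.
rewrite poweR_EFin inver gt_eqF ?powR_gt0// -powRN -EFinM -EFinD lee_fin.
pose t := r / A.
have t0 : 0 < t by rewrite divr_gt0.
have rE : r = A * t by rewrite mulrC divfK ?gt_eqF.
have Ane : A != 0 by rewrite gt_eqF.
have -> : A `^ (- q - 1) = A `^ (- q) / A.
  by rewrite powRB ?Ane ?implybT// powRr1// ltW.
rewrite rE powRM ?(ltW A0) ?(ltW t0)//.
have -> : q * (A `^ (- q) / A) * (A * t) = A `^ (- q) * (q * t) by field.
(* the claim is now 1 + q <= t^(- q) + q t, which follows from
   exp (- q ln t) >= 1 - q ln t and ln t <= t - 1 *)
rewrite -mulrDr [leLHS]mulrC ler_wpM2l ?powR_ge0//.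
have lnt : 1 + ln t <= t by rewrite -[leRHS]lnK// expR_ge1Dx.
have := expR_ge1Dx (- q * ln t).
rewrite /powR gt_eqF//.
have : q * (1 + ln t) <= q * t by rewrite ler_wpM2l// ltW.
lra.
Qed.

(** * Comparison of spherical means *)

Lemma ge0_le_eq_integral_ae d (T : measurableType d) (R : realType)
    (mu : {measure set T -> \bar R}) (f g : T -> \bar R) :
  measurable_fun setT f -> measurable_fun setT g ->
  (forall x, g x \is a fin_num) -> (forall x, 0 <= g x <= f x)%E ->
  (\int[mu]_x f x = \int[mu]_x g x)%E -> (\int[mu]_x g x < +oo)%E ->
  {ae mu, forall x, f x = g x}.
Proof.
move=> mf mg gfin gf e goo.
have d0 x : (0 <= f x - g x)%E by rewrite sube_ge0 ?gfin//; have /andP[] := gf x.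
have g0 x : (0 <= g x)%E by have /andP[] := gf x.
have md : measurable_fun setT (fun x => f x - g x)%E by exact: emeasurable_funB.
have d_eq0 : (\int[mu]_x (f x - g x) = 0)%E.
  have : (\int[mu]_x (f x - g x) + \int[mu]_x g x = \int[mu]_x g x)%E.
    rewrite -ge0_integralD// -e; apply: eq_integral => x _.
    by rewrite subeK.
  have gi : (\int[mu]_x g x)%E \is a fin_num by rewrite ge0_fin_numE// integral_ge0.
  by move=> /(congr1 (fun z => z - \int[mu]_x g x)%E); rewrite addeK// subee.
have /(ae_eq_integral_abs mu measurableT md) : (\int[mu]_x `|f x - g x| = 0)%E.
  by rewrite -[RHS]d_eq0; apply: eq_integral => x _; rewrite gee0_abs.
apply: filterS => x /(_ Logic.I) h.
by rewrite -[LHS](@subeK _ _ (g x))// h add0e.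
Qed.

(** The hypothesis [average] says that J and the multiple A of b^p have the same
    integral against every invariant weight.  In the application s is the
    area of the unit sphere of R^n, b the gauge of the polar projection body and
    [mass] the p-th power of the L^p norm of the gradient. *)
Section spherical_comparison.
Variables (R : realType) (n m : nat) (p : R).
Local Notation M := 'M[R]_(n, m).
Local Notation N := (n * m)%N.
Local Notation S := (@surface_measure R n m).
Hypotheses (n0 : (0 < n)%N) (m0 : (0 < m)%N) (p0 : 0 < p).
Variables (b : M -> R) (J : M -> \bar R) (s c1 c2 : R).
Hypothesis mb : measurable_fun setT b.
Hypothesis b_ge0 : forall theta, 0 <= b theta.
Hypothesis b_orthogonal : forall (T : 'M[R]_n) theta, orthogonal_mx T ->
  b (T *m theta) = b theta.
Hypotheses (s0 : 0 < s) (c10 : 0 < c1).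
Hypothesis b_sphere : forall theta, enorm theta = 1 -> c1 <= b theta <= c2.
Hypothesis mJ : measurable_fun setT J.
Hypothesis J_ge0 : forall theta, (0 <= J theta)%E.
Variable mass : R.
Hypothesis mass_ge0 : 0 <= mass.
Hypothesis average : forall W : M -> \bar R, measurable_fun setT W ->
  (forall theta, 0 <= W theta)%E ->
  (forall (T : 'M[R]_n) theta, orthogonal_mx T -> W (T *m theta) = W theta) ->
  (s%:E * \int[S]_theta (W theta * J theta) =
   mass%:E * \int[S]_theta (W theta * (b theta `^ p)%:E))%E.

Local Open Scope ereal_scope.

Let q : R := (N%:R / p)%R.
Let K := \int[S]_theta ((b theta ^+ N)^-1)%:E.
Let I := \int[S]_theta (J theta `^ q)^-1.

Let N0 : (0 < N)%N. Proof. by rewrite muln_gt0 n0. Qed.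
Let q0 : (0 < q)%R. Proof. by rewrite divr_gt0// ltr0n. Qed.

Let a : R := (mass / s)%R.
Let A theta : R := (a * b theta `^ p)%R.

Let mA : measurable_fun setT A.
Proof.
apply: measurable_funM => //.
by apply: (@measurableT_comp _ _ _ _ _ _ (@powR R ^~ p)) => //; exact: measurable_powR.
Qed.

Let A_ge0 theta : (0 <= A theta)%R.
Proof. by rewrite mulr_ge0 ?powR_ge0// divr_ge0// ltW. Qed.

Let A_orthogonal (T : 'M[R]_n) theta : orthogonal_mx T -> A (T *m theta) = A theta.
Proof. by move=> oT; rewrite /A b_orthogonal. Qed.

Lemma average_eq (W : M -> \bar R) : measurable_fun setT W ->
  (forall theta, 0 <= W theta) ->
  (forall (T : 'M[R]_n) theta, orthogonal_mx T -> W (T *m theta) = W theta) ->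
  \int[S]_theta (W theta * J theta) = \int[S]_theta (W theta * (A theta)%:E).
Proof.
move=> mW W0 WT; have := average mW W0 WT.
have mbp : measurable_fun setT (fun theta => (b theta `^ p)%:E).
  apply/measurable_EFinP; apply: (@measurableT_comp _ _ _ _ _ _ (@powR R ^~ p)) => //.
have -> : \int[S]_theta (W theta * (A theta)%:E) =
    a%:E * \int[S]_theta (W theta * (b theta `^ p)%:E).
  rewrite -ge0_integralZl//.
  - by apply: eq_integral => x _; rewrite /A EFinM muleCA.
  - exact: (emeasurable_funM mW mbp).
  - by move=> x _; rewrite mule_ge0// lee_fin powR_ge0.
  - by rewrite lee_fin divr_ge0// ltW.
move=> e; rewrite /a mulrC EFinM -muleA -e muleA -EFinM mulVf ?gt_eqF//.
by rewrite mul1e.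
Qed.

Let mK : measurable_fun setT (fun theta => ((b theta ^+ N)^-1)%:E).
Proof.
apply/measurable_EFinP; apply: measurable_inv_ge0; first exact: measurable_funX.
by move=> x; rewrite exprn_ge0.
Qed.

Let K_ge0 theta : 0 <= ((b theta ^+ N)^-1)%:E.
Proof. by rewrite lee_fin invr_ge0 exprn_ge0. Qed.

Let S_sphere : S esphere = S setT.
Proof.
have := @ge0_integral_esphere R n m (cst 1)%E (measurable_cst _) (fun=> lee01).
by rewrite !integral_cst ?mul1e//; exact: measurable_esphere.
Qed.

Let S_gt0 : 0 < S setT.
Proof.
by rewrite surface_measureT// mule_gt0 ?lebesgue_eball_gt0// lte_fin ltr0n.
Qed.

Let S_lty : S setT < +oo.
Proof. by rewrite -ge0_fin_numE//; apply: fin_num_measure. Qed.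

Lemma gauge_integral_lty : K < +oo.
Proof.
rewrite /K -ge0_integral_esphere//.
apply: (@le_lt_trans _ _ (\int[S]_(theta in esphere) ((c1 ^+ N)^-1)%:E)).
  apply: ge0_le_integral => //.
  - exact: measurable_esphere.
  - exact: measurable_funTS.
  move=> x x1; have /andP[h _] := b_sphere x1.
  have bx : (0 < b x)%R by exact: lt_le_trans h.
  rewrite lee_fin lef_pV2 ?posrE ?exprn_gt0//.
  by apply: lerXn2r => //; rewrite nnegrE ltW.
rewrite integral_cst//; last exact: measurable_esphere.
rewrite lte_mul_pinfty// ?lee_fin ?invr_ge0 ?exprn_ge0 ?(ltW c10)//.
by rewrite [X in X < _]S_sphere.
Qed.

Lemma gauge_integral_gt0 : 0 < K.
Proof.
rewrite /K -ge0_integral_esphere//.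
have c20 : (0 < c2 + 1)%R.
  have [x x1] : exists x : M, enorm x = 1%R.
    exists (normalize (const_mx 1%R)); apply: enorm_normalize.
    apply/eqP => /matrixP/(_ (Ordinal n0) (Ordinal m0)).
    by rewrite !mxE => /eqP; rewrite oner_eq0.
  have /andP[h1 h2] := b_sphere x1.
  apply: (@lt_le_trans _ _ 1%R) => //.
  by rewrite lerDr (le_trans (ltW c10))// (le_trans h1).
apply: (@lt_le_trans _ _ (\int[S]_(theta in esphere) (((c2 + 1) ^+ N)^-1)%:E)).
  rewrite integral_cst//; last exact: measurable_esphere.
  apply: mule_gt0; first by rewrite lte_fin invr_gt0 exprn_gt0.
  by rewrite [X in _ < X]S_sphere.
apply: ge0_le_integral => //.
- exact: measurable_esphere.
- by move=> x _; rewrite lee_fin invr_ge0 exprn_ge0 ?ltW.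
- exact: measurable_funTS.
move=> x x1; have /andP[h1 h2] := b_sphere x1.
have bx : (0 < b x)%R by exact: lt_le_trans h1.
rewrite lee_fin lef_pV2 ?posrE ?exprn_gt0//.
apply: lerXn2r; rewrite ?nnegrE ?(ltW bx) ?(ltW c20)//.
by apply: (le_trans h2); rewrite lerDl.
Qed.

Let A_powN theta : (A theta `^ (- q) = a `^ (- q) * (b theta ^+ N)^-1)%R.
Proof.
rewrite /A powRM ?powR_ge0 ?divr_ge0 ?(ltW s0)//; congr (_ * _)%R.
by rewrite -powRrM mulrN /q mulrCA divff ?gt_eqF// mulr1 powRN powR_mulrn.
Qed.

Let mJq : measurable_fun setT (fun theta => (J theta `^ q)^-1).
Proof.
apply: measurable_inve_ge0; last by move=> x; exact: poweR_ge0.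
by apply: (@measurableT_comp _ _ _ _ _ _ (fun x => x `^ q)) => //; exact: measurable_poweR.
Qed.

Let Jq_ge0 theta : 0 <= (J theta `^ q)^-1.
Proof. by rewrite inve_ge0 poweR_ge0. Qed.

Let mApow r : measurable_fun setT (fun theta => (A theta `^ r)%:E).
Proof.
apply/measurable_EFinP.
by apply: (@measurableT_comp _ _ _ _ _ _ (@powR R ^~ r)) => //; exact: measurable_powR.
Qed.

Let AK : \int[S]_theta (A theta `^ (- q))%:E = (a `^ (- q))%:E * K.
Proof.
rewrite /K -ge0_integralZl//; last by rewrite lee_fin powR_ge0.
by apply: eq_integral => x _; rewrite A_powN EFinM.
Qed.

(** Jensen's inequality for the power - q, relative to the invariant functions:
    the tangent inequality of [inverse_power_tangent] at A theta is integrated,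
    and its linear term is computed by [average_eq] with the weight
    q A^(- q - 1), which is invariant because A is. *)
Lemma spherical_power_mean : (0 < mass)%R -> (a `^ (- q))%:E * K <= I.
Proof.
move=> M0; have a0 : (0 < a)%R by rewrite divr_gt0.
pose W theta := (q * A theta `^ (- q - 1))%:E.
have mW : measurable_fun setT W.
  by apply/measurable_EFinP; apply: measurable_funM => //; apply/measurable_EFinP; exact: mApow.
have W0 theta : 0 <= W theta by rewrite lee_fin mulr_ge0 ?powR_ge0 ?ltW.
have WT (T : 'M[R]_n) theta : orthogonal_mx T -> W (T *m theta) = W theta.
  by move=> oT; rewrite /W A_orthogonal.
have AKfin : (a `^ (- q))%:E * K \is a fin_num.
  by rewrite fin_numM// ge0_fin_numE ?gauge_integral_lty// integral_ge0.
(* A is positive on the unit sphere only, hence the integrals over the sphere *)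
have WA : \int[S]_theta (W theta * (A theta)%:E) = q%:E * ((a `^ (- q))%:E * K).
  rewrite -AK -ge0_integralZl//; last by rewrite lee_fin ltW.
    rewrite -ge0_integral_esphere; first 1 last.
    - by apply: emeasurable_funM => //; exact/measurable_EFinP.
    - by move=> x; rewrite mule_ge0// lee_fin.
    rewrite -[RHS]ge0_integral_esphere; first 1 last.
    - by apply: emeasurable_funM.
    - by move=> x; rewrite mule_ge0 ?lee_fin ?powR_ge0// ltW.
    apply: eq_integral => x; rewrite inE => x1; have /andP[h1 _] := b_sphere x1.
    have Ax : (0 < A x)%R by rewrite mulr_gt0// powR_gt0// (lt_le_trans c10).
    rewrite /W -!EFinM; congr EFin.
    have Ane : (A x != 0)%R by rewrite gt_eqF.
    by rewrite powRB ?Ane ?implybT// powRr1 ?(ltW Ax)// -mulrA divfK.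
  by move=> x _; rewrite lee_fin powR_ge0.
have key : \int[S]_theta ((1 + q) * A theta `^ (- q))%:E <=
    I + q%:E * ((a `^ (- q))%:E * K).
  rewrite -WA -average_eq// /I -ge0_integralD//; last 2 first.
  - by move=> x _; rewrite mule_ge0.
  - exact: emeasurable_funM.
  rewrite -[leLHS]ge0_integral_esphere; first 1 last.
  - by under eq_fun do rewrite EFinM; apply: emeasurable_funM.
  - by move=> x; rewrite lee_fin mulr_ge0 ?powR_ge0// addr_ge0// ltW.
  rewrite -[leRHS]ge0_integral_esphere; first 1 last.
  - by apply: emeasurable_funD => //; exact: emeasurable_funM.
  - by move=> x; rewrite adde_ge0// mule_ge0.
  apply: ge0_le_integral => //.
  - exact: measurable_esphere.
  - by move=> x _; rewrite lee_fin mulr_ge0 ?powR_ge0// addr_ge0// ltW.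
  - by apply: measurable_funTS; under eq_fun do rewrite EFinM; apply: emeasurable_funM.
  - by apply: measurable_funTS; apply: emeasurable_funD => //; exact: emeasurable_funM.
  move=> x x1; have /andP[h1 _] := b_sphere x1.
  apply: inverse_power_tangent => //.
  by rewrite mulr_gt0// powR_gt0// (lt_le_trans c10).
have : (1 + q)%:E * ((a `^ (- q))%:E * K) <= I + q%:E * ((a `^ (- q))%:E * K).
  apply: le_trans key; rewrite -AK -ge0_integralZl//; last first.
    by rewrite lee_fin addr_ge0// ltW.
  by move=> x _; rewrite lee_fin powR_ge0.
rewrite EFinD ge0_muleDl ?lee_fin ?(ltW q0)// mul1e leeD2rE//.
by rewrite fin_numM.
Qed.

(** The degenerate case: without gradient J vanishes almost everywhere, and the
    energy is an inverse of +oo. *)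
Lemma spherical_mean_infty : mass = 0%R -> I = +oo.
Proof.
move=> M0; have := average (W := cst 1) (measurable_cst _) (fun=> lee01) (fun _ _ _ => erefl).
rewrite M0 mul0e; under eq_integral do rewrite mul1e.
move=> h; have J0 : \int[S]_theta J theta = 0.
  apply/eqP; move/eqP: h; rewrite mule_eq0 => /orP[|//].
  by rewrite eqe gt_eqF.
have /(ae_eq_integral_abs S measurableT mJ) Jae : \int[S]_theta `|J theta| = 0.
  by rewrite -[RHS]J0; apply: eq_integral => x _; rewrite gee0_abs.
transitivity (\int[S]_theta (cst +oo theta : \bar R)).
  apply: ge0_ae_eq_integral => //; first by move=> x _; exact: le0y.
  by apply: filterS Jae => x /(_ Logic.I) -> _; rewrite poweR0r ?gt_eqF// inve0.
by rewrite integral_cst// gt0_mulye.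
Qed.

Lemma energy_bound :
  (s `^ p^-1)%:E * K `^ N%:R^-1 * (I `^ N%:R^-1)^-1 <= (mass `^ p^-1)%:E.
Proof.
have NV0 : (0 < N%:R^-1 :> R)%R by rewrite invr_gt0 ltr0n.
move: (mass_ge0); rewrite le_eqVlt => /predU1P[M0|M0].
  by rewrite spherical_mean_infty// poweRyr ?gt_eqF// invey mule0 lee_fin powR_ge0.
have a0 : (0 < a)%R by rewrite divr_gt0.
have Kfin : K \is a fin_num by rewrite gt0_fin_numE ?gauge_integral_gt0 ?gauge_integral_lty.
have K0 : (0 < fine K)%R by rewrite fine_gt0// gauge_integral_gt0 gauge_integral_lty.
have := spherical_power_mean M0.
rewrite -(fineK Kfin); set k := fine K in K0 *.
rewrite -EFinM => h.
have y0 : (0 < (a `^ (- q) * k) `^ N%:R^-1)%R by rewrite powR_gt0// mulr_gt0// powR_gt0.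
have {}h : ((a `^ (- q) * k) `^ N%:R^-1)%:E <= I `^ N%:R^-1.
  rewrite -poweR_EFin; apply: gt0_ler_poweR => //.
  - by rewrite in_itv/= leey andbT lee_fin mulr_ge0 ?powR_ge0// ltW.
  - by rewrite in_itv/= leey andbT integral_ge0.
have {h} : (I `^ N%:R^-1)^-1 <= (((a `^ (- q) * k) `^ N%:R^-1)^-1)%:E.
  have yV0 : (0 <= ((a `^ (- q) * k) `^ N%:R^-1)^-1)%R by rewrite invr_ge0 ltW.
  move: h; case: (I `^ N%:R^-1) => [r|_|]; [|by rewrite invey lee_fin|by rewrite leeNy_eq].
  rewrite lee_fin => h; have r0 := lt_le_trans y0 h.
  by rewrite inver gt_eqF// lee_fin lef_pV2.
rewrite poweR_EFin -EFinM => h.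
apply: le_trans (lee_wpmul2l _ h) _; first by rewrite lee_fin mulr_ge0 ?powR_ge0.
rewrite -EFinM lee_fin.
rewrite powRM ?powR_ge0 ?(ltW K0)// invfM.
have -> : ((a `^ (- q)) `^ N%:R^-1)^-1%R = (a `^ p^-1)%R.
  by rewrite -powRrM -powRN /q mulNr opprK mulrAC divff ?mul1r// pnatr_eq0 gtn_eqF.
have k0 : (k `^ N%:R^-1 != 0)%R by rewrite gt_eqF// powR_gt0.
rewrite [leLHS](_ : _ = (s `^ p^-1 * a `^ p^-1)%R); last by field.
by rewrite -powRM ?(ltW s0) ?(ltW a0)// /a mulrC divfK// gt_eqF.
Qed.

(** An invariant J is determined by its averages: the indicator functions of
    J > A and of J < A are then admissible weights, and they force J = A. *)
Lemma average_eq_ae :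
  (forall (T : 'M[R]_n) theta, orthogonal_mx T -> J (T *m theta) = J theta) ->
  {ae S, forall theta, J theta = (A theta)%:E}.
Proof.
move=> J_orthogonal.
have mAE : measurable_fun setT (fun theta => (A theta)%:E) by exact/measurable_EFinP.
have Aoo : \int[S]_theta (A theta)%:E < +oo.
  rewrite -ge0_integral_esphere//.
  apply: (@le_lt_trans _ _ (\int[S]_(theta in esphere) (a * (`|c2|) `^ p)%:E)).
    apply: ge0_le_integral.
    - exact: measurable_esphere.
    - by move=> x _; rewrite lee_fin.
    - exact: measurable_funTS.
    - exact: measurable_cst.
    move=> x x1; have /andP[_ h] := b_sphere x1.
    rewrite lee_fin ler_wpM2l ?divr_ge0 ?(ltW s0)//.
    apply: ge0_ler_powR; rewrite ?nnegrE ?(ltW p0)//.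
    by apply: (le_trans h); exact: ler_norm.
  rewrite integral_cst//; last exact: measurable_esphere.
  apply: lte_mul_pinfty => //; last by rewrite [X in X < _]S_sphere.
  by rewrite lee_fin mulr_ge0 ?powR_ge0// divr_ge0// ltW.
have W01 (P : M -> bool) x : 0 <= (if P x then 1 else 0 : \bar R) by case: ifP.
have WAoo (P : M -> bool) : measurable_fun setT P ->
    \int[S]_theta ((if P theta then 1 else 0) * (A theta)%:E) < +oo.
  move=> mP; apply: le_lt_trans Aoo; apply: ge0_le_integral => //.
  - by move=> x _; apply: mule_ge0; rewrite ?lee_fin.
  - by apply: emeasurable_funM => //; exact: measurable_fun_ifT.
  - by move=> x _; case: ifP; rewrite ?mul1e ?mul0e ?lee_fin.
pose P1 theta := (A theta)%:E < J theta.
pose P2 theta := J theta < (A theta)%:E.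
have mP1 : measurable_fun setT P1 by exact: measurable_fun_lte.
have mP2 : measurable_fun setT P2 by exact: measurable_fun_lte.
have mW (P : M -> bool) : measurable_fun setT P ->
    measurable_fun setT (fun x => if P x then 1 else 0 : \bar R).
  by move=> mP; exact: measurable_fun_ifT.
have ae1 : {ae S, forall x, (if P1 x then 1 else 0) * J x = (if P1 x then 1 else 0) * (A x)%:E}.
  apply: ge0_le_eq_integral_ae.
  - by apply: emeasurable_funM => //; exact: mW.
  - by apply: emeasurable_funM => //; exact: mW.
  - by move=> x; case: ifP; rewrite ?mul1e ?mul0e.
  - move=> x; rewrite /P1; case: ifPn => [/ltW h|_]; last by rewrite !mul0e lexx.
    by rewrite !mul1e h lee_fin A_ge0.
  - apply: average_eq => //; first exact: mW.
    by move=> T x oT; rewrite /P1 A_orthogonal// J_orthogonal.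
  - exact: WAoo.
have ae2 : {ae S, forall x, (if P2 x then 1 else 0) * (A x)%:E = (if P2 x then 1 else 0) * J x}.
  have e2 : \int[S]_theta ((if P2 theta then 1 else 0) * J theta) =
      \int[S]_theta ((if P2 theta then 1 else 0) * (A theta)%:E).
    apply: average_eq => //; first exact: mW.
    by move=> T x oT; rewrite /P2 A_orthogonal// J_orthogonal.
  apply: ge0_le_eq_integral_ae.
  - by apply: emeasurable_funM => //; exact: mW.
  - by apply: emeasurable_funM => //; exact: mW.
  - move=> x; rewrite /P2; case: ifPn => [h|]; last by rewrite mul0e.
    by rewrite mul1e ge0_fin_numE// (lt_trans h)// ltry.
  - move=> x; rewrite /P2; case: ifPn => [/ltW h|_]; last by rewrite !mul0e lexx.
    by rewrite !mul1e h J_ge0.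
  - by rewrite e2.
  - by rewrite e2; exact: WAoo.
apply: filterS2 ae1 ae2 => x; rewrite /P1 /P2.
by case: ltgtP => // _; rewrite ?mul1e ?mul0e.
Qed.

Lemma energy_equality :
  (forall (T : 'M[R]_n) theta, orthogonal_mx T -> J (T *m theta) = J theta) ->
  (s `^ p^-1)%:E * K `^ N%:R^-1 * (I `^ N%:R^-1)^-1 = (mass `^ p^-1)%:E.
Proof.
move=> J_orthogonal.
have NV0 : (0 < N%:R^-1 :> R)%R by rewrite invr_gt0 ltr0n.
move: (mass_ge0); rewrite le_eqVlt => /predU1P[M0|M0].
  rewrite spherical_mean_infty// poweRyr ?gt_eqF// invey mule0 -M0 powR0//.
  by rewrite invr_eq0 gt_eqF.
have a0 : (0 < a)%R by rewrite divr_gt0.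
have Kfin : K \is a fin_num by rewrite gt0_fin_numE ?gauge_integral_gt0 ?gauge_integral_lty.
have K0 : (0 < fine K)%R by rewrite fine_gt0// gauge_integral_gt0 gauge_integral_lty.
have -> : I = (a `^ (- q))%:E * K.
  rewrite -AK; transitivity (\int[S]_theta ((A theta)%:E `^ q)^-1).
    apply: ge0_ae_eq_integral => //.
    - apply: measurable_inve_ge0; last by move=> x; exact: poweR_ge0.
      apply/measurable_EFinP.
      by apply: (@measurableT_comp _ _ _ _ _ _ (@powR R ^~ q)) => //; exact: measurable_powR.
    - by move=> x _; rewrite inve_ge0 poweR_ge0.
    - by apply: filterS (average_eq_ae J_orthogonal) => x -> _.
  rewrite -ge0_integral_esphere; first 1 last.
  - apply: measurable_inve_ge0; last by move=> x; exact: poweR_ge0.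
    apply/measurable_EFinP.
    by apply: (@measurableT_comp _ _ _ _ _ _ (@powR R ^~ q)) => //; exact: measurable_powR.
  - by move=> x; rewrite inve_ge0 poweR_ge0.
  rewrite -[RHS]ge0_integral_esphere//.
  apply: eq_integral => x; rewrite inE => x1; have /andP[h1 _] := b_sphere x1.
  have Ax : (0 < A x)%R by rewrite mulr_gt0// powR_gt0// (lt_le_trans c10).
  by rewrite poweR_EFin inver gt_eqF ?powR_gt0// powRN.
  by move=> x; rewrite lee_fin powR_ge0.
rewrite -(fineK Kfin); set k := fine K in K0 *.
rewrite -EFinM !poweR_EFin inver gt_eqF; last by rewrite powR_gt0// mulr_gt0// powR_gt0.
rewrite -EFinM; congr EFin.
rewrite powRM ?powR_ge0 ?(ltW K0)// invfM.
have -> : ((a `^ (- q)) `^ N%:R^-1)^-1%R = (a `^ p^-1)%R.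
  by rewrite -powRrM -powRN /q mulNr opprK mulrAC divff ?mul1r// pnatr_eq0 gtn_eqF.
have k0 : (k `^ N%:R^-1 != 0)%R by rewrite gt_eqF// powR_gt0.
rewrite [LHS](_ : _ = (s `^ p^-1 * a `^ p^-1)%R); last by field.
by rewrite -powRM ?(ltW s0) ?(ltW a0)// /a mulrC divfK// gt_eqF.
Qed.

End spherical_comparison.

Section affine_energy.
Variables (R : realType) (n m : nat) (p : R) (Q : set 'rV[R]_m).
Hypotheses (n0 : (0 < n)%N) (m0 : (0 < m)%N) (p1 : 1 <= p).
Hypothesis Qbody : convex_body Q.
Hypothesis Q0 : Q 0.
Local Notation V := 'cV[R]_n.
Local Notation M := 'M[R]_(n, m).
Local Notation N := (n * m)%N.
Local Notation sigma := (@surface_measure R n 1).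
Local Notation S := (@surface_measure R n m).
Local Notation b := (@rgauge R n m p Q).
Context d (Z : measurableType d).
Variables (mu : {sigma_finite_measure set Z -> \bar R}) (u : Z -> V) (mass : R).
Hypothesis m_u : measurable_fun setT u.
Hypothesis massE : (\int[mu]_z (enorm (u z) `^ p)%:E = mass%:E)%E.

Local Opaque pkernel pgauge rgauge.

Let p0 : 0 < p. Proof. exact: lt_le_trans p1. Qed.

Definition kernel_mean (theta : M) : \bar R := (\int[mu]_z (pkernel p Q (u z) theta)%:E)%E.

Lemma measurable_kernel_mean : measurable_fun setT kernel_mean.
Proof.
have mpair : measurable_fun setT (fun z : M * Z => (u z.2, z.1)).
  apply/measurable_fun_pairP; split; last exact: measurable_fst.
  exact: (measurableT_comp m_u measurable_snd).
have mK : measurable_fun setT (fun z : M * Z => (pkernel p Q (u z.2) z.1)%:E).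
  apply/measurable_EFinP.
  exact: (measurableT_comp (@measurable_pkernel R n m p Q Qbody Q0) mpair).
apply: (measurable_fun_fubini_tonelli_F (m2 := mu) _ mK) => z.
by rewrite lee_fin pkernel_ge0.
Qed.

Lemma kernel_mean_ge0 theta : (0 <= kernel_mean theta)%E.
Proof. by apply: integral_ge0 => z _; rewrite lee_fin pkernel_ge0. Qed.

Let s : R := fine (sigma setT).

Let sE : sigma setT = s%:E.
Proof.
rewrite fineK// ge0_fin_numE//; exact: surface_measure_lty.
Qed.

Let s0 : 0 < s.
Proof. by rewrite fine_gt0// surface_measure_gt0// surface_measure_lty. Qed.

Let mass_ge0 : 0 <= mass.
Proof.
by rewrite -lee_fin -massE; apply: integral_ge0 => z _; rewrite lee_fin powR_ge0.
Qed.

Let average (W : M -> \bar R) : measurable_fun setT W ->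
  (forall theta, (0 <= W theta)%E) ->
  (forall (T : 'M[R]_n) theta, orthogonal_mx T -> W (T *m theta) = W theta) ->
  (s%:E * \int[S]_theta (W theta * kernel_mean theta) =
   mass%:E * \int[S]_theta (W theta * (b theta `^ p)%:E))%E.
Proof.
move=> mW W0 WT.
have av := averaging n0 (@measurable_pkernel R n m p Q Qbody Q0)
  (fun u theta => pkernel_ge0 p Q u theta)
  (fun T u theta oT => pkernel_orthogonal p Q u theta oT)
  (@pkernelZl R n m p Q Qbody Q0) mW W0 WT.
have avs := averaging_sphere n0 (@measurable_pkernel R n m p Q Qbody Q0)
  (fun u theta => pkernel_ge0 p Q u theta)
  (fun T u theta oT => pkernel_orthogonal p Q u theta oT)
  (@pkernelZl R n m p Q Qbody Q0) mW W0 WT.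
have -> : (\int[S]_theta (W theta * (b theta `^ p)%:E) =
    \int[S]_theta (W theta * \int[sigma]_v (pkernel p Q v theta)%:E))%E.
  apply: eq_integral => theta _; congr (_ * _)%E.
  by rewrite -(rgauge_powR n0 p1 Qbody Q0 theta).
by rewrite avs sE (av _ _ mu u m_u) massE muleCA.
Qed.

Let gauge_sphere : exists c1 c2 : R, 0 < c1 /\
  forall theta : M, enorm theta = 1 -> c1 <= b theta <= c2.
Proof.
have [c c0 hc] := pgauge_lower n0 m0 p1 Qbody Q0.
have [C C0 hC] := pgauge_upper n0 p1 Qbody Q0.
exists (c `^ p^-1), (C `^ p^-1); split; first exact: powR_gt0.
move=> theta th1; have b0 := rgauge_ge0 p Q theta.
have pV0 : 0 <= p^-1 by rewrite invr_ge0 ltW.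
have bE : b theta = (b theta `^ p) `^ p^-1.
  by rewrite -powRrM mulfV ?gt_eqF// powRr1.
have := hc theta; have := hC theta.
rewrite th1 powR1 !mulr1 (rgauge_powR n0 p1 Qbody Q0 theta) !lee_fin => h2 h1.
by rewrite bE; apply/andP; split; apply: ge0_ler_powR; rewrite ?nnegrE ?powR_ge0 ?(ltW c0).
Qed.

Let energyE (f : V -> R) : ~ {ae lebesgue_mx, forall z, f z = 0%R} ->
  (energy p Q f kernel_mean = (s `^ p^-1)%:E *
   (\int[S]_theta ((b theta ^+ N)^-1)%:E) `^ N%:R^-1 *
   ((\int[S]_theta (kernel_mean theta `^ (N%:R / p))^-1) `^ N%:R^-1)^-1)%E.
Proof.
move=> f0; rewrite /energy asboolF// /d_const.
rewrite (volume_polar_Pi_body n0 m0 p1 Qbody Q0).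
rewrite ge0_integral_esphere; first 1 last.
- apply: measurable_inve_ge0; last by move=> x; exact: poweR_ge0.
  apply: (@measurableT_comp _ _ _ _ _ _ (fun x => x `^ (N%:R / p))%E).
    exact: measurable_poweR.
  exact: measurable_kernel_mean.
- by move=> x; rewrite inve_ge0 poweR_ge0.
by rewrite -poweR_EFin -sE surface_measureT ?muln1.
Qed.

(** The field u is an arbitrary measurable one with integrable p-th power on any
    sigma-finite space, which covers both weak gradients and, for p = 1, the
    polar decomposition of the derivative of a function of bounded variation. *)
Lemma energy_le (f : V -> R) : (energy p Q f kernel_mean <= (mass `^ p^-1)%:E)%E.
Proof.
have [f0|f0] := pselect {ae lebesgue_mx, forall z, f z = 0%R}.
  by rewrite /energy asboolT// lee_fin powR_ge0.
have [c1 [c2 [c10 hc]]] := gauge_sphere.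
rewrite (energyE f0).
exact: (energy_bound n0 m0 p0 (@measurable_rgauge R n m p Q Qbody Q0)
  (rgauge_ge0 p Q) (fun T theta oT => rgauge_orthogonal p Qbody Q0 theta oT)
  s0 c10 hc measurable_kernel_mean kernel_mean_ge0 mass_ge0 average).
Qed.

Lemma energy_eq (f : V -> R) :
  ({ae lebesgue_mx, forall z, f z = 0%R} -> mass = 0) ->
  (forall (T : 'M[R]_n) theta, orthogonal_mx T -> kernel_mean (T *m theta) = kernel_mean theta) ->
  (energy p Q f kernel_mean = (mass `^ p^-1)%:E)%E.
Proof.
move=> f_mass JT.
have [f0|f0] := pselect {ae lebesgue_mx, forall z, f z = 0%R}.
  by rewrite /energy asboolT// f_mass// powR0// invr_eq0 gt_eqF.
have [c1 [c2 [c10 hc]]] := gauge_sphere.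
rewrite (energyE f0).
exact: (energy_equality n0 m0 p0 (@measurable_rgauge R n m p Q Qbody Q0)
  (rgauge_ge0 p Q) (fun T theta oT => rgauge_orthogonal p Qbody Q0 theta oT)
  s0 c10 hc measurable_kernel_mean kernel_mean_ge0 mass_ge0 average JT).
Qed.

End affine_energy.

(** * Smooth bump functions *)

Section flat_function.
Variable R : realType.

(** The index j records the negative powers of t which appear when exp (- 1 / t)
    is differentiated; the family is closed under differentiation up to linear
    combinations ([is_derive_flat]). *)
Definition flat (j : nat) (t : R) : R :=
  if 0 < t then (t ^+ j)^-1 * expR (- t^-1) else 0.

Lemma flat_ge0 j t : 0 <= flat j t.
Proof.
by rewrite /flat; case: ifPn => // t0; rewrite mulr_ge0 ?expR_ge0// invr_ge0 exprn_ge0// ltW.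
Qed.

(** A Taylor term of exp (1 / t) absorbs the power t^-j with one factor t to
    spare.  As [flat j t / t = flat j.+1 t], this gives the derivative at the
    origin. *)
Lemma flat_le j t : flat j t <= j.+1`!%:R * `|t|.
Proof.
rewrite /flat; case: ifPn => t0; last by rewrite mulr_ge0.
rewrite gtr0_norm// expRN.
have u0 : 0 <= t^-1 by rewrite invr_ge0 ltW.
have f0 : 0 < (j.+1`!%:R : R) by rewrite ltr0n fact_gt0.
have e0 : 0 < expR t^-1 by exact: expR_gt0.
have : t^-1 ^+ j.+1 / j.+1`!%:R <= expR t^-1.
  by apply: le_trans (expR_ge1Dxn j u0); rewrite lerDr.
rewrite ler_pdivrMr// => h.
rewrite ler_pdivrMr//.
have -> : (t ^+ j)^-1 = t * t^-1 ^+ j.+1.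
  by rewrite exprS mulrA divff ?gt_eqF// mul1r exprVn.
rewrite [leRHS](_ : _ = t * (expR t^-1 * j.+1`!%:R)); last by ring.
by rewrite ler_wpM2l// ltW.
Qed.

Let flat_gt0E j t : 0 < t -> flat j t = (t ^+ j)^-1 * expR (- t^-1).
Proof. by rewrite /flat => ->. Qed.

Let flat_le0E j t : t <= 0 -> flat j t = 0.
Proof. by rewrite /flat leNgt => /negbTE ->. Qed.

Lemma is_derive_flat j (t : R) :
  is_derive t (1 : R) (flat j) (flat j.+2 t - j%:R * flat j.+1 t).
Proof.
have [t0|t0|<-] := ltgtP 0 t.
- apply: (@near_eq_is_derive R R R (fun u : R => (u ^+ j)^-1 * expR (- u^-1))).
    near=> u; rewrite flat_gt0E//; near: u; apply: (cvgr_gt t) => //; exact: cvg_id.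
  have tn : t != 0 by rewrite gt_eqF.
  have tjn : t ^+ j != 0 by rewrite expf_neq0.
  have d1 : is_derive t (1 : R) (fun u : R => (u ^+ j)^-1) (- (t ^+ j) ^- 2 *: (j%:R * t ^+ j.-1)).
    have d0 : is_derive t (1 : R) (fun u : R => u ^+ j) (j%:R * t ^+ j.-1).
      apply: DeriveDef; first exact: exprn_derivable.
      by rewrite exp_derive /GRing.scale/= mulr1.
    exact: (@is_deriveV R (fun u : R => u ^+ j) t _ 1 tjn d0).
  have d2 : is_derive t (1 : R) (fun u : R => expR (- u^-1)) (expR (- t^-1) * (t ^- 2)).
    have dV : is_derive t (1 : R) (fun u : R => - u^-1) (t ^- 2).
      have := is_deriveN (@is_deriveV R (fun u : R => u) t _ 1 tn (is_derive_id t (1 : R))).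
      by move=> /is_derive_eq; apply; rewrite scaleNr opprK /GRing.scale/= mulr1.
    exact: (@is_derive1_comp R expR (fun u : R => - u^-1) t _ _ (is_derive_expR (- t^-1)) dV).
  have := is_deriveM d1 d2 => /is_derive_eq; apply.
  rewrite !flat_gt0E// /GRing.scale/=.
  case: j {d1 d2 tjn} => [|i] /=; first by rewrite !expr0 !expr1; field.
  by rewrite !exprS; field; rewrite tn expf_neq0.
- apply: (@near_eq_is_derive R R R (cst 0)).
    near=> u; rewrite flat_le0E//; apply/ltW.
    by near: u; apply: (cvgr_lt t) => //; exact: cvg_id.
  by rewrite !flat_le0E ?ltW// mulr0 subrr; exact: is_derive_cst.
- have c : (fun h : R => h^-1 *: ((flat j \o shift 0) (h *: (1 : R)) - flat j 0)) @ 0^' --> (0 : R).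
    apply/cvgr0Pnorm_le => e e0; near=> h.
    rewrite /= (flat_le0E j (lexx 0)) subr0 addr0 /GRing.scale/= mulr1.
    have F0 : 0 < (j.+2`!%:R : R) by rewrite ltr0n fact_gt0.
    have : `|h^-1 * flat j h| <= j.+2`!%:R * `|h|.
      have [h0|h0] := leP h 0; first by rewrite flat_le0E// mulr0 normr0 mulr_ge0.
      have -> : h^-1 * flat j h = flat j.+1 h.
        by rewrite !flat_gt0E// exprS invfM mulrA.
      by rewrite ger0_norm ?flat_ge0//; exact: flat_le.
    move=> /le_trans; apply.
    rewrite mulrC -ler_pdivlMr//; near: h; apply: dnbhs0_le.
    by rewrite divr_gt0.
  have -> : flat j.+2 0 - j%:R * flat j.+1 0 = 0.
    by rewrite !flat_le0E// mulr0 subrr.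
  apply: DeriveDef; first by apply/cvg_ex; exists (0 : R).
  exact: cvg_lim.
Unshelve. all: by end_near. Qed.

Lemma flat_le1 t : flat 0 t <= 1.
Proof.
rewrite /flat; case: ifPn => // t0.
by rewrite expr0 invr1 mul1r expR_le1 oppr_le0 invr_ge0 ltW.
Qed.

Lemma flat_neq0 j t : (flat j t != 0) = (0 < t).
Proof.
rewrite /flat; case: ifPn => [t0|]; last by rewrite eqxx.
by rewrite mulf_neq0// ?invr_neq0 ?expf_neq0 ?gt_eqF// expR_gt0.
Qed.

Lemma cvg_flat_dilate (t : R) :
  (fun k : nat => flat 0 (k.+1%:R * t)) @ \oo --> (if 0 < t then 1 else 0 : R).
Proof.
case: ifPn => t0; last first.
  rewrite (_ : (fun _ => _) = cst 0); first exact: cvg_cst.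
  by apply/funext => k; rewrite flat_le0E// mulr_ge0_le0// leNgt.
rewrite (_ : (fun _ => _) = (fun k : nat => expR (- (k.+1%:R * t)^-1))); last first.
  by apply/funext => k; rewrite flat_gt0E ?mulr_gt0// expr0 invr1 mul1r.
rewrite -[X in _ --> X]expR0; apply: continuous_cvg; first exact: continuous_expR.
rewrite -[X in _ --> X]oppr0; apply: cvgN.
rewrite (_ : (fun _ => _) = (fun k : nat => k.+1%:R^-1 * t^-1)); last first.
  by apply/funext => k; rewrite invfM.
rewrite -[X in _ --> X](mul0r t^-1); apply: cvgMl.
exact: cvg_harmonic.
Qed.

End flat_function.

Section flat_polynomials.
Variables (R : realType) (n : nat).
Local Notation V := 'cV[R]_n.

(** A family of smooth functions that contains bumps supported in boxes, and is
    closed under directional derivatives and under linear changes of variables.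
    Closure under the latter is what allows weak gradients to be transported by
    orthogonal matrices. *)
Inductive flat_poly : (V -> R) -> Prop :=
| flat_poly_cst (c : R) : flat_poly (fun=> c)
| flat_poly_flat (j : nat) (w : V) (c : R) :
    flat_poly (fun x => flat j (dotmx w x + c))
| flat_polyD f g : flat_poly f -> flat_poly g -> flat_poly (fun x => f x + g x)
| flat_polyM f g : flat_poly f -> flat_poly g -> flat_poly (fun x => f x * g x).

Lemma differentiable_dotmx (w x : V) : differentiable (fun y : V => dotmx w y : R) x.
Proof.
rewrite /dotmx.
have -> : (fun y : V => \sum_i \sum_j w i j * y i j : R) =
    \sum_(i < n) (fun y : V => w i ord0 * y i ord0).
  apply/funext => y; rewrite fct_sumE; apply: eq_bigr => i _.
  by rewrite big_ord1.
apply: differentiable_sum => i.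
by apply: differentiableZ; exact: differentiable_coord.
Qed.

Lemma is_derive_dotmx (w x v : V) : is_derive x v (fun y : V => dotmx w y : R) (dotmx w v).
Proof.
have c : (fun h : R => h^-1 *: (((fun y : V => dotmx w y) \o shift x) (h *: v) - dotmx w x)) @ 0^'
    --> (dotmx w v : R).
  apply: (@cvg_trans _ (cst (dotmx w v) @ 0^')); last exact: cvg_cst.
  apply: near_eq_cvg; near=> h.
  rewrite /= dotmxDr dotmxZr addrK /GRing.scale/= mulrA mulVf ?mul1r//.
  by near: h; exact: nbhs_dnbhs_neq.
apply: DeriveDef; first by apply/cvg_ex; exists (dotmx w v).
exact: cvg_lim.
Unshelve. all: by end_near. Qed.

Lemma is_derive_comp_dotmx (j : nat) (w x v : V) (c : R) :
  differentiable (fun y : V => flat j (dotmx w y + c)) x /\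
  'D_v (fun y : V => flat j (dotmx w y + c)) x =
  dotmx w v * (flat j.+2 (dotmx w x + c) - j%:R * flat j.+1 (dotmx w x + c)).
Proof.
have da : differentiable (fun y : V => dotmx w y + c : R) x.
  apply: differentiableD; first exact: differentiable_dotmx.
  exact: differentiable_cst.
have df : differentiable (flat j : R -> R) (dotmx w x + c).
  by apply/derivable1_diffP; have [] := is_derive_flat j (dotmx w x + c).
split; first exact: (differentiable_comp da df).
rewrite deriveE; last exact: (differentiable_comp da df).
rewrite (diff_comp da df) /= diff1E// -(deriveE _ da).
have -> : 'D_v (fun y : V => dotmx w y + c) x = dotmx w v.
  have [dw <-] := is_derive_dotmx w x v.
  by rewrite [LHS]deriveD// derive_cst addr0.
by rewrite derive1E; have [_ ->] := is_derive_flat j (dotmx w x + c).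
Qed.

Lemma flat_poly_smooth phi : flat_poly phi ->
  (forall x, differentiable phi x) /\
  (forall v, flat_poly (fun x => 'D_v phi x)).
Proof.
have ext (f g : V -> R) : f =1 g -> flat_poly f -> flat_poly g.
  by move=> /funext ->.
elim => [c|j w c|f g pf [df Df] pg [dg Dg]|f g pf [df Df] pg [dg Dg]].
- split => [x|v]; first exact: differentiable_cst.
  apply: (ext (fun=> 0)); last exact: flat_poly_cst.
  by move=> x; apply/esym; exact: derive_cst.
- split => [x|v]; first by have [] := is_derive_comp_dotmx j w x 0 c.
  apply: (ext (fun x => dotmx w v *
    (flat j.+2 (dotmx w x + c) + (- j%:R) * flat j.+1 (dotmx w x + c)))).
    by move=> x; have [_ ->] := is_derive_comp_dotmx j w x v c; rewrite mulNr.
  apply: flat_polyM; first exact: flat_poly_cst.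
  apply: flat_polyD; first exact: flat_poly_flat.
  apply: flat_polyM; first exact: flat_poly_cst.
  exact: flat_poly_flat.
- split => [x|v]; first exact: (differentiableD (df x) (dg x)).
  apply: (ext (fun x => 'D_v f x + 'D_v g x)); last exact: flat_polyD.
  by move=> x; apply/esym; apply: deriveD; exact: diff_derivable.
- split => [x|v]; first exact: (differentiableM (df x) (dg x)).
  apply: (ext (fun x => f x * 'D_v g x + g x * 'D_v f x)).
    by move=> x; apply/esym; apply: deriveM; exact: diff_derivable.
  by apply: flat_polyD; exact: flat_polyM.
Qed.

Lemma flat_poly_differentiable phi x : flat_poly phi -> differentiable phi x.
Proof. by move=> /flat_poly_smooth[]. Qed.

Lemma flat_poly_continuous phi : flat_poly phi -> continuous phi.
Proof. by move=> pphi x; apply: differentiable_continuous; exact: flat_poly_differentiable. Qed.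

Lemma flat_poly_of_class_C k phi : flat_poly phi -> of_class_C k phi.
Proof.
elim: k phi => [|k ih] phi pphi /=; first exact: flat_poly_continuous.
split; first exact: flat_poly_continuous.
have [df Df] := flat_poly_smooth pphi.
move=> i; split; first by move=> x; exact: diff_derivable.
exact/ih/Df.
Qed.

Lemma flat_poly_linear (T : 'M[R]_n) phi : flat_poly phi ->
  flat_poly (fun x => phi (T *m x)).
Proof.
elim => [c|j w c|f g _ pf _ pg|f g _ pf _ pg].
- exact: flat_poly_cst.
- have -> : (fun x => flat j (dotmx w (T *m x) + c)) =
      (fun x => flat j (dotmx (T^T *m w) x + c)).
    apply/funext => x; congr (flat j (_ + c)).
    by rewrite !dotmx_trace trmx_mul trmxK mulmxA.
  exact: flat_poly_flat.
- exact: flat_polyD.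
- exact: flat_polyM.
Qed.

Lemma derive_linear (T : 'M[R]_n) (phi : V -> R) (v x : V) :
  'D_v (fun y => phi (T *m y)) x = 'D_(T *m v) phi (T *m x).
Proof.
have E : (fun h : R => h^-1 *: (((fun y => phi (T *m y)) \o shift x) (h *: v) -
      phi (T *m x))) =
    (fun h : R => h^-1 *: ((phi \o shift (T *m x)) (h *: (T *m v)) - phi (T *m x))).
  by apply/funext => h /=; rewrite mulmxDr -scalemxAr.
by rewrite /derive E.
Qed.

Lemma flat_poly_deriveE phi (v x : V) : flat_poly phi ->
  'D_v phi x = \sum_i v i ord0 * partial i phi x.
Proof.
move=> pphi; have d := flat_poly_differentiable x pphi.
rewrite deriveE// {1}(matrix_sum_delta v) linear_sum/=.
by apply: eq_bigr => i _; rewrite big_ord1 linearZ/= /partial deriveE.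
Qed.

Lemma partial_linear (T : 'M[R]_n) phi (i : 'I_n) (x : V) : flat_poly phi ->
  partial i (fun y => phi (T *m y)) x = \sum_j T j i * partial j phi (T *m x).
Proof.
move=> pphi; rewrite /partial derive_linear flat_poly_deriveE//.
apply: eq_bigr => j _; congr (_ * _).
rewrite mxE (bigD1 i)//= mxE !eqxx mulr1 big1 ?addr0// => k ki.
by rewrite mxE (negbTE ki) mulr0.
Qed.

Lemma compact_cube (c : R) : compact (@cube R n 1 c).
Proof.
have cr : compact [set v : 'rV[R]_n | forall i, `[- c, c]%classic (v ord0 i)].
  by apply: (@rV_compact R n (fun=> `[- c, c]%classic)) => _; exact: segment_compact.
have ct : {within [set v : 'rV[R]_n | forall i, `[- c, c]%classic (v ord0 i)],
    continuous (fun v : 'rV[R]_n => v^T)}.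
  apply: continuous_subspaceT => v A /= /nbhs_ballP[e /= e0 eA].
  apply/nbhs_ballP; exists e => // w [_ vw]; apply: eA.
  by apply: ball_mx_coord => // i j; rewrite !mxE; exact: vw.
have := continuous_compact ct cr; congr compact.
apply/seteqP; split => [_ [v hv <-] i j|x hx].
  by rewrite mxE ord1; have := hv i; rewrite /= in_itv/= ler_norml.
exists x^T; last by rewrite trmxK.
by move=> i /=; rewrite mxE in_itv/= -ler_norml; exact: hx.
Qed.

Lemma flat_poly_test_fun phi (c : R) : flat_poly phi ->
  (forall x, phi x != 0 -> cube c x) -> test_fun phi.
Proof.
move=> pphi supp; split; first by move=> k; exact: flat_poly_of_class_C.
have cc := @compact_cube c.
have clc : closed (@cube R n 1 c) by apply: compact_closed cc; exact: norm_hausdorff.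
apply: (subclosed_compact _ cc); first exact: closed_closure.
rewrite [X in _ `<=` X]((closure_id _).1 clc).
by apply: closure_subset => x; exact: supp.
Qed.

End flat_polynomials.

(** * Functions with vanishing integrals against bumps *)

(** The proofs that the density is measurable and nonnegative are arguments, so
    that the measure structure below can be inferred from the term. *)
Definition density_measure d (T : measurableType d) (R : realType)
    (mu : {measure set T -> \bar R}) (f : T -> \bar R)
    (mf : measurable_fun setT f) (f0 : forall x, (0 <= f x)%E) (A : set T) : \bar R :=
  (\int[mu]_(x in A) f x)%E.

Section density_measure.
Context d (T : measurableType d) (R : realType) (mu : {measure set T -> \bar R}).
Variables (f : T -> \bar R) (mf : measurable_fun setT f) (f0 : forall x, (0 <= f x)%E).
Local Open Scope ereal_scope.

Let density0 : density_measure mu mf f0 set0 = 0.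
Proof. exact: integral_set0. Qed.

Let density_ge0 A : 0 <= density_measure mu mf f0 A.
Proof. exact: integral_ge0. Qed.

Let density_sigma_additive : semi_sigma_additive (density_measure mu mf f0).
Proof.
move=> F mF tF mUF; rewrite /density_measure ge0_integral_bigcup//; last first.
  exact: measurable_funTS.
apply: is_cvg_nneseries_cond => n _ _; exact: integral_ge0.
Qed.

HB.instance Definition _ := isMeasure.Build _ _ _ (density_measure mu mf f0)
  density0 density_ge0 density_sigma_additive.

End density_measure.

Section boxes.
Variables (R : realType) (n : nat).
Local Notation V := 'cV[R]_n.

Definition box (a b : V) : set V :=
  [set x | forall i, a i ord0 < x i ord0 < b i ord0].

Lemma measurable_box a b : measurable (box a b).
Proof.
have -> : box a b = \bigcap_(i in [set: 'I_n])
    ((fun x : V => x i ord0 : measurableTypeR R) @^-1` `]a i ord0, b i ord0[%classic).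
  by apply/seteqP; split => [x h i _|x h i]; [have := h i|have := h i Logic.I];
    rewrite /= in_itv.
apply: fin_bigcap_measurable => // i _.
rewrite -[X in measurable X]setTI; exact: measurable_mx_coord.
Qed.

Definition boxes : set (set V) := [set box a b | a in setT & b in setT].

Lemma boxesI : setI_closed boxes.
Proof.
move=> _ _ [a _ [b _ <-]] [a' _ [b' _ <-]].
exists (\col_i Num.max (a i ord0) (a' i ord0)) => //.
exists (\col_i Num.min (b i ord0) (b' i ord0)) => //.
apply/seteqP; split => x.
  move=> h; split => i; have := h i; rewrite !mxE gt_max lt_min.
    by move=> /andP[/andP[-> _] /andP[-> _]].
  by move=> /andP[/andP[_ ->] /andP[_ ->]].
move=> [h h'] i; rewrite !mxE gt_max lt_min.
by move: (h i) (h' i) => /andP[-> ->] /andP[-> ->].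
Qed.

Definition centered_box (k : nat) : set V := box (const_mx (- k%:R)) (const_mx k%:R).

Lemma centered_box_cover : \bigcup_k centered_box k = setT.
Proof.
apply/seteqP; split => // x _.
have [k hk] : exists k : nat, enorm x < k%:R.
  by exists (Num.truncn (enorm x)).+1; rewrite truncnS_gt ?enorm_ge0.
exists k => // i; rewrite !mxE -ltr_norml.
exact: le_lt_trans (enorm_coord x i ord0) hk.
Qed.

Lemma measurable_boxes : (@measurable _ V) = <<s boxes >>.
Proof.
apply/seteqP; split; last first.
  apply: smallest_sub; first exact: sigma_algebra_measurable.
  by move=> _ [a _ [b _ <-]]; exact: measurable_box.
apply: smallest_sub; first exact: smallest_sigma_algebra.
move=> _ [i [j [B mB ->]]]; rewrite (ord1 j) => {j}.
have mcoord : @measurable_fun _ _ (g_sigma_algebraType boxes) (measurableTypeR R) setT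
    (fun x : V => x i ord0).
  apply: (measurability _ (RGenOInfty.measurableE R)).
  move=> _ [_ [r ->] <-]; rewrite setTI.
  have -> : (fun x : V => x i ord0) @^-1` `]r, +oo[%classic =
      \bigcup_k box (\col_l if l == i then r else - k%:R) (const_mx k%:R).
    apply/seteqP; split => x /=.
      rewrite in_itv/= andbT => rx.
      have [k hk] : exists k : nat, enorm x < k%:R.
        by exists (Num.truncn (enorm x)).+1; rewrite truncnS_gt ?enorm_ge0.
      exists k => // l; rewrite !mxE.
      have := le_lt_trans (enorm_coord x l ord0) hk; rewrite ltr_norml => /andP[h1 h2].
      by rewrite h2 andbT; case: eqP => [->|_].
    by move=> [k _ /(_ i)]; rewrite !mxE eqxx in_itv/= andbT => /andP[].
  apply: bigcupT_measurable => k; apply: sub_sigma_algebra.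
  by exists (\col_l if l == i then r else - k%:R) => //; exists (const_mx k%:R).
by have := mcoord measurableT B mB; rewrite setTI.
Qed.

End boxes.

Section bump_functions.
Variables (R : realType) (n : nat).
Local Notation V := 'cV[R]_n.
Local Notation lambda := (@lebesgue_mx R n 1).
Implicit Types (a b x : V).

(** As k grows this increases to the indicator function of the open box with
    corners a and b. *)
Definition bump a b (k : nat) : V -> R := fun x =>
  \prod_(i < n) (flat 0 (k.+1%:R * (x i ord0 - a i ord0)) *
                 flat 0 (k.+1%:R * (b i ord0 - x i ord0))).

Lemma flat_poly_bump a b k : flat_poly (bump a b k).
Proof.
rewrite /bump; elim: (index_enum _) => [|i r ih].
  have -> : (fun x : V => \prod_(i <- [::]) (flat 0 (k.+1%:R * (x i ord0 - a i ord0)) *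
      flat 0 (k.+1%:R * (b i ord0 - x i ord0))) : R) = fun=> 1.
    by apply/funext => x; rewrite big_nil.
  exact: flat_poly_cst.
pose e : V := k.+1%:R *: delta_mx i ord0.
have eE x : dotmx e x = k.+1%:R * x i ord0.
  rewrite dotmxC dotmxZr dotmxC /dotmx (bigD1 i)//= big_ord1 mxE !eqxx mul1r.
  by rewrite big1 ?addr0// => l li; rewrite big_ord1 mxE (negbTE li) mul0r.
have eNE x : dotmx (- e) x = - (k.+1%:R * x i ord0).
  by rewrite dotmxC dotmxNr dotmxC eE.
have -> : (fun x : V => \prod_(l <- i :: r) (flat 0 (k.+1%:R * (x l ord0 - a l ord0)) *
      flat 0 (k.+1%:R * (b l ord0 - x l ord0)))) =
    (fun x => (flat 0 (dotmx e x + - (k.+1%:R * a i ord0)) *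
      flat 0 (dotmx (- e) x + k.+1%:R * b i ord0)) *
      \prod_(l <- r) (flat 0 (k.+1%:R * (x l ord0 - a l ord0)) *
      flat 0 (k.+1%:R * (b l ord0 - x l ord0)))).
  apply/funext => x; rewrite big_cons; congr (flat 0 _ * flat 0 _ * _).
    by rewrite eE mulrBr.
  by rewrite eNE mulrBr addrC.
apply: flat_polyM => //; apply: flat_polyM; exact: flat_poly_flat.
Qed.

Lemma bump_ge0 a b k x : 0 <= bump a b k x.
Proof. by apply: prodr_ge0 => i _; rewrite mulr_ge0// flat_ge0. Qed.

Lemma bump_le1 a b k x : bump a b k x <= 1.
Proof.
apply: prodr_ile1 => i _; rewrite mulr_ge0 ?flat_ge0//=.
by apply: mulr_ile1; rewrite ?flat_ge0 ?flat_le1.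
Qed.

Lemma bump_supp a b k x : bump a b k x != 0 -> box a b x.
Proof.
move=> h i; move: h; rewrite /bump => /prodf_neq0 /(_ i isT).
rewrite mulf_eq0 negb_or !flat_neq0 !pmulr_rgt0// !subr_gt0.
by move=> /andP[-> ->].
Qed.

Lemma cvg_bump a b x : bump a b k x @[k --> \oo] --> (\1_(box a b) x : R).
Proof.
have -> : (\1_(box a b) x : R) = \prod_(i < n)
   ((if 0 < x i ord0 - a i ord0 then 1 else 0) * (if 0 < b i ord0 - x i ord0 then 1 else 0)).
  rewrite indicE; have [hx|hx] := boolP (x \in box a b).
    rewrite big1// => i _; move: hx; rewrite inE => /(_ i).
    by rewrite !subr_gt0 => /andP[-> ->]; rewrite mulr1.
  have [i hi] : exists i, ~~ (a i ord0 < x i ord0 < b i ord0).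
    apply: contrapT => /forallNP h; move/negP: hx; apply; rewrite inE => i.
    by apply: contrapT => /negP; exact: h.
  rewrite (bigD1 i)//= !subr_gt0.
  by move: hi; rewrite negb_and => /orP[/negbTE->|/negbTE->]; rewrite ?mul0r ?mulr0 ?mul0r.
rewrite /bump; elim: (index_enum _) => [|i r ih].
  rewrite big_nil; under eq_fun do rewrite big_nil; exact: cvg_cst.
rewrite big_cons; under eq_fun do rewrite big_cons.
apply: cvgM => //; apply: cvgM; exact: cvg_flat_dilate.
Qed.

End bump_functions.

Lemma box_sub_cube (R : realType) n (a b : 'cV[R]_n) :
  box a b `<=` cube (\sum_i (`|a i ord0| + `|b i ord0|)).
Proof.
move=> x h i j; rewrite (ord1 j) ler_norml; have /andP[h1 h2] := h i.
set c := \sum_i _.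
have hc : `|a i ord0| + `|b i ord0| <= c.
  by rewrite /c (bigD1 i)//= lerDl sumr_ge0// => l _; rewrite addr_ge0.
have := ler_norm (b i ord0); have := ler_norm (- a i ord0); rewrite normrN => h3 h4.
have := normr_ge0 (a i ord0); have := normr_ge0 (b i ord0) => h5 h6.
apply/andP; split; lra.
Qed.

Lemma integral_supp d (T : measurableType d) (R : realType)
    (mu : {measure set T -> \bar R}) (D : set T) (F : T -> \bar R) :
  (forall x, ~ D x -> F x = 0%E) -> (\int[mu]_x F x = \int[mu]_(x in D) F x)%E.
Proof.
move=> FD; rewrite [RHS]integral_mkcond; apply: eq_integral => x _.
rewrite /patch; case: ifPn => // /negP; rewrite inE => /FD //.
Qed.

Section fundamental_lemma.
Variables (R : realType) (n : nat).
Local Notation V := 'cV[R]_n.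
Local Notation lambda := (@lebesgue_mx R n 1).
Implicit Types (a b x : V).
Variable G : V -> R.
Hypothesis mG : measurable_fun setT G.
Hypothesis iG : forall c : R, lambda.-integrable (cube c) (EFin \o G).
Local Open Scope ereal_scope.

Lemma integral_box_eq0 a b :
  (forall k, \int[lambda]_x (G x * bump a b k x)%:E = 0) ->
  \int[lambda]_(x in box a b) (G x)%:E = 0.
Proof.
move=> G0.
pose c : R := (\sum_i (`|a i ord0| + `|b i ord0|))%R.
have bc : box a b `<=` cube c by exact: box_sub_cube.
have mc := @measurable_cube R n 1 c.
have mbump k : measurable_fun setT (bump a b k).
  by apply: continuous_mx_measurable; exact: flat_poly_continuous (flat_poly_bump _ _ _).
have mb := measurable_box a b.
have iGc := iG c.
have cv : \int[lambda]_(x in cube c) (G x * bump a b k x)%:E @[k --> \oo] -->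
    \int[lambda]_(x in cube c) (G x * \1_(box a b) x)%:E.
  apply: (@dominated_cvg _ _ _ lambda (cube c) mc _ _ (abse \o (EFin \o G))).
  - move=> k; apply: measurable_funTS; apply/measurable_EFinP.
    exact: measurable_funM.
  - move=> x _; apply: cvg_EFin; first exact: nearW.
    by apply: cvgM; [exact: cvg_cst|exact: cvg_bump].
  - by move=> x _.
  - exact: integrable_abse.
  - move=> k x _; rewrite /= lee_fin normrM -[leRHS]mulr1 ler_wpM2l//.
    by rewrite ger0_norm ?bump_ge0// bump_le1.
have cv0 : (fun k => \int[lambda]_(x in cube c) (G x * bump a b k x)%:E) = cst 0.
  apply/funext => k; rewrite /= -[RHS](G0 k); apply/esym; apply: integral_supp => x cx.
  suff -> : bump a b k x = 0%R by rewrite mulr0.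
  by apply/eqP; apply: contrapT => /negP /bump_supp /bc.
rewrite cv0 in cv.
have E0 : \int[lambda]_(x in cube c) (G x * \1_(box a b) x)%:E = 0.
  have <- := cvg_lim (@ereal_hausdorff R) cv.
  exact: (lim_cst (@ereal_hausdorff R)).
rewrite -[RHS]E0 -(@integral_supp _ _ _ lambda (cube c) (fun x => (G x * \1_(box a b) x)%:E)); last first.
  move=> x cx; rewrite indicE memNset ?mulr0// => /bc //.
rewrite [LHS]integral_mkcond; apply: eq_integral => x _.
by rewrite /patch indicE; case: ifP => _; rewrite ?mulr1 ?mulr0.
Qed.

(** By dominated convergence the integral of G over every box vanishes, so the
    measures with densities the positive and the negative part of G agree on
    boxes, hence everywhere.  As these parts are supported in disjoint sets, both
    vanish almost everywhere. *)
Lemma fundamental_lemma_boxes :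
  (forall a b k, \int[lambda]_x (G x * bump a b k x)%:E = 0) ->
  {ae lambda, forall x, G x = 0%R}.
Proof.
move=> G0.
pose GE : V -> \bar R := EFin \o G.
have mGE : measurable_fun setT GE by exact/measurable_EFinP.
have mp : measurable_fun setT (GE^\+) by exact: measurable_funepos.
have mn : measurable_fun setT (GE^\-) by exact: measurable_funeneg.
pose m1 : {measure set V -> \bar R} := density_measure lambda mp (funepos_ge0 GE).
pose m2 : {measure set V -> \bar R} := density_measure lambda mn (funeneg_ge0 GE).
have boxfin a b : lambda.-integrable (box a b) GE.
  apply: (integrableS _ _ (@box_sub_cube R n a b)).
  - exact: measurable_cube.
  - exact: measurable_box.
  - exact: iG.
have m12 A : boxes A -> m1 A = m2 A.
  move=> [a _ [b _ <-]].
  have := integral_box_eq0 (G0 a b); rewrite integralE => e.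
  have h2 := integrable_neg_fin_num (measurable_box a b) (boxfin a b).
  have := subeK (\int[lambda]_(x in box a b) GE^\+ x) h2.
  by rewrite e add0e.
have m1fin k : m1 (centered_box k) < +oo.
  have h := integrable_pos_fin_num (measurable_box _ _)
    (boxfin (const_mx (- k%:R)%R) (const_mx k%:R%R)).
  by rewrite -ge0_fin_numE.
have mE A : measurable A -> m1 A = m2 A.
  apply: (measure_unique (@boxes R n) (@centered_box R n)) => //.
  - exact: measurable_boxes.
  - exact: boxesI.
  - by move=> k; exists (const_mx (- k%:R)%R) => //; exists (const_mx k%:R%R).
  - exact: centered_box_cover.
(* integrating over the set where f1 does not vanish, on which f2 does *)
have part0 (f1 f2 : V -> \bar R) : measurable_fun setT f1 -> measurable_fun setT f2 ->
    (forall x, 0 <= f1 x) -> (forall x, f1 x = 0 \/ f2 x = 0) ->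
    (forall A, measurable A -> \int[lambda]_(x in A) f1 x = \int[lambda]_(x in A) f2 x) ->
    {ae lambda, forall x, f1 x = 0}.
  move=> mf1 mf2 f10 disj e12.
  pose A := [set x : V | f1 x != 0].
  have mA : measurable A.
    have -> : A = f1 @^-1` (~` [set 0]).
      by apply/seteqP; split => x /eqP.
    by rewrite -[X in measurable X]setTI; apply: mf1 => //; exact: measurableC.
  have f1int : \int[lambda]_x `|f1 x| = 0.
    rewrite (@integral_supp _ _ _ lambda A); last first.
      by move=> x /negP; rewrite negbK => /eqP ->; rewrite abse0.
    rewrite (eq_integral f1); last by move=> x _; rewrite gee0_abs.
    rewrite e12// (eq_integral (cst 0)) ?integral0// => x; rewrite inE => /eqP f1x.
    by have [|] := disj x.
  have /(ae_eq_integral_abs lambda measurableT mf1) := f1int.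
  by apply: filterS => x /(_ Logic.I).
have disj x : GE^\+ x = 0 \/ GE^\- x = 0.
  rewrite funeposE funenegE; have [h|h] := leP 0 (GE x).
    by right; rewrite max_r// oppe_le0.
  by left.
have disj' x : GE^\- x = 0 \/ GE^\+ x = 0 by have [] := disj x; [right|left].
have ae1 := part0 _ _ mp mn (funepos_ge0 GE) disj mE.
have ae2 := part0 _ _ mn mp (funeneg_ge0 GE) disj'
  (fun A mA => esym (mE A mA)).
apply: filterS2 ae1 ae2 => x h1 h2.
have := congr1 (fun F : V -> \bar R => F x) (funeposneg GE).
by rewrite /= h1 h2 sube0; exact: EFin_inj.
Qed.

End fundamental_lemma.

(** * Weak gradients *)

Section local_integrability.
Variables (R : realType) (n : nat).
Local Notation V := 'cV[R]_n.
Local Notation lambda := (@lebesgue_mx R n 1).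
Implicit Types (F psi : V -> R).

Definition locally_integrable F := measurable_fun setT F /\
  forall c : R, lambda.-integrable (cube c) (EFin \o F).

Lemma locally_integrable_mul F psi (c : R) :
  locally_integrable F -> continuous psi -> (forall x, psi x != 0 -> cube c x) ->
  lambda.-integrable setT (fun x => (F x * psi x)%:E).
Proof.
move=> [mF iF] cpsi supp.
have mpsi : measurable_fun setT psi by exact: continuous_mx_measurable.
have mc := @measurable_cube R n 1 c.
have [B hB] : exists B : R, forall x, cube c x -> `|psi x| <= B.
  have := continuous_compact (continuous_subspaceT cpsi) (@compact_cube R n c).
  move=> /compact_bounded[B [_ hB]]; exists (B + 1) => x cx.
  by apply: (hB (B + 1)); [rewrite ltrDl|exists x].
have icube : lambda.-integrable (cube c) (fun x => (F x * psi x)%:E).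
  apply: (@le_integrable _ _ _ lambda _ mc _ (fun x => (B%:E * (EFin \o F) x)%E)).
  - by apply: measurable_funTS; apply/measurable_EFinP; exact: measurable_funM.
  - move=> x cx; rewrite /= lee_fin normrM [leRHS]normrM mulrC ler_wpM2r//.
    by apply: le_trans (ler_norm _); exact: hB.
  - exact: integrableZl.
have -> : (fun x => (F x * psi x)%:E) = (fun x => (F x * psi x)%:E) \_ (cube c).
  apply/funext => x; rewrite /patch; case: ifPn => // /negP; rewrite inE => ncx.
  suff -> : psi x = 0 by rewrite mulr0.
  by apply/eqP; apply: contrapT => /negP /supp.
exact: (integrable_mkcond _ mc).1 icube.
Qed.

Lemma partial_supp phi (c : R) (i : 'I_n) : (forall x, phi x != 0 -> cube c x) ->
  forall x, partial i phi x != 0 -> cube c x.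
Proof.
move=> supp x; apply: contraPP => ncx; apply/negP; rewrite negbK; apply/eqP.
have clc : closed (@cube R n 1 c).
  by apply: compact_closed (@compact_cube R n c); exact: norm_hausdorff.
have : \near x, phi x = cst 0 x.
  have : nbhs x (~` (@cube R n 1 c)).
    by apply: open_nbhs_nbhs; split => //; exact: closed_openC.
  apply: filterS => y ncy; apply/eqP; apply: contrapT => /negP /supp.
  exact: ncy.
by move=> h; rewrite /partial (near_eq_derive _ h) derive_cst.
Qed.

Lemma cube_orthogonal (T : 'M[R]_n) (c : R) (x : V) : orthogonal_mx T ->
  cube c x -> cube (n%:R * c) (T *m x).
Proof.
move=> oT cx i j; rewrite (ord1 j); apply: (le_trans (enorm_coord _ _ _)).
rewrite enorm_orthogonal//; apply: (le_trans (enorm_le_sum _)).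
apply: (@le_trans _ _ (\sum_(k < n) c)).
  by apply: ler_sum => k _; rewrite big_ord1; exact: cx.
by rewrite sumr_const card_ord mulr_natl.
Qed.

Lemma integral_orthogonal (T : 'M[R]_n) (F : V -> \bar R) : orthogonal_mx T ->
  measurable_fun setT F ->
  (\int[lambda]_x F (T *m x) = \int[lambda]_x F x)%E.
Proof.
move=> oT mF; rewrite integralE [RHS]integralE; congr (_ - _)%E.
  rewrite -[RHS](ge0_integral_lebesgue_mx_orthogonal oT); last by move=> x; exact: funepos_ge0.
    by apply: eq_integral => x _; rewrite !funeposE.
  exact: measurable_funepos.
rewrite -[RHS](ge0_integral_lebesgue_mx_orthogonal oT); last by move=> x; exact: funeneg_ge0.
  by apply: eq_integral => x _; rewrite !funenegE.
exact: measurable_funeneg.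
Qed.

Lemma locally_integrable_orthogonal (T : 'M[R]_n) F : orthogonal_mx T ->
  locally_integrable F -> locally_integrable (fun x => F (T *m x)).
Proof.
move=> oT [mF iF].
have mFT : measurable_fun setT (fun x => F (T *m x)).
  exact: (measurableT_comp mF (@measurable_mx_mull R n 1 T)).
split => // c; apply/integrableP; split.
  by apply: measurable_funTS; exact/measurable_EFinP.
have mE : measurable_fun setT (fun x => `|(F x)%:E|%E).
  by apply: measurableT_comp => //; exact/measurable_EFinP.
have mc := @measurable_cube R n 1 (n%:R * c).
have /integrableP[_] := iF (n%:R * c); apply: le_lt_trans.
rewrite integral_mkcond [leRHS]integral_mkcond.
rewrite -[leRHS](ge0_integral_lebesgue_mx_orthogonal oT); last 2 first.
- apply/(measurable_restrictT _ _).1 => //; exact: measurable_funTS.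
- by move=> x; rewrite /patch; case: ifP.
apply: ge0_le_integral => //.
- by move=> x _; rewrite /patch; case: ifP.
- apply/(measurable_restrictT _ _).1; first exact: measurable_cube.
  apply: measurable_funTS; apply: measurableT_comp => //; exact/measurable_EFinP.
- apply: (measurableT_comp _ (@measurable_mx_mull R n 1 T)).
  apply/(measurable_restrictT _ _).1 => //; exact: measurable_funTS.
move=> x _; rewrite /patch; case: ifPn; rewrite ?inE => cx.
  by rewrite mem_set//; exact: cube_orthogonal.
by case: ifP => // _; exact: abse_ge0.
Qed.

Lemma Lfun_integral_powR_lty (p : R) F : p != 0 -> F \in Lfun lambda p%:E ->
  (\int[lambda]_x (`|F x| `^ p)%:E < +oo)%E.
Proof.
move=> p0 LF.
have /set_mem : F \in finLfun lambda p%:E := sub_Lfun_finLfun LF.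
by rewrite /finLfun/= /finite_norm => h; have := poweR_lty p h; rewrite poweR_Lnorm//.
Qed.

Lemma Lfun_locally_integrable (p : R) F : 1 <= p ->
  F \in Lfun lambda p%:E -> locally_integrable F.
Proof.
move=> p1 LF.
have mF : measurable_fun setT F by have /set_mem := sub_Lfun_mfun LF.
have p0 : p != 0 by rewrite gt_eqF// (lt_le_trans _ p1).
have Foo := Lfun_integral_powR_lty p0 LF.
split => // c; apply/integrableP; split.
  by apply: measurable_funTS; exact/measurable_EFinP.
have mc := @measurable_cube R n 1 c.
have mFp : measurable_fun setT (fun x => (`|F x| `^ p)%:E).
  apply/measurable_EFinP; apply: (@measurableT_comp _ _ _ _ _ _ (@powR R ^~ p)) => //.
  exact: measurableT_comp.
apply: (@le_lt_trans _ _ (\int[lambda]_(x in cube c) (1 + (`|F x| `^ p)%:E))%E).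
  apply: ge0_le_integral => //.
  - apply: measurable_funTS; apply: measurableT_comp => //; exact/measurable_EFinP.
  - by apply: measurable_funTS; apply: emeasurable_funD.
  move=> x _; rewrite /= -EFinD lee_fin.
  have [h|/ltW h] := leP `|F x| 1.
    by apply: (le_trans h); rewrite lerDl powR_ge0.
  by apply: (le_trans (le1r_powR h p1)); rewrite lerDr.
rewrite ge0_integralD//; last exact: measurable_funTS.
rewrite lte_add_pinfty//.
  rewrite integral_cst// mul1e.
  have [c0|c0] := leP 0 c; first by rewrite [ltLHS]lebesgue_cube// ltry.
  apply: (@le_lt_trans _ _ (lambda (cube 0))); last by rewrite [ltLHS]lebesgue_cube// ltry.
  apply: le_measure; rewrite ?inE//; first exact: measurable_cube.
  by move=> x cx i j; apply: (le_trans (cx i j)); exact: ltW.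
by apply: le_lt_trans Foo; apply: ge0_subset_integral.
Qed.

End local_integrability.

Section tested_gradient.
Variables (R : realType) (n : nat).
Local Notation V := 'cV[R]_n.
Local Notation lambda := (@lebesgue_mx R n 1).
Implicit Types (f phi : V -> R) (g : V -> V).

(** A weakening of the notion of weak gradient with fewer test functions, which
    is still strong enough for uniqueness and is stable under composition with
    orthogonal matrices. *)
Definition tested_gradient f g :=
  (forall i, locally_integrable (fun x => g x i ord0)) /\
  forall i phi (c : R), flat_poly phi -> (forall x, phi x != 0 -> cube c x) ->
    (\int[lambda]_x (f x * partial i phi x)%:E =
     - \int[lambda]_x (g x i ord0 * phi x)%:E)%E.

Lemma weak_gradient_tested f g : weak_gradient f g -> tested_gradient f g.
Proof.
move=> [mg ig wg]; split => [i|i phi c pphi supp].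
  by split; [exact: mg|move=> c; apply: ig; exact: compact_cube].
by apply: wg; exact: flat_poly_test_fun supp.
Qed.

Lemma integral_ae_eq_mul f f' (psi : V -> R) :
  measurable_fun setT f -> measurable_fun setT f' -> measurable_fun setT psi ->
  {ae lambda, forall x, f x = f' x} ->
  (\int[lambda]_x (f x * psi x)%:E = \int[lambda]_x (f' x * psi x)%:E)%E.
Proof.
move=> mf mf' mpsi ff'; apply: ae_eq_integral => //.
- by apply/measurable_EFinP; exact: measurable_funM.
- by apply/measurable_EFinP; exact: measurable_funM.
- by apply: filterS ff' => x -> _.
Qed.

Lemma measurable_partial phi i : flat_poly phi -> measurable_fun setT (partial i phi).
Proof.
move=> pphi; apply: continuous_mx_measurable.
by apply: flat_poly_continuous; have [_ ] := flat_poly_smooth pphi; apply.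
Qed.

Lemma tested_gradient_unique f f' g g' :
  measurable_fun setT f -> measurable_fun setT f' ->
  {ae lambda, forall x, f x = f' x} ->
  tested_gradient f g -> tested_gradient f' g' ->
  {ae lambda, forall x, g x = g' x}.
Proof.
move=> mf mf' ff' [ig wg] [ig' wg'].
have coord i : {ae lambda, forall x, g x i ord0 = g' x i ord0}.
  pose G x := g x i ord0 - g' x i ord0.
  have mG : measurable_fun setT G.
    by apply: measurable_funB; [exact: (ig i).1|exact: (ig' i).1].
  suff : {ae lambda, forall x, G x = 0}.
    by apply: filterS => x /eqP; rewrite subr_eq0 => /eqP.
  apply: (fundamental_lemma_boxes mG).
    move=> c; have -> : EFin \o G =
        ((EFin \o (fun x => g x i ord0)) \- (EFin \o (fun x => g' x i ord0)))%E.
      by apply/funext => x /=.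
    by apply: integrableB; [exact: measurable_cube|exact: (ig i).2|exact: (ig' i).2].
  move=> a b k; have pb := flat_poly_bump a b k.
  have supp x : bump a b k x != 0 -> cube (\sum_i (`|a i ord0| + `|b i ord0|)) x.
    by move=> /bump_supp; exact: box_sub_cube.
  have cb := flat_poly_continuous pb.
  transitivity (\int[lambda]_x ((g x i ord0 * bump a b k x)%:E -
      (g' x i ord0 * bump a b k x)%:E))%E.
    by apply: eq_integral => x _; rewrite -EFinB mulrBl.
  have I1 := locally_integrable_mul (ig i) cb supp.
  have I2 := locally_integrable_mul (ig' i) cb supp.
  rewrite integralB//.
  have e : (\int[lambda]_x (g x i ord0 * bump a b k x)%:E =
      \int[lambda]_x (g' x i ord0 * bump a b k x)%:E)%E.
    apply: oppe_inj; rewrite -(wg i _ _ pb supp) -(wg' i _ _ pb supp).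
    by apply: integral_ae_eq_mul => //; exact: measurable_partial.
  by rewrite e subee//; exact: integrable_fin_num.
have : {ae lambda, forall x i, g x i ord0 = g' x i ord0}.
  by apply: filter_forall => i; exact: coord.
apply: filterS => x h; apply/matrixP => i j; rewrite (ord1 j); exact: h.
Qed.

(** Change of variables by T in the integral against phi, which becomes a test
    function again after composition with the inverse of T; the chain rule
    produces the matrix T^T. *)
Lemma tested_gradient_orthogonal (T : 'M[R]_n) f g : orthogonal_mx T ->
  locally_integrable f -> tested_gradient f g ->
  tested_gradient (fun x => f (T *m x)) (fun x => T^T *m g (T *m x)).
Proof.
move=> oT lf [ig wg].
have oT' := orthogonal_mxT oT.
have TK x : T *m (T^T *m x) = x :> V by rewrite mulmxA (mulmx1C oT) mul1mx.
have T'K x : T^T *m (T *m x) = x :> V by rewrite mulmxA oT mul1mx.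
have igT j := locally_integrable_orthogonal oT (ig j).
have gE i x : (T^T *m g (T *m x)) i ord0 = \sum_j T j i * g (T *m x) j ord0.
  by rewrite mxE; apply: eq_bigr => j _; rewrite mxE.
split => [i|i phi c pphi supp].
  have mi : measurable_fun setT (fun x => (T^T *m g (T *m x)) i ord0).
    apply: (eq_measurable_fun (fun x => \sum_j T j i * g (T *m x) j ord0)).
      by move=> x _; rewrite gE.
    by apply: measurable_sum => j; apply: measurable_funM => //; exact: (igT j).1.
  split => // c.
  have -> : EFin \o (fun x => (T^T *m g (T *m x)) i ord0) =
      (fun x => \sum_j ((T j i)%:E * (EFin \o (fun x => g (T *m x) j ord0)) x))%E.
    by apply/funext => x /=; rewrite gE sumEFin.
  apply: integrable_sum; first exact: measurable_cube.
  move=> j _; apply: integrableZl; first exact: measurable_cube.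
  exact: (igT j).2.
pose psi := fun y => phi (T^T *m y).
have ppsi : flat_poly psi by exact: flat_poly_linear.
have spsi x : psi x != 0 -> cube (n%:R * c) x.
  by move=> /supp /(cube_orthogonal oT); rewrite TK.
have phiE : phi = fun x => psi (T *m x) by apply/funext => x; rewrite /psi T'K.
have cphi := flat_poly_continuous pphi.
have cpsi := flat_poly_continuous ppsi.
have mphi := continuous_mx_measurable cphi.
have mpsi := continuous_mx_measurable cpsi.
have [mf _] := lf.
have cpart j : continuous (partial j psi).
  by apply: flat_poly_continuous; have [_ ] := flat_poly_smooth ppsi; apply.
have ifpart j : lambda.-integrable setT (fun y => (f y * partial j psi y)%:E).
  exact: locally_integrable_mul lf (cpart j) (partial_supp (i := j) spsi).
transitivity (\int[lambda]_y (\sum_j (T j i)%:E * (f y * partial j psi y)%:E))%E.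
  rewrite -[RHS](integral_orthogonal oT); last first.
        apply: emeasurable_sum => j; apply: emeasurable_funM => //.
    by have /integrableP[] := ifpart j.
  apply: eq_integral => x _; rewrite {1}phiE partial_linear// mulr_sumr -sumEFin.
  by apply: eq_bigr => j _; rewrite -EFinM; congr EFin; ring.
rewrite integral_sum//; last by move=> j; apply: integrableZl => //; exact: ifpart.
transitivity (\sum_j (T j i)%:E * - \int[lambda]_y (g y j ord0 * psi y)%:E)%E.
  apply: eq_bigr => j _; rewrite integralZl//; congr (_ * _)%E.
  exact: wg ppsi spsi.
have igpsi j := locally_integrable_mul (ig j) cpsi spsi.
have igphi j := locally_integrable_mul (igT j) cphi supp.
transitivity (- \sum_j (T j i)%:E * \int[lambda]_x (g (T *m x) j ord0 * phi x)%:E)%E.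
  under eq_bigr do rewrite muleN.
  rewrite fin_num_sumeN; last first.
    by move=> j _; rewrite fin_numM//; apply: integrable_fin_num => //; exact: igpsi.
  congr (- _)%E; apply: eq_bigr => j _; congr (_ * _)%E.
  rewrite -[LHS](integral_orthogonal oT); last by have /integrableP[] := igpsi j.
  by apply: eq_integral => x _; rewrite /psi T'K.
congr (- _)%E.
transitivity (\int[lambda]_x (\sum_j (T j i)%:E * (g (T *m x) j ord0 * phi x)%:E))%E.
  rewrite integral_sum//; last by move=> j; apply: integrableZl => //; exact: igphi.
  by apply: eq_bigr => j _; rewrite integralZl.
apply: eq_integral => x _; rewrite gE mulr_suml -sumEFin.
by apply: eq_bigr => j _; rewrite -EFinM mulrA.
Qed.

End tested_gradient.

(** * Energies of functions *)

Section gradient_energy.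
Variables (R : realType) (n : nat).
Local Notation V := 'cV[R]_n.
Local Notation lambda := (@lebesgue_mx R n 1).
Implicit Types (f : V -> R) (g : V -> V) (p : R).

Lemma tested_gradient0 : tested_gradient (cst 0 : V -> R) (fun=> 0).
Proof.
have e i : (fun x : V => (0 : V) i ord0) = cst 0 by apply/funext => x; rewrite mxE.
split => [i|i phi c _ _].
  rewrite e; split; first exact: measurable_cst.
  by move=> c; exact: integrable0.
rewrite !integral0_eq ?oppe0// => x _; first by rewrite mxE mul0r.
by rewrite mul0r.
Qed.

Lemma measurable_weak_gradient f g : weak_gradient f g -> measurable_fun setT g.
Proof. by move=> [mg _ _]; apply: measurable_to_mx => i j; rewrite (ord1 j); exact: mg. Qed.

Lemma weak_gradient0 f g : measurable_fun setT f -> weak_gradient f g ->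
  {ae lambda, forall x, f x = 0} -> {ae lambda, forall x, g x = 0}.
Proof.
move=> mf wg f0.
have m0 : measurable_fun setT (cst 0 : V -> R) by exact: measurable_cst.
have e : {ae lambda, forall x, f x = (cst 0 : V -> R) x} by [].
have := tested_gradient_unique mf m0 e (weak_gradient_tested wg) tested_gradient0.
by [].
Qed.

(** Both sides are tested gradients of functions that are almost everywhere
    equal. *)
Lemma radially_symmetric_gradient f g (T : 'M[R]_n) : locally_integrable f ->
  weak_gradient f g -> radially_symmetric f -> orthogonal_mx T ->
  {ae lambda, forall x, T^T *m g (T *m x) = g x}.
Proof.
move=> lf wg fT oT; have tg := weak_gradient_tested wg.
have mfT := (locally_integrable_orthogonal oT lf).1.
exact: (tested_gradient_unique mfT lf.1 (fT T oT) (tested_gradient_orthogonal oT lf tg) tg).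
Qed.

Lemma measurable_enorm_powR d (Z : measurableType d) (u : Z -> V) p :
  measurable_fun setT u -> measurable_fun setT (fun z => (enorm (u z) `^ p)%:E).
Proof.
move=> mu; apply/measurable_EFinP; apply: (@measurableT_comp _ _ _ _ _ _ (@powR R ^~ p)).
  exact: measurable_powR.
exact: (measurableT_comp (@measurable_enorm R n 1) mu).
Qed.

Lemma enorm_powR_le_sum p (x : V) : 1 <= p ->
  enorm x `^ p <= n%:R `^ p * \sum_i `|x i ord0| `^ p.
Proof.
move=> p1; have p0 : 0 < p by exact: lt_le_trans p1.
have s0 : 0 <= \sum_i `|x i ord0| `^ p by apply: sumr_ge0 => i _; exact: powR_ge0.
set s := \sum_i _ in s0 *.
(* each coordinate is at most the l^p norm, and there are n of them *)
have coord i : `|x i ord0| <= s `^ p^-1.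
  rewrite -[leLHS]powRr1// -(mulfV (lt0r_neq0 p0)) powRrM.
  apply: ge0_ler_powR; rewrite ?nnegrE ?powR_ge0 ?invr_ge0 ?(ltW p0)//.
  rewrite /s (bigD1 i)//= lerDl; apply: sumr_ge0 => j _; exact: powR_ge0.
have le : enorm x <= n%:R * s `^ p^-1.
  apply: (le_trans (enorm_le_sum x)).
  apply: (@le_trans _ _ (\sum_(i < n) s `^ p^-1)).
    by apply: ler_sum => i _; rewrite big_ord1.
  by rewrite sumr_const card_ord mulr_natl.
have sE : s = (s `^ p^-1) `^ p by rewrite -powRrM mulVf ?gt_eqF// powRr1.
rewrite [in leRHS]sE -powRM ?powR_ge0//.
by apply: ge0_ler_powR; rewrite ?nnegrE ?enorm_ge0 ?mulr_ge0 ?powR_ge0 ?(ltW p0).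
Qed.

(** Membership in W^{1,p} provides some weak gradient with finite norm, and g
    agrees with it almost everywhere. *)
Lemma gradient_energy_lty p f g : 1 <= p -> W1p p f -> weak_gradient f g ->
  (\int[lambda]_x (enorm (g x) `^ p)%:E < +oo)%E.
Proof.
move=> p1 [Lf [g' wg' Lg']] wg.
have p0 : p != 0 by rewrite gt_eqF// (lt_le_trans _ p1).
have mg := measurable_weak_gradient wg; have mg' := measurable_weak_gradient wg'.
have mf := (Lfun_locally_integrable p1 Lf).1.
have gg' : {ae lambda, forall x, g x = g' x}.
  apply: (tested_gradient_unique mf mf _ (weak_gradient_tested wg) (weak_gradient_tested wg')).
  exact: nearW.
have -> : (\int[lambda]_x (enorm (g x) `^ p)%:E = \int[lambda]_x (enorm (g' x) `^ p)%:E)%E.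
  apply: ge0_ae_eq_integral => //; try exact: measurable_enorm_powR.
  - by move=> x _; rewrite lee_fin powR_ge0.
  - by move=> x _; rewrite lee_fin powR_ge0.
  by apply: filterS gg' => x -> _.
have mc i : measurable_fun setT (fun x => (`|g' x i ord0| `^ p)%:E).
  apply/measurable_EFinP; apply: (@measurableT_comp _ _ _ _ _ _ (@powR R ^~ p)).
    exact: measurable_powR.
  by apply: measurableT_comp => //; have [m_ _ _] := wg'; exact: m_.
apply: (@le_lt_trans _ _ (\int[lambda]_x ((n%:R `^ p)%:E *
    \sum_i (`|g' x i ord0| `^ p)%:E))%E).
  apply: ge0_le_integral => //.
  - by move=> x _; rewrite lee_fin powR_ge0.
  - exact: measurable_enorm_powR.
  - by apply: emeasurable_funM => //; exact: emeasurable_sum.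
  - by move=> x _; rewrite sumEFin -EFinM lee_fin; exact: enorm_powR_le_sum.
rewrite ge0_integralZl//; first last.
- by move=> x _; apply: sume_ge0 => i _; rewrite lee_fin powR_ge0.
- exact: emeasurable_sum.
rewrite ge0_integral_sum//.
rewrite lte_mul_pinfty ?lee_fin ?powR_ge0//.
by apply: lte_sum_pinfty => i _; exact: Lfun_integral_powR_lty.
Qed.

End gradient_energy.

(** The kernel at T theta only sees T^t g(z).  As the field T^t g(T x) agrees with
    g almost everywhere, the change of variables z = T x concludes. *)
Lemma kernel_mean_radial (R : realType) (n m : nat) (p : R) (Q : set 'rV[R]_m)
    (f : 'cV[R]_n -> R) (g : 'cV[R]_n -> 'cV[R]_n) :
  convex_body Q -> Q 0 -> locally_integrable f -> weak_gradient f g ->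
  radially_symmetric f -> forall (T : 'M[R]_n) theta, orthogonal_mx T ->
  kernel_mean p Q lebesgue_mx g (T *m theta) = kernel_mean p Q lebesgue_mx g theta.
Proof.
move=> Qb Q0 lf wg fT T theta oT; have mg := measurable_weak_gradient wg.
have mk u th : measurable_fun setT u ->
    measurable_fun setT (fun x : 'cV[R]_n => (pkernel p Q (u x : 'cV[R]_n) th)%:E).
  move=> mu; apply/measurable_EFinP.
  exact: (measurableT_comp (measurable_pkernel1 p Qb Q0 th) mu).
have mTg : measurable_fun setT (fun x => T^T *m g x).
  exact: (measurableT_comp (@measurable_mx_mull R n 1 T^T) mg).
have k0 (u : 'cV[R]_n -> 'cV[R]_n) th x : (0 <= (pkernel p Q (u x) th)%:E)%E.
  by rewrite lee_fin pkernel_ge0.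
rewrite /kernel_mean.
transitivity (\int[lebesgue_mx]_x (pkernel p Q (T^T *m g x) theta)%:E)%E.
  apply: eq_integral => x _; congr EFin.
  rewrite -(pkernel_orthogonal p Q (T^T *m g x) theta oT); congr pkernel.
  by rewrite mulmxA (mulmx1C oT) mul1mx.
rewrite -(ge0_integral_lebesgue_mx_orthogonal oT (mk _ theta mTg) (k0 _ theta)).
apply: ge0_ae_eq_integral => //.
- apply: mk; exact: (measurableT_comp mTg (@measurable_mx_mull R n 1 T)).
- exact: (mk g theta mg).
- by apply: filterS (radially_symmetric_gradient lf wg fT oT) => x -> _.
Qed.

Lemma affine_energy_Lnorm (R : realType) (n m : nat) (p : R) (Q : set 'rV[R]_m)
    (f : 'cV[R]_n -> R) (g : 'cV[R]_n -> 'cV[R]_n) :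
  (0 < n)%N -> (0 < m)%N -> 1 <= p -> convex_body Q -> Q 0 ->
  W1p p f -> weak_gradient f g ->
  (affine_energy p Q f g <= 'N[lebesgue_mx]_(p%:E)[EFin \o (enorm \o g)])%E /\
  (radially_symmetric f ->
   (affine_energy p Q f g = 'N[lebesgue_mx]_(p%:E)[EFin \o (enorm \o g)])%E).
Proof.
move=> n0 m0 p1 Qb Q0 wf wg.
have p0 : 0 < p by exact: lt_le_trans p1.
have mg := measurable_weak_gradient wg.
have lf := Lfun_locally_integrable p1 wf.1.
pose mass : R := fine (\int[lebesgue_mx]_x (enorm (g x) `^ p)%:E)%E.
have massE : (\int[lebesgue_mx]_x (enorm (g x) `^ p)%:E = mass%:E)%E.
  rewrite /mass fineK// ge0_fin_numE; first exact: gradient_energy_lty wf wg.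
  by apply: integral_ge0 => x _; rewrite lee_fin powR_ge0.
have -> : ('N[lebesgue_mx]_(p%:E)[EFin \o (enorm \o g)] = (mass `^ p^-1)%:E)%E.
  rewrite unlock -poweR_EFin -massE; congr poweR.
  apply: eq_integral => x _; rewrite /= ger0_norm ?enorm_ge0//.
rewrite (_ : affine_energy p Q f g = energy p Q f (kernel_mean p Q lebesgue_mx g))//.
split; first exact: (energy_le n0 m0 p1 Qb Q0 mg massE).
move=> fT; apply: (energy_eq n0 m0 p1 Qb Q0 mg massE) => [f0|].
  apply: EFin_inj; rewrite -massE.
  transitivity (\int[@lebesgue_mx R n 1]_(x in setT) (cst 0 x))%E; last by rewrite integral0.
  apply: ge0_ae_eq_integral => //.
  - exact: measurable_enorm_powR.
  - by move=> x _; rewrite lee_fin powR_ge0.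
  - apply: filterS (weak_gradient0 lf.1 wg f0) => x -> _.
    by rewrite enorm0 powR0// gt_eqF.
exact: (kernel_mean_radial p Qb Q0 lf wg fT).
Qed.

Lemma affine_energy_BV_le (R : realType) (n m : nat) (Q : set 'rV[R]_m)
    (f : 'cV[R]_n -> R) (mu : {finite_measure set 'cV[R]_n -> \bar R})
    (s : 'cV[R]_n -> 'cV[R]_n) :
  (0 < n)%N -> (0 < m)%N -> convex_body Q -> Q 0 ->
  measurable_fun setT s -> {ae mu, forall x, enorm (s x) = 1} ->
  (affine_energy_BV Q f mu s <= mu setT)%E.
Proof.
move=> n0 m0 Qb Q0 ms s1.
have muE : (fine (mu setT))%:E = mu setT by rewrite fineK// fin_num_measure.
have massE : (\int[mu]_x (enorm (s x) `^ 1)%:E = (fine (mu setT))%:E)%E.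
  rewrite muE (_ : mu setT = \int[mu]_(x in setT) (cst 1 x))%E; last first.
    by rewrite integral_cst// mul1e.
  apply: ge0_ae_eq_integral => //.
  - exact: measurable_enorm_powR.
  - by move=> x _; rewrite lee_fin powR_ge0.
  - by apply: filterS s1 => x -> _; rewrite powR1.
have -> : affine_energy_BV Q f mu s = energy 1 Q f (kernel_mean 1 Q mu s).
  rewrite /affine_energy_BV; congr energy; apply/funext => theta.
  apply: eq_integral => x _; congr EFin; rewrite pkernelE powRr1//.
  exact: support_fun_ge0.
apply: le_trans (energy_le n0 m0 (lexx 1) Qb Q0 ms massE f) _.
have mu0 : 0 <= fine (mu setT) by rewrite fine_ge0.
by rewrite invr1 (powRr1 mu0) muE.
Qed.

Theorem theorem1p2 (R : realType) (n m : nat) (hn : (0 < n)%N) (hm : (0 < m)%N) :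
  (forall (p : R) (f : 'cV[R]_n -> R) (g : 'cV[R]_n -> 'cV[R]_n),
     1 <= p -> W1p p f -> weak_gradient f g ->
     forall Q : set 'rV[R]_m, convex_body Q -> Q 0 ->
       (affine_energy p Q f g <=
          'N[lebesgue_mx]_(p%:E)[EFin \o (enorm \o g)])%E /\
       (radially_symmetric f ->
        (affine_energy p Q f g =
           'N[lebesgue_mx]_(p%:E)[EFin \o (enorm \o g)])%E)) /\
  (forall (f : 'cV[R]_n -> R) (mu : {finite_measure set 'cV[R]_n -> \bar R})
          (s : 'cV[R]_n -> 'cV[R]_n),
     BV f -> total_variation_decomposition f mu s ->
     forall Q : set 'rV[R]_m, convex_body Q -> Q 0 ->
       (affine_energy_BV Q f mu s <= mu setT)%E).
Proof.
split=> [p f g p1 wf wg Q Qb Q0|f mu s _ [ms s1 _] Q Qb Q0].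
  exact: affine_energy_Lnorm.
exact: affine_energy_BV_le.
Qed.
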